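(* (Newton–Leibniz.) Let $t,t_1,t_2$ be terms of the calculus and $x,y$ variables such that $t$ contains no free occurrence of $x$, and such that both $\int_{t_1}^{t_2}\frac{\partial t}{\partial y}|_{x}\,dx$ and $t[t_2/y]\ominus t[t_1/y]$ are well-typed and weak-normalizable. Then, in the sense of term equality, $$\int_{t_1}^{t_2}\frac{\partial t}{\partial y}\Big|_{x}\,dx = t[t_2/y]\ominus t[t_1/y].$$
   Context: Types. $\mathsf B$ denotes base types (such as $\mathbb R,\mathbb C$). Types: $T::=\mathsf B\mid (T_1,\dots,T_n)\mid T\to T\mid T+T$. Interpretable types: $iB::=\mathsf B\mid iB\to iB$. Addable types: $T^*::=\mathsf B\mid (T^*,\dots,T^* )\mid T\to T^*$. Notation: $\frac{\partial T}{\partial \mathsf B}=T$, $\frac{\partial T}{\partial (T_1,\dots,T_n)}=(\frac{\partial T}{\partial T_1},\dots,\frac{\partial T}{\partial T_n})$; $\frac{\partial T}{\partial S}$ is undefined if $S$ is a function or sum type. Terms. $t::=c\mid x\mid \lambda x{:}T.t\mid t\,t\mid (t_1,\dots,t_n)\mid \pi_j t\mid t\oplus t\mid t\ominus t\mid t*t\mid \frac{\partial t}{\partial x}|_{t}\mid \int_{t}^{t}t\,dx\mid inl~t\mid inr~t\mid case~t~of~inl~x_1\Rightarrow t\mid inr~x_2\Rightarrow t\mid \mathit{fix}~t$, where constants $c$ have interpretable types; $x$ is bound in $t_1$ in $\frac{\partial t_1}{\partial x}|_{t_2}$ and in $t$ in $\int_{t_1}^{t_2}t\,dx$. Terms are taken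 up to $\alpha$-equivalence. Typing. The usual rules for constants, variables, abstraction, application, tuples, projections, injections, case; $\mathit{fix}~t:T$ if $t:T\to T$; $t_1\oplus t_2,\ t_1\ominus t_2:T^*$ if $t_1,t_2:T^*$; $\Gamma\vdash \frac{\partial t_2}{\partial x}|_{t_1}:\frac{\partial T_2}{\partial T_1}$ if $\Gamma\vdash t_1:T_1$ and $\Gamma,x{:}T_1\vdash t_2:T_2$; $t_1*t_2:T^*$ if $t_1:\frac{\partial T^*}{\partial T}$ and $t_2:T$; $\Gamma\vdash\int_{t_1}^{t_2}t\,dx:T^*$ if $\Gamma\vdash t_1,t_2:T$ and $\Gamma,x{:}T\vdash t:\frac{\partial T^*}{\partial T}$. Reduction $\rightarrow$ is full reduction: any of the following rules may be applied to any subterm (also under binders). $(\lambda x{:}T.t)t_1\rightarrow t[t_1/x]$; $\pi_j(t_1,\dots,t_n)\rightarrow t_j$; $case~(inl~t)~of~inl~x_1\Rightarrow t_1\mid inr~x_2\Rightarrow t_2\rightarrow t_1[t/x_1]$; $case~(inr~t)~of~inl~x_1\Rightarrow t_1\mid inr~x_2\Rightarrow t_2\rightarrow t_2[t/x_2]$; $\mathit{fix}~f\rightarrow f(\mathit{fix}~f)$. Derivative, if $t_0:\mathsf B$: $\frac{\partial(t_1,\dots,t_n)}{\partial x}|_{t_0}\rightarrow(\frac{\partial t_1}{\partial x}|_{t_0},\dots,\frac{\partial t_n}{\partial x}|_{t_0})$; $\frac{\partial\, inl/inr~t}{\partial x}|_{t_0}\rightarrow inl/inr~\frac{\partial t}{\partial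 x}|_{t_0}$; $\frac{\partial(\lambda y:T.t)}{\partial x}|_{t_0}\rightarrow\lambda y{:}T.\frac{\partial t}{\partial x}|_{t_0}$. At a tuple: $\frac{\partial t}{\partial x}|_{(t_1,\dots,t_n)}\rightarrow(\frac{\partial t[t_{1*}/x]}{\partial x_1}|_{t_1},\dots,\frac{\partial t[t_{n*}/x]}{\partial x_n}|_{t_n})$ with $t_{i*}=(t_1,\dots,t_{i-1},x_i,t_{i+1},\dots,t_n)$, $x_i$ fresh. Integral, if $t_1,t_2:\mathsf B$: $\int_{t_1}^{t_2}(s_1,\dots,s_n)dx\rightarrow(\int_{t_1}^{t_2}s_1dx,\dots,\int_{t_1}^{t_2}s_ndx)$; $\int_{t_1}^{t_2}inl/inr~t\,dx\rightarrow inl/inr\int_{t_1}^{t_2}t\,dx$; $\int_{t_1}^{t_2}\lambda y{:}T.t\,dx\rightarrow\lambda y{:}T.\int_{t_1}^{t_2}t\,dx$. Between tuples: $\int_{(t_{11},\dots,t_{1n})}^{(t_{21},\dots,t_{2n})}t\,dx\rightarrow\int_{t_{11}}^{t_{21}}\pi_1(t[t_{1*}/x])dx_1\oplus\cdots\oplus\int_{t_{1n}}^{t_{2n}}\pi_n(t[t_{n*}/x])dx_n$ with $t_{i*}=(t_{21},\dots,t_{2(i-1)},x_i,t_{1(i+1)},\dots,t_{1n})$. For $\odot\in\{\oplus,\ominus\}$: $(t_{11},\dots,t_{1n})\odot(t_{21},\dots,t_{2n})\rightarrow(t_{11}\odot t_{21},\dots,t_{1n}\odot t_{2n})$; $(\lambda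 x{:}T.t_1)\odot(\lambda y{:}T.t_2)\rightarrow\lambda x{:}T.(t_1\odot t_2[x/y])$. Multiplication, if $t_0:\mathsf B$: $(t_1,\dots,t_n)*t_0\rightarrow(t_1*t_0,\dots,t_n*t_0)$; $(\lambda x{:}T.t)*t_0\rightarrow\lambda x{:}T.(t*t_0)$; $(inl/inr~t)*t_0\rightarrow inl/inr~(t*t_0)$. Between tuples: $(t_{11},\dots,t_{1n})*(t_{21},\dots,t_{2n})\rightarrow(t_{11}*t_{21})\oplus\cdots\oplus(t_{1n}*t_{2n})$. Normal forms. $\mathit{nf}::=\mathit{nb}\mid(\mathit{nf},\dots,\mathit{nf})\mid\lambda x{:}T.t$ (with $t$ not further reducible) $\mid inl/inr~\mathit{nf}$, where $\mathit{nb}::=c\mid x$ (constants and variables of interpretable types) $\mid\mathit{nb}~\mathit{nf}\mid\mathit{nb}\oplus\mathit{nf}\mid\mathit{nf}\oplus\mathit{nb}\mid\mathit{nb}\ominus\mathit{nf}\mid\mathit{nf}\ominus\mathit{nb}\mid\mathit{nb}*\mathit{nb}\mid\frac{\partial\,\mathit{nb}}{\partial x}|_{\mathit{nb}}\mid\int_{\mathit{nb}}^{\mathit{nb}}\mathit{nb}\,dx$. A term is weak-normalizable if it reduces to a normal form (which is then unique, reduction being confluent). Base types. There is a default well-defined interpreter evaluating terms built from constants and variables of interpretable types by abstraction, application, $\oplus,\ominus,*$, derivative and integration (under an environment mapping variables to constants). On each base type $\oplus$ and $*$ are associative and commutative, $(a\oplus b)\ominus b=a$, $(a\ominus b)\oplus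 b=a$, and $a*(b\oplus c)=a*b\oplus a*c$. Standing assumption: on base types, the Newton–Leibniz formula, the (multivariable) Chain Rule and Taylor's theorem hold for all primitive functions and their closures under addition, subtraction, multiplication, derivative and integration; e.g. $\int_{a_1}^{a_2}\frac{\partial s}{\partial y}|_x dx=s[a_2/y]\ominus s[a_1/y]$ when $s,a_1,a_2$ are normal forms of base type. Term equality. Open terms: $t_1=t_2$ iff for the free variables $x_1,\dots,x_n$ of $t_1,t_2$ and all closed weak-normalizable terms $u_i$ of the same type as $x_i$, $t_1[u_1/x_1,\dots,u_n/x_n]=t_2[u_1/x_1,\dots,u_n/x_n]$. Closed terms: $t_1=t_2$ iff their normal forms are equal, where normal forms $n_1,n_2$ are equal if: (1) $n_1,n_2$ have the same interpretable type and are equal under the base type interpretation; or (2) $n_1=(t_1,\dots,t_n)$, $n_2=(t_1',\dots,t_n')$ and $t_j=t_j'$ for all $j$; or (3) $n_1=\lambda x{:}T.t$, $n_2=\lambda y{:}T.t'$ and $n_1~x$ equals $n_2~x$; or (4) $n_1=inl~t_1'$, $n_2=inl~t_2'$ with $t_1'=t_2'$; or (5) the same with $inr$. Equality between unnormalizable terms is undefined. *)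

(* Defs.v *)
From mathcomp Require Import all_boot.
From Stdlib Require List.

Set Implicit Arguments.
Unset Strict Implicit.
Unset Printing Implicit Defensive.

(* [TTup T Ts] is the type of tuples (T, Ts_0, ..., Ts_(n-1)): tuples are
   non-empty. *)
Inductive type (B : Type) : Type :=
| TBase of B
| TTup of type B & seq (type B)
| TArr of type B & type B
| TSum of type B & type B.

(* Interpretable types. *)
Inductive itype (B : Type) : Type :=
| IBase of B
| IArr of itype B & itype B.

Fixpoint ity {B : Type} (A : itype B) : type B :=
  match A with
  | IBase b => TBase b
  | IArr A1 A2 => TArr (ity A1) (ity A2)
  end.

(* The types T* closed under addition. *)
Fixpoint addable {B : Type} (T : type B) : bool :=
  match T with
  | TBase _ => true
  | TTup T1 Ts => addable T1 && all addable Ts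
  | TArr _ T2 => addable T2
  | TSum _ _ => false
  end.

(* dT/dS is [dty T S], and it is defined iff [diffable S]; the value of [dty]
   at other S is junk, so [dty T S] is only used along with [diffable S]. *)
Fixpoint diffable {B : Type} (S : type B) : bool :=
  match S with
  | TBase _ => true
  | TTup S1 Ss => diffable S1 && all diffable Ss
  | _ => false
  end.

Fixpoint dty {B : Type} (T S : type B) : type B :=
  match S with
  | TTup S1 Ss => TTup (dty T S1) (map (dty T) Ss)
  | _ => T
  end.

Record signature := Signature {
  base : Type;
  const : itype base -> Type
}.

(* Terms up to alpha-equivalence, with de Bruijn indices.
   - [Lam T t], [Der t t0] (the derivative of t at t0) and [Int t1 t2 t] (the
     integral of t from t1 to t2) bind index 0 in t; [Case t t1 t2] binds
     index 0 in t1 and in t2.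
   - Projections are numbered from 0.
   - [Inl T2 t] and [Inr T1 t] carry the type of the missing summand, so that
     a term has at most one type in a given context; the side conditions
     "if t0 : B" of the reduction rules rely on it. *)
Inductive term (S : signature) : Type :=
| Var of nat
| Cst (A : itype (base S)) of const A
| Lam of type (base S) & term S
| App of term S & term S
| Tup of seq (term S)
| Proj of nat & term S
| Plus of term S & term S
| Minus of term S & term S
| Times of term S & term S
| Der of term S & term S
| Int of term S & term S & term S
| Inl of type (base S) & term S
| Inr of type (base S) & term S
| Case of term S & term S & term S
| Fix of term S.

Arguments Var {S} _.
Arguments Cst {S A} _.

Definition upren (r : nat -> nat) (i : nat) : nat :=
  if i is j.+1 then (r j).+1 else 0.

Fixpoint rename {S : signature} (r : nat -> nat) (t : term S) : term S :=
  match t with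
  | Var i => Var (r i)
  | Cst A c => Cst c
  | Lam T t => Lam T (rename (upren r) t)
  | App t u => App (rename r t) (rename r u)
  | Tup ts => Tup (map (rename r) ts)
  | Proj j t => Proj j (rename r t)
  | Plus t u => Plus (rename r t) (rename r u)
  | Minus t u => Minus (rename r t) (rename r u)
  | Times t u => Times (rename r t) (rename r u)
  | Der t t0 => Der (rename (upren r) t) (rename r t0)
  | Int t1 t2 t => Int (rename r t1) (rename r t2) (rename (upren r) t)
  | Inl T t => Inl T (rename r t)
  | Inr T t => Inr T (rename r t)
  | Case t t1 t2 =>
      Case (rename r t) (rename (upren r) t1) (rename (upren r) t2)
  | Fix t => Fix (rename r t)
  end.

Definition shift {S : signature} (t : term S) : term S := rename succn t.

(* Exchanges the two innermost variables. *)
Definition swap {S : signature} (t : term S) : term S :=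
  rename (fun i => match i with 0 => 1 | 1 => 0 | _ => i end) t.

Definition upsubst {S : signature} (s : nat -> term S) (i : nat) : term S :=
  if i is j.+1 then shift (s j) else Var 0.

Fixpoint subst {S : signature} (s : nat -> term S) (t : term S) : term S :=
  match t with
  | Var i => s i
  | Cst A c => Cst c
  | Lam T t => Lam T (subst (upsubst s) t)
  | App t u => App (subst s t) (subst s u)
  | Tup ts => Tup (map (subst s) ts)
  | Proj j t => Proj j (subst s t)
  | Plus t u => Plus (subst s t) (subst s u)
  | Minus t u => Minus (subst s t) (subst s u)
  | Times t u => Times (subst s t) (subst s u)
  | Der t t0 => Der (subst (upsubst s) t) (subst s t0)
  | Int t1 t2 t => Int (subst s t1) (subst s t2) (subst (upsubst s) t)
  | Inl T t => Inl T (subst s t)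
  | Inr T t => Inr T (subst s t)
  | Case t t1 t2 =>
      Case (subst s t) (subst (upsubst s) t1) (subst (upsubst s) t2)
  | Fix t => Fix (subst s t)
  end.

(* t[u/x], for x the variable of index 0. *)
Definition inst {S : signature} (t u : term S) : term S :=
  subst (fun i => if i is j.+1 then Var j else u) t.

(* t[u/x], for x the variable of index 0 and u a term in which index 0 is a
   fresh variable that takes the place of x. *)
Definition replace {S : signature} (t u : term S) : term S :=
  subst (fun i => if i is j.+1 then Var j.+1 else u) t.

Fixpoint free_in {S : signature} (i : nat) (t : term S) : bool :=
  match t with
  | Var j => i == j
  | Cst _ _ => false
  | Lam _ t => free_in i.+1 t
  | App t u | Plus t u | Minus t u | Times t u => free_in i t || free_in i u
  | Tup ts => has (free_in i) ts
  | Proj _ t | Inl _ t | Inr _ t | Fix t => free_in i t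
  | Der t t0 => free_in i.+1 t || free_in i t0
  | Int t1 t2 t => [|| free_in i t1, free_in i t2 | free_in i.+1 t]
  | Case t t1 t2 => [|| free_in i t, free_in i.+1 t1 | free_in i.+1 t2]
  end.

Inductive typed {S : signature} (G : seq (type (base S))) :
    term S -> type (base S) -> Prop :=
| T_Var i T : onth G i = Some T -> typed G (Var i) T
| T_Cst (A : itype (base S)) (c : const A) : typed G (Cst c) (ity A)
| T_Lam T1 T2 t : typed (T1 :: G) t T2 -> typed G (Lam T1 t) (TArr T1 T2)
| T_App T1 T2 t u :
    typed G t (TArr T1 T2) -> typed G u T1 -> typed G (App t u) T2
| T_Tup ts T Ts :
    List.Forall2 (typed G) ts (T :: Ts) -> typed G (Tup ts) (TTup T Ts)
| T_Proj j t T Ts U :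
    typed G t (TTup T Ts) -> onth (T :: Ts) j = Some U -> typed G (Proj j t) U
| T_Add t u T :
    addable T -> typed G t T -> typed G u T -> typed G (Plus t u) T
| T_Sub t u T :
    addable T -> typed G t T -> typed G u T -> typed G (Minus t u) T
| T_Mul t u T U :
    addable T -> diffable U -> typed G t (dty T U) -> typed G u U ->
    typed G (Times t u) T
| T_Der t t0 T U :
    diffable U -> typed G t0 U -> typed (U :: G) t T ->
    typed G (Der t t0) (dty T U)
| T_Int t1 t2 t T U :
    addable T -> diffable U -> typed G t1 U -> typed G t2 U ->
    typed (U :: G) t (dty T U) -> typed G (Int t1 t2 t) T
| T_Inl t T1 T2 : typed G t T1 -> typed G (Inl T2 t) (TSum T1 T2)
| T_Inr t T1 T2 : typed G t T2 -> typed G (Inr T1 t) (TSum T1 T2)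
| T_Case t t1 t2 T1 T2 T :
    typed G t (TSum T1 T2) -> typed (T1 :: G) t1 T -> typed (T2 :: G) t2 T ->
    typed G (Case t t1 t2) T
| T_Fix t T : typed G t (TArr T T) -> typed G (Fix t) T.

(* t_1 (+) ... (+) t_n, for n > 0, associated to the left. *)
Definition bigPlus {S : signature} (t : term S) (ts : seq (term S)) : term S :=
  foldl (@Plus S) t ts.

(* The tuple (us_0, ..., us_(i-1), x_i, ts_(i+1), ..., ts_(n-1)), where x_i is
   a fresh variable, of index 0. *)
Definition mixed {S : signature} (i : nat) (us ts : seq (term S)) : term S :=
  Tup (map shift (take i us) ++ Var 0 :: map shift (drop i.+1 ts)).

Definition isBase {S : signature} (G : seq (type (base S))) (t : term S) :
    Prop :=
  exists b, typed G t (TBase b).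

(* One-step full reduction of a term with free variables typed by G; the
   context is needed only for the side conditions "if t : B". *)
Inductive step {S : signature} (G : seq (type (base S))) :
    term S -> term S -> Prop :=
| S_Beta T t u : step G (App (Lam T t) u) (inst t u)
| S_Proj ts j t : onth ts j = Some t -> step G (Proj j (Tup ts)) t
| S_CaseInl T t t1 t2 : step G (Case (Inl T t) t1 t2) (inst t1 t)
| S_CaseInr T t t1 t2 : step G (Case (Inr T t) t1 t2) (inst t2 t)
| S_Fix f : step G (Fix f) (App f (Fix f))
(* derivative *)
| S_DerTup ts t0 : isBase G t0 ->
    step G (Der (Tup ts) t0) (Tup [seq Der t t0 | t <- ts])
| S_DerInl T t t0 : isBase G t0 -> step G (Der (Inl T t) t0) (Inl T (Der t t0))
| S_DerInr T t t0 : isBase G t0 -> step G (Der (Inr T t) t0) (Inr T (Der t t0))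
| S_DerLam T t t0 : isBase G t0 ->
    step G (Der (Lam T t) t0) (Lam T (Der (swap t) (shift t0)))
| S_DerAtTup t ts :
    step G (Der t (Tup ts))
      (Tup [seq Der (replace t (mixed i ts ts)) (nth (Var 0) ts i)
           | i <- iota 0 (size ts)])
(* integral *)
| S_IntTup t1 t2 ts : isBase G t1 -> isBase G t2 ->
    step G (Int t1 t2 (Tup ts)) (Tup [seq Int t1 t2 t | t <- ts])
| S_IntInl T t1 t2 t : isBase G t1 -> isBase G t2 ->
    step G (Int t1 t2 (Inl T t)) (Inl T (Int t1 t2 t))
| S_IntInr T t1 t2 t : isBase G t1 -> isBase G t2 ->
    step G (Int t1 t2 (Inr T t)) (Inr T (Int t1 t2 t))
| S_IntLam T t1 t2 t : isBase G t1 -> isBase G t2 ->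
    step G (Int t1 t2 (Lam T t)) (Lam T (Int (shift t1) (shift t2) (swap t)))
| S_IntBetweenTup t ts1 ts2 s ss :
    size ts1 = size ts2 ->
    [seq Int (nth (Var 0) ts1 i) (nth (Var 0) ts2 i)
           (Proj i (replace t (mixed i ts2 ts1)))
    | i <- iota 0 (size ts1)] = s :: ss ->
    step G (Int (Tup ts1) (Tup ts2) t) (bigPlus s ss)
(* addition and subtraction *)
| S_AddTup ts us : size ts = size us ->
    step G (Plus (Tup ts) (Tup us)) (Tup [seq Plus p.1 p.2 | p <- zip ts us])
| S_AddLam T t u : step G (Plus (Lam T t) (Lam T u)) (Lam T (Plus t u))
| S_SubTup ts us : size ts = size us ->
    step G (Minus (Tup ts) (Tup us)) (Tup [seq Minus p.1 p.2 | p <- zip ts us])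
| S_SubLam T t u : step G (Minus (Lam T t) (Lam T u)) (Lam T (Minus t u))
(* multiplication *)
| S_MulTup ts t0 : isBase G t0 ->
    step G (Times (Tup ts) t0) (Tup [seq Times t t0 | t <- ts])
| S_MulLam T t t0 : isBase G t0 ->
    step G (Times (Lam T t) t0) (Lam T (Times t (shift t0)))
| S_MulInl T t t0 : isBase G t0 ->
    step G (Times (Inl T t) t0) (Inl T (Times t t0))
| S_MulInr T t t0 : isBase G t0 ->
    step G (Times (Inr T t) t0) (Inr T (Times t t0))
| S_MulTupTup ts us s ss :
    size ts = size us ->
    [seq Times p.1 p.2 | p <- zip ts us] = s :: ss ->
    step G (Times (Tup ts) (Tup us)) (bigPlus s ss)
(* congruence *)
| C_Lam T t t' : step (T :: G) t t' -> step G (Lam T t) (Lam T t')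
| C_App1 t t' u : step G t t' -> step G (App t u) (App t' u)
| C_App2 t u u' : step G u u' -> step G (App t u) (App t u')
| C_Tup ts t t' us :
    step G t t' -> step G (Tup (ts ++ t :: us)) (Tup (ts ++ t' :: us))
| C_Proj j t t' : step G t t' -> step G (Proj j t) (Proj j t')
| C_Add1 t t' u : step G t t' -> step G (Plus t u) (Plus t' u)
| C_Add2 t u u' : step G u u' -> step G (Plus t u) (Plus t u')
| C_Sub1 t t' u : step G t t' -> step G (Minus t u) (Minus t' u)
| C_Sub2 t u u' : step G u u' -> step G (Minus t u) (Minus t u')
| C_Mul1 t t' u : step G t t' -> step G (Times t u) (Times t' u)
| C_Mul2 t u u' : step G u u' -> step G (Times t u) (Times t u')
| C_Der1 T t t' t0 :
    typed G t0 T -> step (T :: G) t t' -> step G (Der t t0) (Der t' t0)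
| C_Der2 t t0 t0' : step G t0 t0' -> step G (Der t t0) (Der t t0')
| C_Int1 t1 t1' t2 t : step G t1 t1' -> step G (Int t1 t2 t) (Int t1' t2 t)
| C_Int2 t1 t2 t2' t : step G t2 t2' -> step G (Int t1 t2 t) (Int t1 t2' t)
| C_Int3 T t1 t2 t t' :
    typed G t1 T -> typed G t2 T -> step (T :: G) t t' ->
    step G (Int t1 t2 t) (Int t1 t2 t')
| C_Inl T t t' : step G t t' -> step G (Inl T t) (Inl T t')
| C_Inr T t t' : step G t t' -> step G (Inr T t) (Inr T t')
| C_Case t t' t1 t2 : step G t t' -> step G (Case t t1 t2) (Case t' t1 t2)
| C_Case1 T1 T2 t t1 t1' t2 :
    typed G t (TSum T1 T2) -> step (T1 :: G) t1 t1' ->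
    step G (Case t t1 t2) (Case t t1' t2)
| C_Case2 T1 T2 t t1 t2 t2' :
    typed G t (TSum T1 T2) -> step (T2 :: G) t2 t2' ->
    step G (Case t t1 t2) (Case t t1 t2')
| C_Fix t t' : step G t t' -> step G (Fix t) (Fix t').

Inductive steps {S : signature} (G : seq (type (base S))) (t : term S) :
    term S -> Prop :=
| steps_refl : steps G t t
| steps_step u v : steps G t u -> step G u v -> steps G t v.

Definition irreducible {S : signature} (G : seq (type (base S))) (t : term S) :
    Prop :=
  forall t', ~ step G t t'.

Inductive nf {S : signature} (G : seq (type (base S))) : term S -> Prop :=
| nf_nb t : nb G t -> nf G t
| nf_Tup ts : List.Forall (nf G) ts -> nf G (Tup ts)
| nf_Lam T t : irreducible (T :: G) t -> nf G (Lam T t)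
| nf_Inl T t : nf G t -> nf G (Inl T t)
| nf_Inr T t : nf G t -> nf G (Inr T t)
with nb {S : signature} (G : seq (type (base S))) : term S -> Prop :=
| nb_Cst (A : itype (base S)) (c : const A) : nb G (Cst c)
| nb_Var i A : onth G i = Some (ity A) -> nb G (Var i)
| nb_App t u : nb G t -> nf G u -> nb G (App t u)
| nb_Add1 t u : nb G t -> nf G u -> nb G (Plus t u)
| nb_Add2 t u : nf G t -> nb G u -> nb G (Plus t u)
| nb_Sub1 t u : nb G t -> nf G u -> nb G (Minus t u)
| nb_Sub2 t u : nf G t -> nb G u -> nb G (Minus t u)
| nb_Mul t u : nb G t -> nb G u -> nb G (Times t u)
| nb_Der T t t0 :
    typed G t0 T -> nb (T :: G) t -> nb G t0 -> nb G (Der t t0)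
| nb_Int T t1 t2 t :
    typed G t1 T -> typed G t2 T -> nb G t1 -> nb G t2 -> nb (T :: G) t ->
    nb G (Int t1 t2 t).

Definition weak_normalizable {S : signature} (G : seq (type (base S)))
    (t : term S) : Prop :=
  exists2 n, steps G t n & nf G n.

(* The data of an interpreter.  [dom (IArr A1 A2)] need not contain all the
   functions from [dom A1] to [dom A2]: it stands for the primitive functions
   and their closures, the only ones that [der] and [integ] act on. *)
Record interpretation (S : signature) := Interpretation {
  dom : itype (base S) -> Type;
  app : forall A1 A2, dom (IArr A1 A2) -> dom A1 -> dom A2;
  cval : forall A, const A -> dom A;
  add : forall A, dom A -> dom A -> dom A;
  sub : forall A, dom A -> dom A -> dom A;
  mul : forall A b, dom A -> dom (IBase b) -> dom A;
  der : forall b A, dom (IArr (IBase b) A) -> dom (IBase b) -> dom A;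
  integ : forall b A, dom (IArr (IBase b) A) ->
    dom (IBase b) -> dom (IBase b) -> dom A
}.

Definition value {S : signature} (M : interpretation S) : Type :=
  {A : itype (base S) & dom M A}.

(* The typing context of an environment. *)
Definition env_ctx {S : signature} {M : interpretation S}
    (rho : seq (value M)) : seq (type (base S)) :=
  [seq ity (tag v) | v <- rho].

(* [eval rho t v]: the interpreter maps t to v, of interpretable type A, in the
   environment rho. *)
Inductive eval {S : signature} (M : interpretation S) (rho : seq (value M)) :
    term S -> forall A : itype (base S), dom M A -> Prop :=
| E_Var i A (v : dom M A) :
    onth rho i = Some (Tagged (dom M) v) -> eval rho (Var i) v
| E_Cst A (c : const A) : eval rho (Cst c) (cval M c)
| E_Lam A1 A2 t (f : dom M (IArr A1 A2)) :
    (forall d : dom M A1, eval (Tagged (dom M) d :: rho) t (app f d)) ->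
    eval rho (Lam (ity A1) t) f
| E_App A1 A2 t u (f : dom M (IArr A1 A2)) (d : dom M A1) :
    eval rho t f -> eval rho u d -> eval rho (App t u) (app f d)
| E_Add A t u (v w : dom M A) :
    eval rho t v -> eval rho u w -> eval rho (Plus t u) (add v w)
| E_Sub A t u (v w : dom M A) :
    eval rho t v -> eval rho u w -> eval rho (Minus t u) (sub v w)
| E_Mul A b t u (v : dom M A) (w : dom M (IBase b)) :
    eval rho t v -> eval rho u w -> eval rho (Times t u) (mul v w)
| E_Der b A t t0 (f : dom M (IArr (IBase b) A)) (a : dom M (IBase b)) :
    (forall d : dom M (IBase b),
       eval (Tagged (dom M) d :: rho) t (app f d)) ->
    eval rho t0 a -> eval rho (Der t t0) (der f a)
| E_Int b A t1 t2 t (f : dom M (IArr (IBase b) A)) (a1 a2 : dom M (IBase b)) :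
    eval rho t1 a1 -> eval rho t2 a2 ->
    (forall d : dom M (IBase b),
       eval (Tagged (dom M) d :: rho) t (app f d)) ->
    eval rho (Int t1 t2 t) (integ f a1 a2).

(* The terms the interpreter is meant for. *)
Inductive interpretable_term {S : signature} : term S -> Prop :=
| I_Var i : interpretable_term (Var i)
| I_Cst (A : itype (base S)) (c : const A) : interpretable_term (Cst c)
| I_Lam (A : itype (base S)) t :
    interpretable_term t -> interpretable_term (Lam (ity A) t)
| I_App t u :
    interpretable_term t -> interpretable_term u -> interpretable_term (App t u)
| I_Add t u :
    interpretable_term t -> interpretable_term u ->
    interpretable_term (Plus t u)
| I_Sub t u :
    interpretable_term t -> interpretable_term u ->
    interpretable_term (Minus t u)
| I_Mul t u :
    interpretable_term t -> interpretable_term u ->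
    interpretable_term (Times t u)
| I_Der t t0 :
    interpretable_term t -> interpretable_term t0 ->
    interpretable_term (Der t t0)
| I_Int t1 t2 t :
    interpretable_term t1 -> interpretable_term t2 -> interpretable_term t ->
    interpretable_term (Int t1 t2 t).

(* For t in a context y :: G, [avoid t] is t in the context y :: x :: G.  The
   terms of this form are exactly those in which x does not occur free. *)
Definition avoid {S : signature} (t : term S) : term S :=
  rename (upren succn) t.

(* The integral from t1 to t2 of the derivative of t with respect to y at x,
   with respect to x: index 0 of t is y, and x does not occur free in t. *)
Definition int_der {S : signature} (t1 t2 t : term S) : term S :=
  Int t1 t2 (Der (avoid t) (Var 0)).

(* The standing assumptions on base types.  The chain rule and Taylor's theorem
   are not required. *)
Record base_laws {S : signature} (M : interpretation S) : Prop := BaseLaws {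
  eval_total : forall (rho : seq (value M)) (A : itype (base S)) (t : term S),
    interpretable_term t -> typed (env_ctx rho) t (ity A) ->
    exists v : dom M A, eval rho t v;
  (* functions are extensional, and the operations on them are pointwise, in
     accordance with the reduction rules for abstractions *)
  app_ext : forall A1 A2 (f g : dom M (IArr A1 A2)),
    (forall d, app f d = app g d) -> f = g;
  app_add : forall A1 A2 (f g : dom M (IArr A1 A2)) d,
    app (add f g) d = add (app f d) (app g d);
  app_sub : forall A1 A2 (f g : dom M (IArr A1 A2)) d,
    app (sub f g) d = sub (app f d) (app g d);
  app_mul : forall A1 A2 b (f : dom M (IArr A1 A2)) (a : dom M (IBase b)) d,
    app (mul f a) d = mul (app f d) a;
  app_der : forall b A1 A2 (f : dom M (IArr (IBase b) (IArr A1 A2)))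
      (g : dom M (IArr (IBase b) A2)) d a,
    (forall x, app g x = app (app f x) d) -> app (der f a) d = der g a;
  app_integ : forall b A1 A2 (f : dom M (IArr (IBase b) (IArr A1 A2)))
      (g : dom M (IArr (IBase b) A2)) d a1 a2,
    (forall x, app g x = app (app f x) d) ->
    app (integ f a1 a2) d = integ g a1 a2;
  base_addA : forall b (x y z : dom M (IBase b)),
    add x (add y z) = add (add x y) z;
  base_addC : forall b (x y : dom M (IBase b)), add x y = add y x;
  base_mulA : forall b (x y z : dom M (IBase b)),
    mul x (mul y z) = mul (mul x y) z;
  base_mulC : forall b (x y : dom M (IBase b)), mul x y = mul y x;
  base_addK : forall b (x y : dom M (IBase b)), sub (add x y) y = x;
  base_subK : forall b (x y : dom M (IBase b)), add (sub x y) y = x;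
  base_mulDr : forall b (x y z : dom M (IBase b)),
    mul x (add y z) = add (mul x y) (mul x z);
  newton_leibniz_base : forall (rho : seq (value M)) (b b' : base S)
      (s a1 a2 : term S) (v w : dom M (IBase b')),
    nf (TBase b :: env_ctx rho) s ->
    typed (TBase b :: env_ctx rho) s (TBase b') ->
    nf (env_ctx rho) a1 -> typed (env_ctx rho) a1 (TBase b) ->
    nf (env_ctx rho) a2 -> typed (env_ctx rho) a2 (TBase b) ->
    eval rho (int_der a1 a2 s) v ->
    eval rho (Minus (inst s a2) (inst s a1)) w -> v = w
}.

(* Equality of closed terms, and of their normal forms.  Equality is only
   defined between weak-normalizable terms: it does not hold for others. *)
Inductive closed_eq {S : signature} (M : interpretation S) :
    term S -> term S -> Prop :=
| closed_eq_nf t1 t2 n1 n2 :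
    steps [::] t1 n1 -> nf [::] n1 -> steps [::] t2 n2 -> nf [::] n2 ->
    nf_eq M n1 n2 -> closed_eq M t1 t2
with nf_eq {S : signature} (M : interpretation S) : term S -> term S -> Prop :=
| nf_eq_interp n1 n2 (A : itype (base S)) (v : dom M A) :
    typed [::] n1 (ity A) -> typed [::] n2 (ity A) ->
    eval [::] n1 v -> eval [::] n2 v -> nf_eq M n1 n2
| nf_eq_Tup ts us :
    List.Forall2 (closed_eq M) ts us -> nf_eq M (Tup ts) (Tup us)
| nf_eq_Lam T t t' :
    (forall u, typed [::] u T -> weak_normalizable [::] u ->
       closed_eq M (App (Lam T t) u) (App (Lam T t') u)) ->
    nf_eq M (Lam T t) (Lam T t')
| nf_eq_Inl T t t' : closed_eq M t t' -> nf_eq M (Inl T t) (Inl T t')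
| nf_eq_Inr T t t' : closed_eq M t t' -> nf_eq M (Inr T t) (Inr T t').

(* Equality of terms with free variables typed by G. *)
Definition term_eq {S : signature} (M : interpretation S)
    (G : seq (type (base S))) (t1 t2 : term S) : Prop :=
  forall s : nat -> term S,
    (forall i T, free_in i t1 || free_in i t2 -> onth G i = Some T ->
       typed [::] (s i) T /\ weak_normalizable [::] (s i)) ->
    closed_eq M (subst s t1) (subst s t2).

(* Main.v *)
(* Normal forms contain no fix, and the fix-free calculus is weakly normalizing,
   by reducibility. Typed reduction is confluent, so terms can be compared through
   any of their reducts.

   For limits of base type, integral and derivative are pushed through the tuples
   and abstractions of the normal form of t. What remains has an interpretable
   type, where the formula holds by assumption at base types and pointwise at
   function types.

   For limits (a_1, .., a_n) and (b_1, .., b_n), the integral reduces to the sum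
   of the integrals along the path (a_1, .., a_n), (b_1, a_2, .., a_n), ..,
   (b_1, .., b_n), which changes one component at a time. By induction on the type
   of the limits, each summand is the difference of the values of t at the ends of
   an edge, and these differences telescope. *)

Require Import Defs.
From mathcomp Require Import all_boot.
From Stdlib Require List.
From Stdlib Require Import Eqdep.

Set Implicit Arguments.
Unset Strict Implicit.
Unset Printing Implicit Defensive.

(** * Substitution *)

(** [Fix] is the main obstacle. A normalizing term can contain a diverging subterm that reduction
    discards, so the hypothesis on the integral says nothing directly about [t] or the limits. Two
    facts get around this. The rules for sums, and those for derivatives and integrals at base
    points, move subterms without discarding them, so normalization passes from such a term to its
    parts. Conversely, a normalizing term may be traded for its normal form, to which reducibility
    applies; hence application, projection, substitution and addition preserve normalization even
    when [Fix] occurs. The side conditions of the rules speak of types, so reduction carries a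
    context, and confluence is proved for well-typed terms, whose types are unique. The telescoping
    sum lives at an arbitrary addable type, while equality of closed terms compares normal forms.
    The comparison is therefore made with [sem_eq], which observes terms by projections and
    applications down to interpretable types and is invariant under conversion. *)

Lemma type_nested_ind (B : Type) (P : type B -> Prop) :
  (forall b, P (TBase b)) ->
  (forall T Ts, List.Forall P (T :: Ts) -> P (TTup T Ts)) ->
  (forall T1 T2, P T1 -> P T2 -> P (TArr T1 T2)) ->
  (forall T1 T2, P T1 -> P T2 -> P (TSum T1 T2)) ->
  forall T, P T.
Proof.
move=> hB hT hA hS; fix IH 1; case=> [b|T Ts|T1 T2|T1 T2].
- exact: hB.
- by apply: hT; constructor=> //; elim: Ts => [|U Us IHs]; constructor.
- exact: hA.
- exact: hS.
Qed.

Section Calculus.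
Context {S : signature}.
Implicit Types (t u v : term S) (s : nat -> term S) (r : nat -> nat).
Implicit Types (T U : type (base S)) (G D : seq (type (base S))).

(** As for types, the generated principle would give no hypothesis on the components of a tuple. *)
Lemma term_nested_ind (P : term S -> Prop) :
  (forall i, P (Var i)) -> (forall A (c : const A), P (Cst c)) ->
  (forall T t, P t -> P (Lam T t)) ->
  (forall t u, P t -> P u -> P (App t u)) ->
  (forall ts, List.Forall P ts -> P (Tup ts)) ->
  (forall j t, P t -> P (Proj j t)) ->
  (forall t u, P t -> P u -> P (Plus t u)) ->
  (forall t u, P t -> P u -> P (Minus t u)) ->
  (forall t u, P t -> P u -> P (Times t u)) ->
  (forall t u, P t -> P u -> P (Der t u)) ->
  (forall t u v, P t -> P u -> P v -> P (Int t u v)) ->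
  (forall T t, P t -> P (Inl T t)) -> (forall T t, P t -> P (Inr T t)) ->
  (forall t u v, P t -> P u -> P v -> P (Case t u v)) ->
  (forall t, P t -> P (Fix t)) ->
  forall t, P t.
Proof.
move=> hV hC hL hA hT hP hAd hS hM hD hI hl hr hc hf; fix IH 1.
case=> [i|A c|T t|t u|ts|j t|t u|t u|t u|t u|t u v|T t|T t|t u v|t].
all: try by [apply: hV | apply: hC | apply: hL | apply: hA | apply: hP |
  apply: hAd | apply: hS | apply: hM | apply: hD | apply: hI | apply: hl |
  apply: hr | apply: hc | apply: hf].
by apply: hT; elim: ts => [|t ts IHts]; constructor.
Qed.

Lemma map_eq_Forall (A B : Type) (f g : A -> B) (l : seq A) :
  List.Forall (fun x => f x = g x) l -> map f l = map g l.
Proof. by elim=> //= x {}l -> _ ->. Qed.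

Ltac rewrite_IH :=
  intros; repeat match goal with IH : forall _, _ |- _ => rewrite IH; clear IH end.

(** Agreement is asked for on free variables only, because in the end a closing substitution is
    altered at the variables that do not occur. *)
Lemma subst_ext_free t s s' :
  (forall i, free_in i t -> s i = s' i) -> subst s t = subst s' t.
Proof.
have up s1 s2 (u : term S) : (forall i, free_in i.+1 u -> s1 i = s2 i) ->
    forall i, free_in i u -> upsubst s1 i = upsubst s2 i.
  by move=> h [|i] //= /h ->.
elim/term_nested_ind: t s s' => /= [i||||ts IH||||||||||].
5: { move=> s s' h; congr Tup; elim: IH h => //= t {}ts IHt _ IH h.
  rewrite (IHt s s') ?IH // => i hi; by apply: h; rewrite hi ?orbT. }
all: intros; try by [].
all: try by auto.
all: f_equal; match goal with IH : forall s s', _ -> subst s ?t = _ |- subst _ ?t = _ =>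
  apply: IH end; try apply: up; move=> i hi;
  match goal with h : forall i, is_true _ -> _ |- _ => by apply: h; rewrite hi ?orbT end.
Qed.

Lemma subst_ext t s s' : s =1 s' -> subst s t = subst s' t.
Proof. by move=> h; apply: subst_ext_free. Qed.

Lemma renameE r t : rename r t = subst (fun i => Var (r i)) t.
Proof.
have up r' : upsubst (fun i => @Var S (r' i)) =1 fun i => Var (upren r' i).
  by case.
elim/term_nested_ind: t r => //= [||ts IH r||||||||||];
  try (by rewrite_IH; rewrite ?(subst_ext _ (up _))).
by congr Tup; apply: map_eq_Forall; apply: List.Forall_impl IH => t.
Qed.

Lemma subst_id t : subst Var t = t.
Proof.
have up : upsubst (@Var S) =1 Var by case.
elim/term_nested_ind: t => //= [||ts IH||||||||||];
  try (by intros; rewrite ?(subst_ext _ up); congruence).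
by congr Tup; rewrite -[RHS]map_id; exact: map_eq_Forall.
Qed.

Lemma subst_rename s r t : subst s (rename r t) = subst (fun i => s (r i)) t.
Proof.
have up s' r' : (fun i => upsubst s' (upren r' i)) =1
                upsubst (fun i => s' (r' i)) by case.
elim/term_nested_ind: t s r => //= [||ts IH s r||||||||||];
  try (by rewrite_IH; rewrite ?(subst_ext _ (up _ _))).
by congr Tup; rewrite -map_comp; apply: map_eq_Forall; apply: List.Forall_impl IH => t /= ->.
Qed.

Lemma rename_subst r s t :
  rename r (subst s t) = subst (fun i => rename r (s i)) t.
Proof.
have up r' s' : (fun i => rename (upren r') (upsubst s' i)) =1
                upsubst (fun i => rename r' (s' i)).
  by case=> [|i] //=; rewrite /shift [LHS]renameE [RHS]renameE !subst_rename.
elim/term_nested_ind: t s r => //= [||ts IH s r||||||||||];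
  try (by rewrite_IH; rewrite ?(subst_ext _ (up _ _))).
by congr Tup; rewrite -map_comp; apply: map_eq_Forall; apply: List.Forall_impl IH => t /= ->.
Qed.

(** Under a binder [upsubst] shifts, so composing two substitutions rests on both mixed laws,
    [subst_rename] and [rename_subst]. *)
Lemma subst_subst s s' t : subst s (subst s' t) = subst (fun i => subst s (s' i)) t.
Proof.
have up s1 s2 : (fun i => subst (upsubst s1) (upsubst s2 i)) =1
                upsubst (fun i => subst s1 (s2 i)).
  by case=> [|i] //=; rewrite /shift subst_rename rename_subst.
elim/term_nested_ind: t s s' => //= [||ts IH s s'||||||||||];
  try (by rewrite_IH; rewrite ?(subst_ext _ (up _ _))).
by congr Tup; rewrite -map_comp; apply: map_eq_Forall; apply: List.Forall_impl IH => t /= ->.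
Qed.

(** [inst t u] is convertible to [subst (scons u Var) t]. The general tail serves bodies that are
    renamed into another context while being instantiated. *)
Definition scons u s (i : nat) : term S := if i is j.+1 then s j else u.

Lemma subst_shift s t : subst s (shift t) = subst (fun i => s i.+1) t.
Proof. exact: subst_rename. Qed.

Lemma subst_up_shift s t : subst (upsubst s) (shift t) = shift (subst s t).
Proof. by rewrite subst_shift /shift rename_subst. Qed.

Lemma subst_inst s t u :
  subst s (inst t u) = inst (subst (upsubst s) t) (subst s u).
Proof.
rewrite /inst !subst_subst; apply: subst_ext => -[|i] //=.
by rewrite subst_shift subst_id.
Qed.

Lemma subst_swap s t :
  subst (upsubst (upsubst s)) (swap t) = swap (subst (upsubst (upsubst s)) t).
Proof.
rewrite /swap subst_rename rename_subst; apply: subst_ext => -[|[|i]] //=.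
by rewrite /shift !renameE !subst_subst.
Qed.

Lemma subst_replace s t u :
  subst (upsubst s) (replace t u) =
  replace (subst (upsubst s) t) (subst (upsubst s) u).
Proof.
rewrite /replace !subst_subst; apply: subst_ext => -[|i] //=.
by rewrite subst_shift /shift renameE.
Qed.

Lemma map_subst_up_shift s ts :
  map (subst (upsubst s)) (map shift ts) = map shift (map (subst s) ts).
Proof. by rewrite -!map_comp; apply: eq_map => t /=; exact: subst_up_shift. Qed.

Lemma subst_mixed s i ts us :
  subst (upsubst s) (mixed i ts us) = mixed i (map (subst s) ts) (map (subst s) us).
Proof.
by rewrite /mixed /= map_cat /= !map_subst_up_shift map_take map_drop.
Qed.

Lemma subst_avoid s t :
  subst (upsubst (upsubst s)) (avoid t) = avoid (subst (upsubst s) t).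
Proof.
rewrite /avoid subst_rename rename_subst; apply: subst_ext => -[|i] //=.
by rewrite /shift !renameE !subst_subst.
Qed.

Lemma subst_int_der s t1 t2 t :
  subst s (int_der t1 t2 t) =
  int_der (subst s t1) (subst s t2) (subst (upsubst s) t).
Proof. by rewrite /int_der /= subst_avoid. Qed.

Lemma subst_bigPlus s t ts :
  subst s (bigPlus t ts) = bigPlus (subst s t) (map (subst s) ts).
Proof. by rewrite /bigPlus; elim: ts t => //= u ts IH t; rewrite IH. Qed.
End Calculus.

(** * Typing *)

Lemma onth_mapE (A B : Type) (f : A -> B) l i : onth (map f l) i = omap f (onth l i).
Proof. by elim: l i => [|x l IH] [|i] //=. Qed.

Lemma onth_mkseq (A : Type) (f : nat -> A) n i :
  onth [seq f i | i <- iota 0 n] i = if i < n then Some (f i) else None.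
Proof.
rewrite onth_mapE; have -> : onth (iota 0 n) i = if i < n then Some i else None.
  rewrite -[X in _ = if _ then Some X else _]add0n.
  by elim: n i 0 => [|n IH] [|i] m //=; rewrite ?addn0 // IH ltnS addSnnS.
by case: ifP.
Qed.

Lemma onth_lt (A : Type) (l : seq A) i x : onth l i = Some x -> i < size l.
Proof. by elim: l i => [|y l IH] [|i] //= /IH. Qed.

Lemma lt_onth (A : Type) (l : seq A) i : i < size l -> exists x, onth l i = Some x.
Proof. by elim: l i => [|y l IH] [|i] //= h; [exists y | exact: IH]. Qed.

Lemma drop_onth (A : Type) (l : seq A) i x : onth l i = Some x -> drop i l = x :: drop i.+1 l.
Proof. by elim: l i => [|y l IH] [|i] //=; [case=> ->; rewrite drop0 | exact: IH]. Qed.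

Lemma all_onth (A : Type) (p : pred A) (l : seq A) i x : all p l -> onth l i = Some x -> p x.
Proof. by elim: l i => [|y l IH] [|i] //= /andP [h1 h2]; [case=> <- | exact: IH]. Qed.

(** * Predicates and relations on lists, position by position *)

Section Lists.
Context {A B C : Type}.

Lemma Forall_onth (P : A -> Prop) (l : seq A) :
  List.Forall P l <-> forall i x, onth l i = Some x -> P x.
Proof.
split=> [|h]; first by elim=> [|x {}l hx _ IH] [|i] //= y; [case=> <- | exact: IH].
elim: l h => [|x l IH] h; constructor; first exact: (h 0).
by apply: IH => i y; exact: (h i.+1).
Qed.

Lemma Forall2_onth (R : A -> B -> Prop) l l' :
  List.Forall2 R l l' <->
  size l = size l' /\
  forall i x y, onth l i = Some x -> onth l' i = Some y -> R x y.
Proof.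
split=> [|[]].
  elim=> [|x y {}l {}l' hxy _ [hs IH]]; first by split=> // -[].
  split=> /=; first by rewrite hs.
  by move=> [|i] u v; [case=> <- [<-] | exact: IH].
elim: l l' => [|x l IH] [|y l'] //= [] hs h; constructor; first exact: (h 0).
by apply: IH => // i; exact: (h i.+1).
Qed.

Lemma Forall2_size (R : A -> B -> Prop) l l' :
  List.Forall2 R l l' -> size l = size l'.
Proof. by case/Forall2_onth. Qed.

Lemma Forall2_get (R : A -> B -> Prop) l l' i x y : List.Forall2 R l l' ->
  onth l i = Some x -> onth l' i = Some y -> R x y.
Proof. by case/Forall2_onth => _; apply. Qed.

Lemma Forall2_getl (R : A -> B -> Prop) l l' i x : List.Forall2 R l l' ->
  onth l i = Some x -> exists2 y, onth l' i = Some y & R x y.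
Proof.
move=> h hx; have := onth_lt hx; rewrite (Forall2_size h) => /lt_onth [y hy].
by exists y => //; exact: Forall2_get hx hy.
Qed.

Lemma Forall2_getr (R : A -> B -> Prop) l l' i y : List.Forall2 R l l' ->
  onth l' i = Some y -> exists2 x, onth l i = Some x & R x y.
Proof.
move=> h hy; have := onth_lt hy; rewrite -(Forall2_size h) => /lt_onth [x hx].
by exists x => //; exact: Forall2_get hx hy.
Qed.

Lemma Forall2_take (R : A -> B -> Prop) i l l' :
  List.Forall2 R l l' -> List.Forall2 R (take i l) (take i l').
Proof. by move=> h; elim: h i => [|x y {}l {}l' hxy h IH] [|i]; constructor. Qed.

Lemma Forall2_drop (R : A -> B -> Prop) i l l' :
  List.Forall2 R l l' -> List.Forall2 R (drop i l) (drop i l').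
Proof. by move=> h; elim: h i => [|x y {}l {}l' hxy h IH] [|i] //=; constructor. Qed.

Lemma Forall2_mapl (R : B -> C -> Prop) (f : A -> B) l l' :
  List.Forall2 (fun x y => R (f x) y) l l' -> List.Forall2 R (map f l) l'.
Proof. by elim=> //= *; constructor. Qed.

Lemma Forall2_impl (R R' : A -> B -> Prop) l l' :
  (forall x y, R x y -> R' x y) -> List.Forall2 R l l' -> List.Forall2 R' l l'.
Proof. by move=> h; elim=> *; constructor => //; exact: h. Qed.

Lemma Forall2_mkseq (R : A -> B -> Prop) (f : nat -> A) (g : nat -> B) n :
  (forall i, i < n -> R (f i) (g i)) ->
  List.Forall2 R [seq f i | i <- iota 0 n] [seq g i | i <- iota 0 n].
Proof.
move=> h; apply/Forall2_onth; split; first by rewrite !size_map.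
by move=> i x y; rewrite !onth_mkseq; case: ifP => // /h hR [<-] [<-].
Qed.

End Lists.

Ltac split_goal := repeat match goal with
  | |- exists _, _ => eexists | |- exists2 _, _ & _ => eexists
  | |- _ /\ _ => split | |- and3 _ _ _ => split | |- and4 _ _ _ _ => split
  | |- and5 _ _ _ _ _ => split end.

Ltac destruct_all := repeat match goal with
  | H : ex _ |- _ => destruct H | H : ex2 _ _ |- _ => destruct H
  | H : _ /\ _ |- _ => destruct H | H : and3 _ _ _ |- _ => destruct H
  | H : and4 _ _ _ _ |- _ => destruct H | H : and5 _ _ _ _ _ |- _ => destruct H
  | H : ?T = _ |- _ => is_var T; subst T end.

(** * Inversion of typing *)

Section TypingInversion.
Context {S : signature}.
Implicit Types (t u v : term S) (s : nat -> term S) (r : nat -> nat).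
Implicit Types (T U : type (base S)) (G D : seq (type (base S))).

(** Inversion computed from the head of the term, so that a single equivalence both destructs and
    builds typings. The type [dty V U] of a derivative, which is not a pattern, appears as an
    equation. *)
Definition typed_inv G t T : Prop :=
  match t with
  | Var i => onth G i = Some T
  | Cst A c => T = ity A
  | Lam T1 b => exists2 T2, T = TArr T1 T2 & typed (T1 :: G) b T2
  | App a b => exists2 T1, typed G a (TArr T1 T) & typed G b T1
  | Tup ts => exists T1 Ts, T = TTup T1 Ts /\ List.Forall2 (typed G) ts (T1 :: Ts)
  | Proj j a => exists T1 Ts, typed G a (TTup T1 Ts) /\ onth (T1 :: Ts) j = Some T
  | Plus a b | Minus a b => [/\ addable T, typed G a T & typed G b T]
  | Times a b =>
      exists U, [/\ addable T, diffable U, typed G a (dty T U) & typed G b U]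
  | Der a b => exists V U,
      [/\ T = dty V U, diffable U, typed G b U & typed (U :: G) a V]
  | Int a b d => exists U, [/\ addable T, diffable U, typed G a U, typed G b U
      & typed (U :: G) d (dty T U)]
  | Inl T2 a => exists2 T1, T = TSum T1 T2 & typed G a T1
  | Inr T1 a => exists2 T2, T = TSum T1 T2 & typed G a T2
  | Case a b c => exists T1 T2,
      [/\ typed G a (TSum T1 T2), typed (T1 :: G) b T & typed (T2 :: G) c T]
  | Fix a => typed G a (TArr T T)
  end.

Lemma typedP G t T : typed G t T <-> typed_inv G t T.
Proof.
split.
  by case=> /= *; split_goal; eauto.
case: t => /=; intros; destruct_all; eauto using
  T_Var, T_Cst, T_Lam, T_App, T_Tup, T_Proj, T_Add, T_Sub, T_Mul, T_Der, T_Int,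
  T_Inl, T_Inr, T_Case, T_Fix.
Qed.

End TypingInversion.

Ltac head_of t := lazymatch t with ?f _ => head_of f | _ => t end.

Ltac invert_typed := repeat match goal with
  | H : typed ?G ?t ?T |- _ => let c := head_of t in is_constructor c;
      apply (proj1 (typedP G t T)) in H; simpl in H; destruct_all
  end.

Ltac typed_cases tac :=
  intros; invert_typed; simpl; apply typedP; simpl; split_goal; tac.

(** * Weakening, substitution and uniqueness of types *)

Section Typing.
Context {S : signature}.
Implicit Types (t u v : term S) (s : nat -> term S) (r : nat -> nat).
Implicit Types (T U : type (base S)) (G D : seq (type (base S))).

Lemma typed_Tup_nth G ts T Ts : typed G (Tup ts) (TTup T Ts) ->
  List.Forall2 (typed G) ts (T :: Ts).
Proof. by move/typedP => /= [T1 [Us [[-> ->]]]]. Qed.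

Definition ren r G D := forall i T, onth G i = Some T -> onth D (r i) = Some T.

Lemma ren_up r G D T : ren r G D -> ren (upren r) (T :: G) (T :: D).
Proof. by move=> h [|i] //= U; exact: h. Qed.

Lemma ren_succ T G : ren succn G (T :: G).
Proof. by []. Qed.

Lemma ren_id G : ren id G G.
Proof. by []. Qed.

Lemma ren_nil r D : ren r [::] D.
Proof. by case. Qed.

Lemma ren_comp r r' G1 G2 G3 : ren r G1 G2 -> ren r' G2 G3 ->
  ren (fun i => r' (r i)) G1 G3.
Proof. by move=> h h' i T /h /h'. Qed.

Lemma Forall2_Forall_impl (A B : Type) (P Q : A -> B -> Prop) l l' :
  List.Forall (fun x => forall y, P x y -> Q x y) l ->
  List.Forall2 P l l' -> List.Forall2 Q l l'.
Proof.
move=> h h2; elim: h2 h => [|x y {}l {}l' hxy _ IH] h; constructor.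
  by inversion h; auto.
by apply: IH; inversion h.
Qed.

Lemma typed_rename r G D t T :
  ren r G D -> typed G t T -> typed D (rename r t) T.
Proof.
elim/(@term_nested_ind S): t r G D T => /= [i r G D T h /typedP /h h'|||
  |ts IH r G D T h ht||||||||||]; try (by typed_cases ltac:(eauto using ren_up)).
have [T1 [Ts [-> hts]]] := (typedP _ _ _).1 ht; apply/typedP; exists T1, Ts; split=> //.
apply: Forall2_mapl; apply: Forall2_Forall_impl hts; apply: List.Forall_impl IH => t IH U.
exact: IH.
Qed.

Lemma typed_shift G T1 t T : typed G t T -> typed (T1 :: G) (shift t) T.
Proof. exact: typed_rename. Qed.

Lemma rename_id t : rename id t = t.
Proof. by rewrite renameE subst_id. Qed.

(** The hypothesis is an equality of lookups, stronger than [ren r G D]: a variable unbound in [G]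
    must stay unbound, or it would acquire a type. It is used to remove [avoid]. *)
Lemma typed_unrename r G D t T : (forall i, onth D (r i) = onth G i) ->
  typed D (rename r t) T -> typed G t T.
Proof.
have up r' G' D' T' : (forall i, onth D' (r' i) = onth G' i) ->
  forall i, onth (T' :: D') (upren r' i) = onth (T' :: G') i by move=> h [|i] /=.
elim/(@term_nested_ind S): t r G D T => /= [i r G D T h /typedP /= e|||
  |ts IH r G D T h ht||||||||||]; try (by typed_cases ltac:(eauto)).
  by apply/typedP; rewrite /= -h.
have [T1 [Ts [-> hts]]] := (typedP _ _ _).1 ht; apply/typedP; exists T1, Ts; split=> //.
apply/Forall2_onth; split; first by rewrite -(Forall2_size hts) size_map.
move=> i x U hx hU; move/Forall_onth: IH => /(_ _ _ hx) IH; apply: IH h _.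
by apply: Forall2_get hts _ hU; rewrite onth_mapE hx.
Qed.

(** Restricted to free variables because the substitutions that close a term are constrained only
    there. *)
Lemma typed_subst_free s G D t T :
  (forall i U, free_in i t -> onth G i = Some U -> typed D (s i) U) ->
  typed G t T -> typed D (subst s t) T.
Proof.
have up s' G' D' T' u : (forall i U, free_in i.+1 u -> onth G' i = Some U -> typed D' (s' i) U) ->
    forall i U, free_in i u -> onth (T' :: G') i = Some U -> typed (T' :: D') (upsubst s' i) U.
  move=> h [|i] U /= hp hi; first by apply/typedP.
  by apply: typed_shift; apply: h.
elim/(@term_nested_ind S): t s G D T => /= [i s G D T h /typedP|||
  |ts IH s G D T h ht||||||||||]; first by apply: h => /=.
4: { have [T1 [Ts [-> hts]]] := (typedP _ _ _).1 ht; apply/typedP; exists T1, Ts; split=> //.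
  apply: Forall2_mapl; elim: hts IH h => [|x U xs Us hx _ IHx] IH h; constructor.
    by case/List.Forall_cons_iff: IH => IH _; apply: IH hx => i V hf; apply: h; rewrite /= hf.
  by case/List.Forall_cons_iff: IH => _ IH; apply: IHx IH _ => i V hf; apply: h; rewrite /= hf orbT. }
all: typed_cases ltac:(try eassumption); try (by []);
  match goal with IH : context [typed _ (subst _ ?t) _], H : typed _ ?t _ |- typed _ (subst _ ?t) _ =>
    apply: IH H end; try apply: up; move=> i V hf;
  match goal with h : forall i U, is_true _ -> _ |- _ => by apply: h; rewrite hf ?orbT end.
Qed.

Definition tsub s G D := forall i T, onth G i = Some T -> typed D (s i) T.

Lemma typed_subst s G D t T : tsub s G D -> typed G t T -> typed D (subst s t) T.
Proof. by move=> h; apply: typed_subst_free => i U _; exact: h. Qed.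

Lemma tsub_up s G D T : tsub s G D -> tsub (upsubst s) (T :: G) (T :: D).
Proof.
by move=> h [|i] U /= hi; [apply/typedP | apply: typed_shift; exact: h].
Qed.

Lemma tsub_scons u s G D T : typed D u T -> tsub s G D -> tsub (scons u s) (T :: G) D.
Proof. by move=> hu h [|i] U /=; [case=> <- | exact: h]. Qed.

Lemma tsub_ren r G D : ren r G D -> tsub (fun i => Var (r i)) G D.
Proof. by move=> h i T /h h'; apply/typedP. Qed.

Lemma tsub_id G : tsub Var G G.
Proof. exact: tsub_ren (@ren_id G). Qed.

Lemma typed_inst G t u T U : typed (U :: G) t T -> typed G u U -> typed G (inst t u) T.
Proof. by move=> ht hu; apply: typed_subst ht; exact: tsub_scons (@tsub_id G). Qed.

Lemma typed_swap G t T U V : typed (U :: V :: G) t T -> typed (V :: U :: G) (swap t) T.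
Proof. by apply: typed_rename => -[|[|i]]. Qed.

Lemma typed_replace G t u T U V :
  typed (U :: G) t T -> typed (V :: G) u U -> typed (V :: G) (replace t u) T.
Proof.
move=> ht hu; apply: typed_subst ht.
by move=> [|i] W /=; [case=> <- | move=> h; apply/typedP].
Qed.

Lemma typed_mixed G us ts i U T Ts :
  List.Forall2 (typed G) us (T :: Ts) -> List.Forall2 (typed G) ts (T :: Ts) ->
  onth (T :: Ts) i = Some U -> typed (U :: G) (mixed i us ts) (TTup T Ts).
Proof.
move=> hu ht hi; apply/typedP; exists T, Ts; split=> //.
rewrite -(cat_take_drop i (T :: Ts)) (drop_onth hi).
apply: List.Forall2_app; [|constructor]; last 1 first.
- apply: Forall2_mapl; apply: Forall2_impl (Forall2_drop _ ht) => *.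
  exact: typed_shift.
- by apply: Forall2_mapl; apply: Forall2_impl (Forall2_take _ hu) => *;
  exact: typed_shift.
- by apply/typedP.
Qed.

Lemma typed_avoid G t T U V : typed (U :: G) t T -> typed (U :: V :: G) (avoid t) T.
Proof. by apply: typed_rename; exact: ren_up. Qed.

(** Tuples are non-empty, so descending along first components of [U] ends at a base type, where
    [dty] returns [T] itself. *)
Lemma dty_inj T T' U : diffable U -> dty T U = dty T' U -> T = T'.
Proof. by elim/type_nested_ind: U => //= U Us /List.Forall_cons_iff [IH _] /andP [hU _] [/(IH hU)]. Qed.

Lemma ity_inj (B : Type) (A A' : itype B) : ity A = ity A' -> A = A'.
Proof.
by elim: A A' => [b|A1 IH1 A2 IH2] [b'|A1' A2'] //= [] => [->|/IH1 -> /IH2 ->].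
Qed.

(** Injections carry the missing summand, and for products and integrals the result type is
    recovered from [dty T U] by injectivity. Uniqueness makes the side condition [isBase]
    informative: a point known to be of base type cannot be typed as a tuple. *)
Lemma typed_uniq G t T T' : typed G t T -> typed G t T' -> T = T'.
Proof.
elim/(@term_nested_ind S): t G T T' => /= [i|A c|T1 t IH|t u IHt _|ts IH|j t IH|t u IHt _|t u IHt _|
  t u IHt IHu|t u IHt IHu|t u v IHt IHu IHv|T1 t IH|T1 t IH|t u v IHt IHu _|t IH] G T T'.
- by move=> /typedP /= h /typedP /=; rewrite h => -[].
- by move=> /typedP -> /typedP ->.
- by move=> /typedP [T2 -> h] /typedP [T2' -> /(IH _ _ _ h) ->].
- by move=> /typedP [? h _] /typedP [? /(IHt _ _ _ h) [_ ->] _].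
- move=> /typedP [T1 [Ts [-> h]]] /typedP [T1' [Ts' [-> h']]].
  suff [-> ->] : T1 :: Ts = T1' :: Ts' by [].
  elim: h (T1' :: Ts') h' IH => [|x U xs Us hx _ IHx] Us' h'; first by inversion h'.
  case: Us' h' => [|U' Us'] h'; first by inversion h'.
  case/List.Forall2_cons_iff: h' => hx' h' /List.Forall_cons_iff [IHt IH].
  by rewrite (IHt _ _ _ hx hx') (IHx _ h' IH).
- move=> /typedP [? [? [h h1]]] /typedP [? [? [/(IH _ _ _ h) [<- <-] h2]]].
  by move: h2; rewrite h1 => -[].
- by move=> /typedP [_ h _] /typedP [_ h' _]; apply: IHt h h'.
- by move=> /typedP [_ h _] /typedP [_ h' _]; apply: IHt h h'.
- move=> /typedP [U [_ hU h1 h2]] /typedP [U' [_ _ h1' h2']].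
  move: h1'; rewrite -(IHu _ _ _ h2 h2') => /(IHt _ _ _ h1); exact: dty_inj.
- move=> /typedP [V [U [-> _ h1 h2]]] /typedP [V' [U' [-> _ h1' h2']]].
  by move: h2'; rewrite -(IHu _ _ _ h1 h1') => h2'; rewrite (IHt _ _ _ h2 h2').
- move=> /typedP [U [_ hU h1 h2 h3]] /typedP [U' [_ _ h1' _ h3']].
  move: h3'; rewrite -(IHt _ _ _ h1 h1') => /(IHv _ _ _ h3); exact: dty_inj.
- by move=> /typedP [T2 -> h] /typedP [T2' -> /(IH _ _ _ h) ->].
- by move=> /typedP [T2 -> h] /typedP [T2' -> /(IH _ _ _ h) ->].
- move=> /typedP [? [? [h1 h2 _]]] /typedP [? [? [h1' h2' _]]].
  by case: (IHt _ _ _ h1 h1') h2' => <- _; apply: IHu h2.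
- by move=> /typedP h /typedP /(IH _ _ _ h) [].
Qed.

Lemma isBase_typed G t T : isBase G t -> typed G t T -> exists b, T = TBase b.
Proof. by case=> b hb /(typed_uniq hb) <-; exists b. Qed.

Lemma isBase_subst s G D t : tsub s G D -> isBase G t -> isBase D (subst s t).
Proof. by move=> h [b hb]; exists b; apply: typed_subst hb. Qed.

Lemma typed_bigPlus G t ts T : addable T -> typed G t T ->
  List.Forall (fun u => typed G u T) ts -> typed G (bigPlus t ts) T.
Proof.
move=> hT; rewrite /bigPlus; elim: ts t => //= u ts IH t ht hts.
by inversion hts; apply: IH => //; apply/typedP.
Qed.
End Typing.

Ltac unify_types := repeat match goal with
  | H1 : typed ?G ?t ?T, H2 : typed ?G ?t ?U |- _ =>
      lazymatch T with U => fail | _ =>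
        let e := fresh in pose proof (typed_uniq H1 H2) as e;
        first [subst T | subst U | injection e; clear e; intros; subst] end
  end.

(** * Reduction *)

Section Reduction.
Context {S : signature}.
Implicit Types (t u v : term S) (s : nat -> term S) (r : nat -> nat).
Implicit Types (T U : type (base S)) (G D : seq (type (base S))).

(** The rules of [step] at the root alone. By [stepP] a step is either one of these or a step inside
    an immediate subterm, and the two are treated separately throughout. *)
Inductive contr G : term S -> term S -> Prop :=
| R_Beta T t u : contr G (App (Lam T t) u) (inst t u)
| R_Proj ts j t : onth ts j = Some t -> contr G (Proj j (Tup ts)) t
| R_CaseInl T t t1 t2 : contr G (Case (Inl T t) t1 t2) (inst t1 t)
| R_CaseInr T t t1 t2 : contr G (Case (Inr T t) t1 t2) (inst t2 t)
| R_Fix f : contr G (Fix f) (App f (Fix f))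
| R_DerTup ts t0 : isBase G t0 ->
    contr G (Der (Tup ts) t0) (Tup [seq Der t t0 | t <- ts])
| R_DerInl T t t0 : isBase G t0 -> contr G (Der (Inl T t) t0) (Inl T (Der t t0))
| R_DerInr T t t0 : isBase G t0 -> contr G (Der (Inr T t) t0) (Inr T (Der t t0))
| R_DerLam T t t0 : isBase G t0 ->
    contr G (Der (Lam T t) t0) (Lam T (Der (swap t) (shift t0)))
| R_DerAtTup t ts :
    contr G (Der t (Tup ts))
      (Tup [seq Der (replace t (mixed i ts ts)) (nth (Var 0) ts i)
           | i <- iota 0 (size ts)])
| R_IntTup t1 t2 ts : isBase G t1 -> isBase G t2 ->
    contr G (Int t1 t2 (Tup ts)) (Tup [seq Int t1 t2 t | t <- ts])
| R_IntInl T t1 t2 t : isBase G t1 -> isBase G t2 ->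
    contr G (Int t1 t2 (Inl T t)) (Inl T (Int t1 t2 t))
| R_IntInr T t1 t2 t : isBase G t1 -> isBase G t2 ->
    contr G (Int t1 t2 (Inr T t)) (Inr T (Int t1 t2 t))
| R_IntLam T t1 t2 t : isBase G t1 -> isBase G t2 ->
    contr G (Int t1 t2 (Lam T t)) (Lam T (Int (shift t1) (shift t2) (swap t)))
| R_IntBetweenTup t ts1 ts2 w ws :
    size ts1 = size ts2 ->
    [seq Int (nth (Var 0) ts1 i) (nth (Var 0) ts2 i)
           (Proj i (replace t (mixed i ts2 ts1)))
    | i <- iota 0 (size ts1)] = w :: ws ->
    contr G (Int (Tup ts1) (Tup ts2) t) (bigPlus w ws)
| R_AddTup ts us : size ts = size us ->
    contr G (Plus (Tup ts) (Tup us)) (Tup [seq Plus p.1 p.2 | p <- zip ts us])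
| R_AddLam T t u : contr G (Plus (Lam T t) (Lam T u)) (Lam T (Plus t u))
| R_SubTup ts us : size ts = size us ->
    contr G (Minus (Tup ts) (Tup us)) (Tup [seq Minus p.1 p.2 | p <- zip ts us])
| R_SubLam T t u : contr G (Minus (Lam T t) (Lam T u)) (Lam T (Minus t u))
| R_MulTup ts t0 : isBase G t0 ->
    contr G (Times (Tup ts) t0) (Tup [seq Times t t0 | t <- ts])
| R_MulLam T t t0 : isBase G t0 ->
    contr G (Times (Lam T t) t0) (Lam T (Times t (shift t0)))
| R_MulInl T t t0 : isBase G t0 ->
    contr G (Times (Inl T t) t0) (Inl T (Times t t0))
| R_MulInr T t t0 : isBase G t0 ->
    contr G (Times (Inr T t) t0) (Inr T (Times t t0))
| R_MulTupTup ts us w ws :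
    size ts = size us ->
    [seq Times p.1 p.2 | p <- zip ts us] = w :: ws ->
    contr G (Times (Tup ts) (Tup us)) (bigPlus w ws).

Lemma contr_step G t t' : contr G t t' -> step G t t'.
Proof. by case=> *; econstructor; eauto. Qed.

Definition sub_step G t t' : Prop :=
  match t with
  | Var _ | Cst _ _ => False
  | Lam T b => exists2 b', t' = Lam T b' & step (T :: G) b b'
  | App a b => (exists2 a', t' = App a' b & step G a a') \/
               (exists2 b', t' = App a b' & step G b b')
  | Tup ts => exists us x x' vs,
      [/\ ts = us ++ x :: vs, t' = Tup (us ++ x' :: vs) & step G x x']
  | Proj j a => exists2 a', t' = Proj j a' & step G a a'
  | Plus a b => (exists2 a', t' = Plus a' b & step G a a') \/
                (exists2 b', t' = Plus a b' & step G b b')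
  | Minus a b => (exists2 a', t' = Minus a' b & step G a a') \/
                 (exists2 b', t' = Minus a b' & step G b b')
  | Times a b => (exists2 a', t' = Times a' b & step G a a') \/
                 (exists2 b', t' = Times a b' & step G b b')
  | Der a b => (exists T a', [/\ t' = Der a' b, typed G b T & step (T :: G) a a']) \/
               (exists2 b', t' = Der a b' & step G b b')
  | Int a b d => [\/ exists2 a', t' = Int a' b d & step G a a',
      exists2 b', t' = Int a b' d & step G b b' |
      exists T d', [/\ t' = Int a b d', typed G a T, typed G b T & step (T :: G) d d']]
  | Inl T a => exists2 a', t' = Inl T a' & step G a a'
  | Inr T a => exists2 a', t' = Inr T a' & step G a a'
  | Case a b c => [\/ exists2 a', t' = Case a' b c & step G a a',
      exists T1 T2 b', [/\ t' = Case a b' c, typed G a (TSum T1 T2) & step (T1 :: G) b b'] |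
      exists T1 T2 c', [/\ t' = Case a b c', typed G a (TSum T1 T2) & step (T2 :: G) c c']]
  | Fix a => exists2 a', t' = Fix a' & step G a a'
  end.

Lemma stepP G t t' : step G t t' <-> contr G t t' \/ sub_step G t t'.
Proof.
split.
{ case; try (by move=> *; left; econstructor; eauto).
  all: move=> *; right; rewrite /=; split_goal; eauto.
  all: try solve [left; split_goal; eauto | right; split_goal; eauto].
  all: try solve [constructor 1; split_goal; eauto | constructor 2; split_goal; eauto
    | constructor 3; split_goal; eauto]. }
case=> [/contr_step //|].
case: t => //=; intros; destruct_all; repeat match goal with
  | H : _ \/ _ |- _ => destruct H | H : or3 _ _ _ |- _ => destruct H end; destruct_all;
  try (by econstructor; eauto); by [apply: C_Der2 | apply: C_Int2 | eapply C_Case2; eauto].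
Qed.

Lemma steps_trans G t u v : steps G t u -> steps G u v -> steps G t v.
Proof. by move=> h; elim=> // w x _ h1; exact: steps_step. Qed.

Lemma steps1 G t u : step G t u -> steps G t u.
Proof. by apply: steps_step; exact: steps_refl. Qed.

Lemma steps_contr G t u : contr G t u -> steps G t u.
Proof. by move/contr_step/steps1. Qed.

Lemma steps_ctx G G' (f : term S -> term S) t t' :
  (forall a b, step G' a b -> step G (f a) (f b)) ->
  steps G' t t' -> steps G (f t) (f t').
Proof.
move=> h; elim=> [|u v _ IH hs]; first exact: steps_refl.
exact: steps_step IH (h _ _ hs).
Qed.

Lemma map_mapE (A B C : Type) (f : B -> C) (g : A -> B) l :
  map f (map g l) = map (fun x => f (g x)) l.
Proof. by rewrite -map_comp. Qed.

Lemma zip_mapE (A B : Type) (f : A -> B) (op : B -> B -> B) l l' :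
  [seq op p.1 p.2 | p <- zip (map f l) (map f l')] =
  [seq op (f p.1) (f p.2) | p <- zip l l'].
Proof. by elim: l l' => [|x l IH] [|y l'] //=; rewrite IH. Qed.

(** Substitutions have to be well typed here, since the side conditions on points and limits are
    typing statements. *)
Lemma contr_subst s G D t t' :
  tsub s G D -> contr G t t' -> contr D (subst s t) (subst s t').
Proof.
move=> hs; case=> /=.
- by move=> T b u; rewrite subst_inst; constructor.
- by move=> ts j u h; constructor; rewrite onth_mapE h.
- by move=> T u t1 t2; rewrite subst_inst; constructor.
- by move=> T u t1 t2; rewrite subst_inst; constructor.
- by move=> f; constructor.
- move=> ts t0 /(isBase_subst hs) h; rewrite map_mapE.
  by move: (R_DerTup (map (subst (upsubst s)) ts) h); rewrite [in X in X -> _]map_mapE.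
- by move=> T u t0 /(isBase_subst hs) h; constructor.
- by move=> T u t0 /(isBase_subst hs) h; constructor.
- move=> T u t0 /(isBase_subst hs) h; rewrite subst_swap subst_up_shift.
  by constructor.
- move=> u ts; set X := Tup _; set Y := Tup _.
  suff -> : Y = Tup [seq Der (replace (subst (upsubst s) u)
      (mixed i (map (subst s) ts) (map (subst s) ts)))
      (nth (Var 0) (map (subst s) ts) i) | i <- iota 0 (size (map (subst s) ts))].
    exact: R_DerAtTup.
  rewrite /Y size_map map_mapE; congr Tup; apply/eq_in_map => i /=.
  rewrite mem_iota /= => hi.
  by rewrite subst_replace subst_mixed (nth_map (Var 0)).
- move=> t1 t2 ts /(isBase_subst hs) h /(isBase_subst hs) h'.
  by rewrite map_mapE; have := R_IntTup (map (subst (upsubst s)) ts) h h'; rewrite map_mapE.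
- by move=> T t1 t2 u /(isBase_subst hs) h /(isBase_subst hs) h'; constructor.
- by move=> T t1 t2 u /(isBase_subst hs) h /(isBase_subst hs) h'; constructor.
- move=> T t1 t2 u /(isBase_subst hs) h /(isBase_subst hs) h'.
  by rewrite subst_swap !subst_up_shift; constructor.
- move=> u ts1 ts2 w ws hsz hw; rewrite subst_bigPlus.
  apply: R_IntBetweenTup; first by rewrite !size_map.
  rewrite -[_ :: _]/(map (subst s) (w :: ws)) -hw map_mapE size_map.
  apply/eq_in_map => i; rewrite mem_iota /= => hi.
  by rewrite subst_replace subst_mixed !(nth_map (Var 0)) -?hsz.
- move=> ts us hsz; rewrite map_mapE /=.
  by rewrite -(zip_mapE (subst s) (@Plus S)); constructor; rewrite !size_map.
- by move=> T u v; constructor.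
- move=> ts us hsz; rewrite map_mapE /=.
  by rewrite -(zip_mapE (subst s) (@Minus S)); constructor; rewrite !size_map.
- by move=> T u v; constructor.
- move=> ts t0 /(isBase_subst hs) h; rewrite map_mapE.
  by move: (R_MulTup (map (subst s) ts) h); rewrite [in X in X -> _]map_mapE.
- by move=> T u t0 /(isBase_subst hs) h; rewrite subst_up_shift; constructor.
- by move=> T u t0 /(isBase_subst hs) h; constructor.
- by move=> T u t0 /(isBase_subst hs) h; constructor.
- move=> ts us w ws hsz hw; rewrite subst_bigPlus.
  apply: R_MulTupTup; first by rewrite !size_map.
  rewrite -[_ :: _]/(map (subst s) (w :: ws)) -hw map_mapE /=.
  exact: zip_mapE.
Qed.

Lemma contr_rename r G D t t' :
  ren r G D -> contr G t t' -> contr D (rename r t) (rename r t').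
Proof. by move=> h; rewrite !renameE; apply: contr_subst; exact: tsub_ren. Qed.

Lemma step_subst s G D t t' :
  tsub s G D -> step G t t' -> step D (subst s t) (subst s t').
Proof.
move=> hs h; elim: h s D hs => {G t t'}; try (by move=> *; apply: contr_step; eapply contr_subst; [eassumption | econstructor; eauto]).
all: try (by move=> *; simpl; econstructor; eauto using tsub_up, typed_subst).
- by move=> G ts t t' us h IH s D hs /=; rewrite !map_cat /=; constructor; apply: IH.
Qed.

Lemma steps_subst s G D t t' :
  tsub s G D -> steps G t t' -> steps D (subst s t) (subst s t').
Proof. by move=> h; apply: steps_ctx => a b; exact: step_subst. Qed.

Lemma steps_rename r G D t t' :
  ren r G D -> steps G t t' -> steps D (rename r t) (rename r t').
Proof. by move=> h; rewrite !renameE; apply: steps_subst; exact: tsub_ren. Qed.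
End Reduction.

(** * Subject reduction and one-level congruence *)

Section SubjectReduction.
Context {S : signature}.
Implicit Types (t u v : term S) (s : nat -> term S) (r : nat -> nat).
Implicit Types (T U : type (base S)) (G D : seq (type (base S))).

Lemma onth_zip (A B : Type) (l : seq A) (l' : seq B) i :
  onth (zip l l') i =
  if (onth l i, onth l' i) is (Some x, Some y) then Some (x, y) else None.
Proof.
by elim: l l' i => [|x l IH] [|y l'] [|i] //=; case: (onth l i).
Qed.

Lemma typed_zip G (op : term S -> term S -> term S) ts us Ts Us Vs :
  (forall i T U V t u, onth Ts i = Some T -> onth Us i = Some U ->
    onth Vs i = Some V -> typed G t T -> typed G u U -> typed G (op t u) V) ->
  size Vs = size Ts ->
  List.Forall2 (typed G) ts Ts -> List.Forall2 (typed G) us Us ->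
  size ts = size us ->
  List.Forall2 (typed G) [seq op p.1 p.2 | p <- zip ts us] Vs.
Proof.
move=> hop hs ht hu hsz; apply/Forall2_onth; split.
  by rewrite size_map size_zip -hsz minnn (Forall2_size ht).
move=> i x V; rewrite onth_mapE onth_zip.
case ei: (onth ts i) => [t|//]; case ej: (onth us i) => [u|//] /= [<-] hV.
have [T hT tT] := Forall2_getl ht ei; have [U hU uU] := Forall2_getl hu ej.
exact: hop hT hU hV tT uU.
Qed.

Lemma typed_TupP G ts T : typed G (Tup ts) T ->
  exists T1 Ts, T = TTup T1 Ts /\ List.Forall2 (typed G) ts (T1 :: Ts).
Proof. by move/typedP. Qed.

Lemma typed_Tup_map G D (f : term S -> term S) (F : type (base S) -> type (base S))
    ts T1 Ts :
  (forall i t T, onth ts i = Some t -> onth (T1 :: Ts) i = Some T ->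
     typed G t T -> typed D (f t) (F T)) ->
  List.Forall2 (typed G) ts (T1 :: Ts) ->
  typed D (Tup (map f ts)) (TTup (F T1) (map F Ts)).
Proof.
move=> h hts; apply/typedP; exists (F T1), (map F Ts); split=> //.
rewrite -[F T1 :: _]/(map F (T1 :: Ts)); apply/Forall2_onth.
split; first by rewrite !size_map (Forall2_size hts).
move=> i x V; rewrite !onth_mapE.
case e: (onth ts i) => [t|//] [<-]; case e': (onth (T1 :: Ts) i) => [T|//] [<-].
exact: h e e' (Forall2_get hts e e').
Qed.

Lemma typed_DerAt G t ts U V i : diffable U -> typed (U :: G) t V ->
  typed G (Tup ts) U -> i < size ts ->
  exists T1 Ts Ui, [/\ U = TTup T1 Ts, onth (T1 :: Ts) i = Some Ui,
    diffable Ui & typed G (nth (Var 0) ts i) Ui].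
Proof.
move=> hU ht /typed_TupP [T1 [Ts [eU hts]]] /lt_onth [u hu].
have [Ui hi hui] := Forall2_getl hts hu.
exists T1, Ts, Ui; split=> //; last by rewrite (onth_nth (Var 0) _ _ _ hu).
by move: hU; rewrite eU => hU; apply: (@all_onth _ _ (T1 :: Ts) i).
Qed.

Lemma onth_map_some (A B : Type) (f : A -> B) l i x :
  onth l i = Some x -> onth (map f l) i = Some (f x).
Proof. by rewrite onth_mapE => ->. Qed.

(** For a derivative at a tuple, [dty] distributes over the components and matches the tuple of
    partial derivatives. Between tuples, the i-th projection of the integrand has type [dty T Ui],
    which is what an integral over the i-th component asks for. *)
Lemma contr_typed G t t' T : contr G t t' -> typed G t T -> typed G t' T.
Proof.
case=> {t t'}.
- by move=> T1 t u /typedP [T2 /typedP [T3 [<- <-] h] hu]; apply: typed_inst hu.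
- move=> ts j t hj /typedP [T1 [Ts [/typed_Tup_nth h hT]]].
  exact: Forall2_get h hj hT.
- by move=> T1 t t1 t2 /typedP [? [? [/typedP [? [-> ->] h] h1 _]]];
    apply: typed_inst h.
- by move=> T1 t t1 t2 /typedP [? [? [/typedP [? [-> ->] h] _ h2]]];
    apply: typed_inst h.
- by move=> f /typedP /= h; apply/typedP; exists T => //; apply/typedP.
- move=> ts t0 hb /typedP [V [U [-> hU h0 /typed_TupP [T1 [Ts [-> hts]]]]]].
  have [b eb] := isBase_typed hb h0; subst U.
  rewrite -[Ts]map_id; apply: (typed_Tup_map (F := id) _ hts) => i t W _ _ ht.
  by apply/typedP; exists W, (TBase b).
- move=> W t t0 hb /typedP [V [U [-> hU h0 /typedP [T1 -> ht]]]].
  have [b eb] := isBase_typed hb h0; subst U.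
  by apply/typedP; exists T1 => //; apply/typedP; exists T1, (TBase b).
- move=> W t t0 hb /typedP [V [U [-> hU h0 /typedP [T1 -> ht]]]].
  have [b eb] := isBase_typed hb h0; subst U.
  by apply/typedP; exists T1 => //; apply/typedP; exists T1, (TBase b).
- move=> W t t0 hb /typedP [V [U [-> hU h0 /typedP [T1 -> ht]]]].
  have [b eb] := isBase_typed hb h0; subst U.
  apply/typedP; exists T1 => //; apply/typedP; exists T1, (TBase b).
  by split=> //; [apply: typed_shift | apply: typed_swap].
- move=> t ts /typedP [V [U [-> hU h0 ht]]].
  have [T1 [Ts [eU hts]]] := typed_TupP h0.
  rewrite eU /=; apply/typedP; eexists; eexists; split; first by [].
  rewrite -[dty V T1 :: _]/(map (dty V) (T1 :: Ts)); apply/Forall2_onth.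
  split; first by rewrite !size_map size_iota (Forall2_size hts).
  move=> i x W; rewrite onth_mkseq onth_mapE; case: ifP => // hi [<-].
  have [T1' [Ts' [Ui [eU' hUi dUi hn]]]] := typed_DerAt hU ht h0 hi.
  move: eU'; rewrite eU => -[? ?]; subst T1' Ts'.
  rewrite hUi /= => -[<-]; apply/typedP; exists V, Ui; split=> //.
  by apply: typed_replace ht _; rewrite eU; apply: typed_mixed hUi.
- move=> t1 t2 ts hb _ /typedP [U [ha hU h1 h2 h]].
  have [b eb] := isBase_typed hb h1; subst U.
  have [T1 [Ts [eT hts]]] := typed_TupP h.
  move: ha; rewrite /= in eT; subst T => ha.
  rewrite -[Ts]map_id; apply: (typed_Tup_map (F := id) _ hts) => i t W _ hi ht.
  apply/typedP; exists (TBase b); split=> //.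
  by apply: (@all_onth _ _ (T1 :: Ts) i).
(* The rules for integrals of injections apply to no typed term: the result would have a sum type,
   which is not addable. The same holds for products below. *)
- move=> W t1 t2 t hb _ /typedP [U [ha hU h1 h2 h]].
  have [b eb] := isBase_typed hb h1; subst U.
  by move/typedP: h ha => [T1 /= -> _].
- move=> W t1 t2 t hb _ /typedP [U [ha hU h1 h2 h]].
  have [b eb] := isBase_typed hb h1; subst U.
  by move/typedP: h ha => [T1 /= -> _].
- move=> W t1 t2 t hb _ /typedP [U [ha hU h1 h2 h]].
  have [b eb] := isBase_typed hb h1; subst U.
  move/typedP: h ha => [T1 /= -> ht] ha.
  apply/typedP; exists T1 => //; apply/typedP; exists (TBase b).
  by split=> //; [exact: typed_shift.. | exact: typed_swap].
- move=> t ts1 ts2 w ws hsz hw /typedP [U [ha hU h1 h2 ht]].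
  have [T1 [Ts [eU hts1]]] := typed_TupP h1.
  have := h2; rewrite eU => /typed_Tup_nth hts2.
  have : List.Forall (fun u => typed G u T) (w :: ws).
    rewrite -hw; apply/Forall_onth => i x.
    rewrite onth_mkseq; case: ifP => // hi [<-].
    have [T1' [Ts' [Ui [eU' hUi dUi hn1]]]] := typed_DerAt hU ht h1 hi.
    rewrite hsz in hi.
    have [T1'' [Ts'' [Ui' [eU'' hUi' _ hn2]]]] := typed_DerAt hU ht h2 hi.
    rewrite eU in eU'; case: eU' => ? ?; subst T1' Ts'.
    rewrite eU in eU''; case: eU'' => ? ?; subst T1'' Ts''.
    rewrite hUi in hUi'; case: hUi' => ?; subst Ui'.
    apply/typedP; exists Ui; split=> //; apply/typedP.
    exists (dty T T1), (map (dty T) Ts); split.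
      move: ht; rewrite eU /= => ht; apply: typed_replace ht _.
      exact: typed_mixed hUi.
    by rewrite -[dty T T1 :: _]/(map (dty T) (T1 :: Ts)); exact: onth_map_some.
  by case/List.Forall_cons_iff => hw1 hws; apply: typed_bigPlus.
- move=> ts us hsz /typedP [ha /typed_TupP [T1 [Ts [eT hts]]]]; subst T.
  move=> /typed_Tup_nth hus; apply/typedP; exists T1, Ts; split=> //.
  apply: typed_zip hts hus hsz => // i T U V t u hi.
  rewrite hi => -[<-] [<-] ht hu.
  by apply/typedP; split=> //; apply: (@all_onth _ _ (T1 :: Ts) i).
- move=> W t u /typedP [ha /typedP [V eT ht]]; subst T.
  move=> /typedP [V' [<-] hu].
  by apply/typedP; exists V => //; apply/typedP.
- move=> ts us hsz /typedP [ha /typed_TupP [T1 [Ts [eT hts]]]]; subst T.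
  move=> /typed_Tup_nth hus; apply/typedP; exists T1, Ts; split=> //.
  apply: typed_zip hts hus hsz => // i T U V t u hi.
  rewrite hi => -[<-] [<-] ht hu.
  by apply/typedP; split=> //; apply: (@all_onth _ _ (T1 :: Ts) i).
- move=> W t u /typedP [ha /typedP [V eT ht]]; subst T.
  move=> /typedP [V' [<-] hu].
  by apply/typedP; exists V => //; apply/typedP.
- move=> ts t0 hb /typedP [U [ha hU h h0]].
  have [b eb] := isBase_typed hb h0; subst U; move: h ha => /typed_TupP [T1 [Ts /= [-> hts]]] ha.
  rewrite -[Ts]map_id; apply: (typed_Tup_map (F := id) _ hts) => i t W _ hi ht.
  apply/typedP; exists (TBase b); split=> //.
  by apply: (@all_onth _ _ (T1 :: Ts) i).
- move=> W t t0 hb /typedP [U [ha hU h h0]].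
  have [b eb] := isBase_typed hb h0; subst U; move: h ha => /typedP [T1 /= -> ht] ha.
  apply/typedP; exists T1 => //; apply/typedP; exists (TBase b).
  by split=> //; exact: typed_shift.
- move=> W t t0 hb /typedP [U [ha hU h h0]].
  by have [b eb] := isBase_typed hb h0; subst U; move: h ha => /typedP [T1 /= -> ht].
- move=> W t t0 hb /typedP [U [ha hU h h0]].
  by have [b eb] := isBase_typed hb h0; subst U; move: h ha => /typedP [T1 /= -> ht].
- move=> ts us w ws hsz hw /typedP [U [ha hU h1 /typed_TupP [T1 [Ts [eU hus]]]]].
  subst U; move: h1 => /= /typed_Tup_nth hts.
  have : List.Forall (fun u => typed G u T) (w :: ws).
    rewrite -hw; apply/Forall_onth => i x; rewrite onth_mapE onth_zip.
    case ei: (onth ts i) => [t|//]; case ej: (onth us i) => [u|//] /= [<-].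
    have [U hU' uU] := Forall2_getl hus ej.
    have := Forall2_get hts ei (@onth_map_some _ _ (dty T) (T1 :: Ts) _ _ hU') => ht.
    apply/typedP; exists U; split=> //.
    by apply: (@all_onth _ _ (T1 :: Ts) i).
  by case/List.Forall_cons_iff => hw1 hws; apply: typed_bigPlus.
Qed.

Lemma step_typed G t t' T : step G t t' -> typed G t T -> typed G t' T.
Proof.
move=> h; elim: h T => {G t t'};
  try (by move=> *; eapply contr_typed; [econstructor; eauto | eassumption]).
4: { move=> G ts t t' us _ IH T /typedP [T1 [Ts [-> h]]]; apply/typedP.
  exists T1, Ts; split=> //.
  case: (List.Forall2_app_inv_l _ _ h) => l1 [l2 [h1 [h2 ->]]].
  case: l2 h2 => [|V l2] h2; first by inversion h2.
  case/List.Forall2_cons_iff: h2 => hV h2.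
  by apply: List.Forall2_app => //; constructor=> //; exact: IH. }
all: by typed_cases ltac:(unify_types; eauto).
Qed.

Lemma steps_typed G t t' T : steps G t t' -> typed G t T -> typed G t' T.
Proof. by elim=> // u v _ IH hs /IH; exact: step_typed. Qed.

(** All immediate subterms are related at once, by an arbitrary [R]; the instances used include
    [steps] and parallel reduction. The typing premises fix the contexts in which bodies of binders
    are compared. *)
Inductive cong (R : seq (type (base S)) -> term S -> term S -> Prop) G :
    term S -> term S -> Prop :=
| K_Var i : cong R G (Var i) (Var i)
| K_Cst A (c : const A) : cong R G (Cst c) (Cst c)
| K_Lam T t t' : R (T :: G) t t' -> cong R G (Lam T t) (Lam T t')
| K_App t t' u u' : R G t t' -> R G u u' -> cong R G (App t u) (App t' u')
| K_Tup ts ts' : List.Forall2 (R G) ts ts' -> cong R G (Tup ts) (Tup ts')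
| K_Proj j t t' : R G t t' -> cong R G (Proj j t) (Proj j t')
| K_Plus t t' u u' : R G t t' -> R G u u' -> cong R G (Plus t u) (Plus t' u')
| K_Minus t t' u u' : R G t t' -> R G u u' -> cong R G (Minus t u) (Minus t' u')
| K_Times t t' u u' : R G t t' -> R G u u' -> cong R G (Times t u) (Times t' u')
| K_Der U t t' u u' : typed G u U -> R (U :: G) t t' -> R G u u' ->
    cong R G (Der t u) (Der t' u')
| K_Int U t t' u u' v v' : typed G t U -> typed G u U ->
    R G t t' -> R G u u' -> R (U :: G) v v' -> cong R G (Int t u v) (Int t' u' v')
| K_Inl T t t' : R G t t' -> cong R G (Inl T t) (Inl T t')
| K_Inr T t t' : R G t t' -> cong R G (Inr T t) (Inr T t')
| K_Case T U t t' u u' v v' : typed G t (TSum T U) ->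
    R G t t' -> R (T :: G) u u' -> R (U :: G) v v' ->
    cong R G (Case t u v) (Case t' u' v')
| K_Fix t t' : R G t t' -> cong R G (Fix t) (Fix t').

Definition cong_inv (R : seq (type (base S)) -> term S -> term S -> Prop) G t c :
    Prop :=
  match t with
  | Var _ | Cst _ _ => c = t
  | Lam T t => exists2 t', c = Lam T t' & R (T :: G) t t'
  | App t u => exists t' u', [/\ c = App t' u', R G t t' & R G u u']
  | Tup ts => exists2 ts', c = Tup ts' & List.Forall2 (R G) ts ts'
  | Proj j t => exists2 t', c = Proj j t' & R G t t'
  | Plus t u => exists t' u', [/\ c = Plus t' u', R G t t' & R G u u']
  | Minus t u => exists t' u', [/\ c = Minus t' u', R G t t' & R G u u']
  | Times t u => exists t' u', [/\ c = Times t' u', R G t t' & R G u u']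
  | Der t u => exists U t' u',
      [/\ c = Der t' u', typed G u U, R (U :: G) t t' & R G u u']
  | Int t u v => exists U t' u' v', [/\ c = Int t' u' v', typed G t U /\ typed G u U,
      R G t t', R G u u' & R (U :: G) v v']
  | Inl T t => exists2 t', c = Inl T t' & R G t t'
  | Inr T t => exists2 t', c = Inr T t' & R G t t'
  | Case t u v => exists T U t' u' v', [/\ c = Case t' u' v', typed G t (TSum T U),
      R G t t', R (T :: G) u u' & R (U :: G) v v']
  | Fix t => exists2 t', c = Fix t' & R G t t'
  end.

Lemma congP R G t c : cong R G t c -> cong_inv R G t c.
Proof.
by case=> *; rewrite /=; try done; split_goal; eauto.
Qed.

Lemma steps_Tup G ts ts' :
  List.Forall2 (steps G) ts ts' -> steps G (Tup ts) (Tup ts').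
Proof.
move=> h; suff H us : steps G (Tup (us ++ ts)) (Tup (us ++ ts')) by exact: (H [::]).
elim: h us => [|t t' {}ts {}ts' ht _ IH] us; first exact: steps_refl.
apply: (@steps_trans _ _ _ (Tup (us ++ t' :: ts))).
  apply: (steps_ctx (f := fun x => Tup (us ++ x :: ts))) ht => a b; exact: C_Tup.
by rewrite -!cat_rcons.
Qed.

Lemma steps_ctx2 G G1 G2 (f : term S -> term S -> term S) t t' u u' :
  (forall a b, step G1 a b -> step G (f a u) (f b u)) ->
  (forall a b, step G2 a b -> step G (f t' a) (f t' b)) ->
  steps G1 t t' -> steps G2 u u' -> steps G (f t u) (f t' u').
Proof. by move=> h1 h2 /(steps_ctx h1) h /(steps_ctx h2); exact: steps_trans. Qed.

(** Bodies are reduced before points, limits and scrutinees, so that the typing premises of the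
    congruence rules still speak of the original subterms. *)
Lemma cong_steps G t c : cong (@steps S) G t c -> steps G t c.
Proof.
case=> {t c}; try (by move=> *; exact: steps_refl).
- by move=> T t t'; apply: steps_ctx => *; exact: C_Lam.
- by move=> t t' u u'; apply: steps_ctx2 => *; [exact: C_App1 | exact: C_App2].
- by move=> *; exact: steps_Tup.
- by move=> j t t'; apply: steps_ctx => *; exact: C_Proj.
- by move=> t t' u u'; apply: steps_ctx2 => *; [exact: C_Add1 | exact: C_Add2].
- by move=> t t' u u'; apply: steps_ctx2 => *; [exact: C_Sub1 | exact: C_Sub2].
- by move=> t t' u u'; apply: steps_ctx2 => *; [exact: C_Mul1 | exact: C_Mul2].
- move=> U t t' u u' hu h1 h2.
  apply: (steps_ctx2 _ _ h1 h2) => *; [exact: C_Der1 hu _ | exact: C_Der2].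
- move=> U t t' u u' v v' ht hu h1 h2 h3; apply: (@steps_trans _ _ _ (Int t u v')).
    by apply: (steps_ctx _ h3) => *; exact: C_Int3 ht hu _.
  by apply: (steps_ctx2 (f := fun x y => Int x y v') _ _ h1 h2) => *;
    [exact: C_Int1 | exact: C_Int2].
- by move=> T t t'; apply: steps_ctx => *; exact: C_Inl.
- by move=> T t t'; apply: steps_ctx => *; exact: C_Inr.
- move=> T U t t' u u' v v' ht h1 h2 h3; apply: (@steps_trans _ _ _ (Case t u' v')).
    by apply: (steps_ctx2 (f := Case t) _ _ h2 h3) => *; [exact: C_Case1 ht _ | exact: C_Case2 ht _].
  by apply: (steps_ctx (f := fun x => Case x u' v') _ h1) => *; exact: C_Case.
- by move=> t t'; apply: steps_ctx => *; exact: C_Fix.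
Qed.
End SubjectReduction.

(** * Confluence *)

Section Confluence.
Context {S : signature}.
Implicit Types (t u v : term S) (s : nat -> term S) (r : nat -> nat).
Implicit Types (T U : type (base S)) (G D : seq (type (base S))).

(** Packs the induction hypotheses for all immediate subterms into one predicate, so that an
    induction can go through [cong] without a case for each constructor. *)
Definition imm (P : term S -> Prop) t : Prop :=
  match t with
  | Var _ | Cst _ _ => True
  | Lam _ a | Proj _ a | Inl _ a | Inr _ a | Fix a => P a
  | App a b | Plus a b | Minus a b | Times a b | Der a b => P a /\ P b
  | Tup ts => List.Forall P ts
  | Int a b c | Case a b c => [/\ P a, P b & P c]
  end.

Lemma imm_ind (P : term S -> Prop) : (forall t, imm P t -> P t) -> forall t, P t.
Proof. by move=> h; elim/(@term_nested_ind S) => *; apply: h. Qed.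

Lemma imm_impl (P Q : term S -> Prop) t : (forall x, P x -> Q x) -> imm P t -> imm Q t.
Proof.
move=> h; case: t => //=; try (by move=> *; auto); try (by move=> ? ? []; auto).
- by move=> ts; apply: List.Forall_impl.
- by move=> t u v []; split; auto.
- by move=> t u v []; split; auto.
Qed.

Lemma cong_imm (R Q : seq (type (base S)) -> term S -> term S -> Prop) G t c :
  imm (fun x => forall G y, R G x y -> Q G x y) t -> cong R G t c -> cong Q G t c.
Proof.
move=> h k; case: k h => {t c} /=; try by move=> *; constructor; auto.
- by move=> t t' u u' h1 h2 []; constructor; auto.
- move=> ts ts' h IH; constructor; apply: Forall2_Forall_impl h.
  by apply: List.Forall_impl IH => t h u; apply: h.
- by move=> t t' u u' h1 h2 []; constructor; auto.
- by move=> t t' u u' h1 h2 []; constructor; auto.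
- by move=> t t' u u' h1 h2 []; constructor; auto.
- by move=> U t t' u u' h h1 h2 []; econstructor; eauto.
- by move=> U t t' u u' v v' h h' h1 h2 h3 []; econstructor; eauto.
- by move=> T U t t' u u' v v' h h1 h2 h3 []; econstructor; eauto.
Qed.

Definition wt G t := exists T, typed G t T.

Lemma typed_wt G t T : typed G t T -> wt G t.
Proof. by exists T. Qed.


(* Since the root is contracted after its subterms, the diamond property reduces
   to [contr_par] and [contr_det]. *)
Inductive par G t u : Prop :=
  par_intro c of cong par G t c & c = u \/ contr G c u.

Lemma par_cong G t u : cong par G t u -> par G t u.
Proof. by exists u => //; left. Qed.

Lemma cong_refl R G t : wt G t -> (forall G x, wt G x -> R G x x) -> cong R G t t.
Proof.
move=> [T /typedP h] hR; case: t h => /=.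
- by constructor.
- by constructor.
- by move=> T1 t [T2 _ h]; constructor; apply: hR; exists T2.
- by move=> t u [T1 h1 h2]; constructor; apply: hR; eexists; eauto.
- move=> ts [T1 [Ts [_ h]]]; constructor; apply/Forall2_onth; split=> // i x y hx.
  have [U _ hU] := Forall2_getl h hx; rewrite hx => -[<-].
  by apply: hR; exists U.
- by move=> j t [T1 [Ts [h _]]]; constructor; apply: hR; eexists; eauto.
- by move=> t u [_ h1 h2]; constructor; apply: hR; eexists; eauto.
- by move=> t u [_ h1 h2]; constructor; apply: hR; eexists; eauto.
- by move=> t u [U [_ _ h1 h2]]; constructor; apply: hR; eexists; eauto.
- by move=> t u [V [U [_ _ h1 h2]]]; econstructor; eauto; apply: hR; eexists; eauto.
- by move=> t u v [U [_ _ h1 h2 h3]]; econstructor; eauto; apply: hR; eexists; eauto.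
- by move=> T1 t [T2 _ h]; constructor; apply: hR; exists T2.
- by move=> T1 t [T2 _ h]; constructor; apply: hR; exists T2.
- move=> t u v [T1 [T2 [h1 h2 h3]]]; econstructor; eauto; apply: hR; eexists; eauto.
- by move=> t h; constructor; apply: hR; eexists; eauto.
Qed.

(** Reflexivity holds for well-typed terms only, because [cong] asks for the types of points, limits
    and scrutinees. *)
Lemma par_refl G t : wt G t -> par G t t.
Proof.
elim/imm_ind: t G => t IH G h; apply: par_cong.
apply: (@cong_imm (fun G x y => wt G x /\ x = y)); last by apply: cong_refl.
by apply: imm_impl IH => x hx G' y [hw <-]; exact: hx.
Qed.

Lemma par_steps G t u : par G t u -> steps G t u.
Proof.
elim/imm_ind: t G u => t IH G u [c /(cong_imm IH) /cong_steps h [<- //|h']].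
exact: steps_trans h (steps_contr h').
Qed.

Lemma par_typed G t u T : par G t u -> typed G t T -> typed G u T.
Proof. by move/par_steps/steps_typed; apply. Qed.

Lemma par_wt G t u : par G t u -> wt G t -> wt G u.
Proof. by move=> h [T /(par_typed h) hT]; exists T. Qed.

(** A step in one subterm is a congruence in which the other subterms stay equal. Well-typedness is
    recorded along with it so that the equal ones can be related by the reflexivity of [par]. *)
Lemma sub_step_cong G t t' : sub_step G t t' -> wt G t ->
  cong (fun G a b => wt G a /\ (a = b \/ step G a b)) G t t'.
Proof.
move=> hs [T hT]; case: t hs hT => [||||ts||||||||||] /=.
5: { case=> us [x [x' [vs [-> -> hs]]]] /typedP [T1 [Ts [_ h]]]; constructor.
  apply/Forall2_onth; split; first by rewrite !size_cat.
  move=> i a b ha; have [U _ hU] := Forall2_getl h ha.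
  move: ha; rewrite !onth_cat; case: ifP => _.
    by move=> -> [<-]; split; [exists U | left].
  case: (i - size us) => [|k] /=; first by move=> [e1] [e2]; subst; split; [exists U | right].
  by move=> -> [<-]; split; [exists U | left]. }
all: intros; repeat match goal with H : _ \/ _ |- _ => destruct H
  | H : or3 _ _ _ |- _ => destruct H end; destruct_all; invert_typed; unify_types;
  try (by []); econstructor; eauto; (split; [by eapply typed_wt; eassumption | by auto]).
Qed.

Lemma step_par G t u : wt G t -> step G t u -> par G t u.
Proof.
elim/imm_ind: t G u => t IH G u hw /stepP [h|h].
  by exists t; [apply: cong_refl => // *; exact: par_refl | right].
apply: par_cong; apply: cong_imm (sub_step_cong h hw).
apply: imm_impl IH => x hx G' y [hwx [<-|hs]]; [exact: par_refl | exact: hx].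
Qed.

Lemma contr_Var G i u : ~ contr G (Var i) u.
Proof. by move=> h; inversion h. Qed.

(** Lifting a pair of related substitutions under a binder uses stability under shifting, which is
    itself an instance of the claim. Abstracting the class [K] of pairs, closed under lifting, lets
    one induction serve renamings and afterwards arbitrary substitutions. *)
Lemma par_subst_gen (K : (nat -> term S) -> (nat -> term S) ->
    seq (type (base S)) -> seq (type (base S)) -> Prop) :
  (forall s s' G D, K s s' G D -> [/\ tsub s G D, tsub s' G D &
     forall i T, onth G i = Some T -> par D (s i) (s' i)]) ->
  (forall s s' G D T, K s s' G D -> K (upsubst s) (upsubst s') (T :: G) (T :: D)) ->
  forall t u s s' G D, K s s' G D -> wt G t -> par G t u ->
  par D (subst s t) (subst s' u).
Proof.
move=> hK hup; elim/imm_ind => t IH u s s' G D k hw [c hc hu].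
have [h1 h2 h3] := hK _ _ _ _ k.
(* Variables are the exception, settled by the hypothesis on [K]. Any other head survives the
   substitution, so a contraction at the root can be repeated after it. *)
suff : (exists i, t = Var i) \/ cong par D (subst s t) (subst s' c).
  case=> [[i et]|hk].
    move: hc hu hw; rewrite et => /congP /= -> [<-|/contr_Var //] [T /typedP].
    exact: h3.
  by exists (subst s' c) => //; case: hu => [->|/(contr_subst h2)]; auto.
move: hw; case: hc IH => {t u hu c}; first by left; exists i.
4: { move=> ts ts' p H1 [? /typedP /= [T1 [Ts [_ q1]]]]; right; apply: K_Tup.
  apply/Forall2_onth; split; first by rewrite !size_map (Forall2_size p).
  move=> i x y; rewrite !onth_mapE.
  case ei: (onth ts i) => [a|//]; case ei': (onth ts' i) => [a'|//] /= [<-] [<-].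
  have [U _ hU] := Forall2_getl q1 ei.
  move/Forall_onth: H1 => /(_ i a ei) H1.
  by eapply H1; [exact: k | exists U | exact: Forall2_get p ei ei']. }
all: intros; right; simpl in *; destruct_all;
  match goal with H : wt _ _ |- _ => destruct H end; invert_typed; unify_types;
  by econstructor; eauto using typed_wt, typed_subst.
Qed.

Lemma par_rename r G D t u : ren r G D -> wt G t -> par G t u ->
  par D (rename r t) (rename r u).
Proof.
move=> h; rewrite !renameE.
(* Equalities are pointwise because lifting a renaming agrees with [upren] only extensionally. *)
pose K s s' G D := exists r', [/\ ren r' G D, s =1 (fun i => @Var S (r' i)) &
  s' =1 (fun i => @Var S (r' i))].
apply: (@par_subst_gen K); last by exists r.
- move=> s s' G' D' [r' [hr e e']]; split=> i T hi; rewrite ?e ?e'.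
  + exact: (tsub_ren hr).
  + exact: (tsub_ren hr).
  + by apply: par_cong; constructor.
- move=> s s' G' D' T [r' [hr e e']]; exists (upren r').
  by split; [exact: ren_up | move=> [|i] //=; rewrite ?e ?e'..].
Qed.

Lemma par_shift G t u T : wt G t -> par G t u -> par (T :: G) (shift t) (shift u).
Proof. exact: par_rename. Qed.

Lemma par_subst s s' G D t u : tsub s G D -> tsub s' G D ->
  (forall i T, onth G i = Some T -> par D (s i) (s' i)) ->
  wt G t -> par G t u -> par D (subst s t) (subst s' u).
Proof.
move=> h1 h2 h3.
pose K s s' G D := [/\ tsub s G D, tsub s' G D &
  forall i T, onth G i = Some T -> par D (s i) (s' i)].
apply: (@par_subst_gen K) => //.
move=> {h1 h2 h3} s1 s2 G' D' T [h1 h2 h3]; split; try exact: tsub_up.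
case=> [|i] U /= hi; first by apply: par_cong; constructor.
by apply: par_shift (h3 _ _ hi); exists U; apply: h1.
Qed.

Lemma par_inst G t t' u u' U : typed G u U -> wt (U :: G) t ->
  par (U :: G) t t' -> par G u u' -> par G (inst t u) (inst t' u').
Proof.
move=> hu ht p pu; apply: par_subst p => //.
- exact: tsub_scons (@tsub_id _ G).
- by apply: tsub_scons (@tsub_id _ G); exact: par_typed hu.
- by case=> [|i] T //= hi; apply: par_cong; constructor.
Qed.

Lemma par_Lam_inv G T t u : par G (Lam T t) u ->
  exists2 t', u = Lam T t' & par (T :: G) t t'.
Proof. by case=> c /congP [t' -> h] [<-|h']; [exists t' | inversion h']. Qed.

Lemma par_Tup_inv G ts u : par G (Tup ts) u ->
  exists2 ts', u = Tup ts' & List.Forall2 (par G) ts ts'.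
Proof. by case=> c /congP [t' -> h] [<-|h']; [exists t' | inversion h']. Qed.

Lemma par_Inl_inv G T t u : par G (Inl T t) u ->
  exists2 t', u = Inl T t' & par G t t'.
Proof. by case=> c /congP [t' -> h] [<-|h']; [exists t' | inversion h']. Qed.

Lemma par_Inr_inv G T t u : par G (Inr T t) u ->
  exists2 t', u = Inr T t' & par G t t'.
Proof. by case=> c /congP [t' -> h] [<-|h']; [exists t' | inversion h']. Qed.

Lemma par_isBase G t t' : par G t t' -> isBase G t -> isBase G t'.
Proof. by move=> p [b /(par_typed p) h]; exists b. Qed.

Lemma par_Plus G t t' u u' : par G t t' -> par G u u' ->
  par G (Plus t u) (Plus t' u').
Proof. by move=> *; apply: par_cong; constructor. Qed.

Lemma par_bigPlus G ts us t u w ws : ts = t :: ws -> us = u :: w ->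
  List.Forall2 (par G) ts us -> par G (bigPlus t ws) (bigPlus u w).
Proof.
move=> -> -> /List.Forall2_cons_iff [h hs]; rewrite /bigPlus.
by elim: hs t u h => //= x y l l' hxy _ IH t u h; apply: IH; apply: par_Plus.
Qed.

Lemma par_nth G ts ts' i : List.Forall2 (par G) ts ts' -> i < size ts ->
  par G (nth (Var 0) ts i) (nth (Var 0) ts' i).
Proof.
move=> h /lt_onth [t ht]; have [t' ht' p] := Forall2_getl h ht.
by rewrite (onth_nth (Var 0) _ _ _ ht) (onth_nth (Var 0) _ _ _ ht').
Qed.

Lemma par_mixed G us us' ts ts' i T1 Ts U :
  List.Forall2 (typed G) us (T1 :: Ts) -> List.Forall2 (typed G) ts (T1 :: Ts) ->
  List.Forall2 (par G) us us' -> List.Forall2 (par G) ts ts' ->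
  par (U :: G) (mixed i us ts) (mixed i us' ts').
Proof.
move=> hus hts pus pts; apply: par_cong; apply: K_Tup.
have H xs ys Us : List.Forall2 (typed G) xs Us -> List.Forall2 (par G) xs ys ->
    List.Forall2 (par (U :: G)) (map shift xs) (map shift ys).
  move=> hx p; apply/Forall2_onth; split; first by rewrite !size_map (Forall2_size p).
  move=> k x y; rewrite !onth_mapE.
  case ei: (onth xs k) => [a|//]; case ei': (onth ys k) => [a'|//] /= [<-] [<-].
  have [V _ hV] := Forall2_getl hx ei.
  by apply: par_shift (Forall2_get p ei ei'); exists V.
apply: List.Forall2_app; last constructor.
- exact: H (Forall2_take _ hus) (Forall2_take _ pus).
- by apply: par_cong; constructor.
- exact: H (Forall2_drop _ hts) (Forall2_drop _ pts).
Qed.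

Lemma par_replace G t t' u u' U V : typed (V :: G) u U -> wt (U :: G) t ->
  par (U :: G) t t' -> par (V :: G) u u' -> par (V :: G) (replace t u) (replace t' u').
Proof.
move=> hu ht p pu; apply: par_subst p => //.
- by move=> [|i] W /=; [case=> <- | move=> h; apply/typedP].
- by move=> [|i] W /=; [case=> <-; exact: par_typed hu | move=> h; apply/typedP].
- by case=> [|i] T //= hi; apply: par_cong; constructor.
Qed.

Lemma Forall2_map2 (A B : Type) (R : B -> B -> Prop) (Q : A -> A -> Prop)
    (f g : A -> B) l l' :
  (forall i x y, onth l i = Some x -> onth l' i = Some y -> Q x y -> R (f x) (g y)) ->
  List.Forall2 Q l l' -> List.Forall2 R (map f l) (map g l').
Proof.
move=> h p; apply/Forall2_onth; split; first by rewrite !size_map (Forall2_size p).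
move=> i x y; rewrite !onth_mapE.
case e: (onth l i) => [a|//]; case e': (onth l' i) => [a'|//] /= [<-] [<-].
exact: h e e' (Forall2_get p e e').
Qed.

Lemma Forall2_zip (op : term S -> term S -> term S) G ts ts' us us' :
  (forall t t' u u', par G t t' -> par G u u' -> par G (op t u) (op t' u')) ->
  List.Forall2 (par G) ts ts' -> List.Forall2 (par G) us us' ->
  List.Forall2 (par G) [seq op p.1 p.2 | p <- zip ts us]
                       [seq op p.1 p.2 | p <- zip ts' us'].
Proof.
move=> hop h; elim: h us us' => [|t t' {}ts {}ts' ht _ IH] us us' [] //=;
  constructor; auto.
Qed.

(** A redex stays a redex when its subterms reduce: introduction forms keep their heads, tuples keep
    their lengths, and base types are preserved. *)
Lemma contr_par G t u c : wt G t -> contr G t u -> cong par G t c ->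
  exists2 u', contr G c u' & par G u u'.
Proof.
move=> hw h; case: h hw => {t u}.
- move=> T t u [V /typedP [V' /typedP [W [? _] ht] hu]] /congP.
  move=> [? [u' [-> /par_Lam_inv [t' -> pt] pu]]]; subst V'.
  exists (inst t' u'); first by constructor.
  by apply: (par_inst hu) pt pu; exists W.
- move=> ts j t hj _ /congP [? -> /par_Tup_inv [ts' -> p]].
  by have [t' ht' pt] := Forall2_getl p hj; exists t' => //; constructor.
- move=> W t t1 t2 [V /typedP [T1 [T2 [/typedP [? [? ?] ht] h1 h2]]]] /congP.
  move=> [? [? [? [a [b [-> /typedP [? [? ?] hT] /par_Inl_inv [t' -> pt] p1 p2]]]]]]; subst.
  have ? := typed_uniq ht hT; subst.
  exists (inst a t'); first by constructor.
  by apply: (par_inst ht) p1 pt; exists V.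
- move=> W t t1 t2 [V /typedP [T1 [T2 [/typedP [? [? ?] ht] h1 h2]]]] /congP.
  move=> [? [? [? [a [b [-> /typedP [? [? ?] hT] /par_Inr_inv [t' -> pt] p1 p2]]]]]]; subst.
  have ? := typed_uniq ht hT; subst.
  exists (inst b t'); first by constructor.
  by apply: (par_inst ht) p2 pt; exists V.
- move=> f _ /congP [f' -> p]; exists (App f' (Fix f')); first by constructor.
  by apply: par_cong; constructor=> //; apply: par_cong; constructor.
- move=> ts t0 hb [V /typedP [V' [U [_ _ h0 _]]]] /congP.
  move=> [W [? [t0' [-> hW /par_Tup_inv [ts' -> p] p0]]]].
  eexists; first by apply: R_DerTup; exact: par_isBase hb.
  apply: par_cong; apply: K_Tup; apply: Forall2_map2 p => i x y _ _ pxy.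
  by apply: par_cong; apply: K_Der hW pxy p0.
- move=> T t t0 hb _ /congP [W [? [t0' [-> hW /par_Inl_inv [t' -> p] p0]]]].
  eexists; first by apply: R_DerInl; exact: par_isBase hb.
  by apply: par_cong; apply: K_Inl; apply: par_cong; apply: K_Der hW p p0.
- move=> T t t0 hb _ /congP [W [? [t0' [-> hW /par_Inr_inv [t' -> p] p0]]]].
  eexists; first by apply: R_DerInr; exact: par_isBase hb.
  by apply: par_cong; apply: K_Inr; apply: par_cong; apply: K_Der hW p p0.
- move=> T t t0 hb [V /typedP [V' [U [_ _ h0 /typedP [X _ hX]]]]] /congP.
  move=> [W [? [t0' [-> hW /par_Lam_inv [t' -> p] p0]]]].
  have ? := typed_uniq h0 hW; subst W.
  eexists; first by apply: R_DerLam; exact: par_isBase hb.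
  apply: par_cong; apply: K_Lam; apply: par_cong; apply: (K_Der (U := U)).
  + exact: typed_shift.
  + by apply: par_rename p; [case=> [|[|i]] | exists X].
  + by apply: par_shift p0; exists U.
- move=> t ts [V /typedP [V' [U [_ hU h0 ht]]]] /congP.
  move=> [W [t' [? [-> hW pt /par_Tup_inv [ts' -> p]]]]].
  have ? := typed_uniq h0 hW; subst W.
  eexists; first by apply: R_DerAtTup.
  apply: par_cong; apply: K_Tup; rewrite -(Forall2_size p).
  apply: Forall2_mkseq => i hi.
  have [T1 [Ts [Ui [eU hUi dUi hn]]]] := typed_DerAt hU ht h0 hi; subst U.
  have hts := typed_Tup_nth h0.
  apply: par_cong; apply: (K_Der hn); last exact: par_nth.
  apply: (par_replace (typed_mixed hts hts hUi)) pt _; first by exists V'.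
  exact: (par_mixed _ _ hts hts p p).
- move=> t1 t2 ts hb hb' _ /congP [W [a [b [? [-> [hW hW'] pa pb /par_Tup_inv [ts' -> p]]]]]].
  eexists; first by apply: R_IntTup; [exact: par_isBase hb | exact: par_isBase hb'].
  apply: par_cong; apply: K_Tup; apply: Forall2_map2 p => i x y _ _ pxy.
  by apply: par_cong; apply: K_Int hW hW' pa pb pxy.
- move=> T t1 t2 t hb hb' _ /congP [W [a [b [? [-> [hW hW'] pa pb /par_Inl_inv [t' -> p]]]]]].
  eexists; first by apply: R_IntInl; [exact: par_isBase hb | exact: par_isBase hb'].
  by apply: par_cong; apply: K_Inl; apply: par_cong; apply: K_Int hW hW' pa pb p.
- move=> T t1 t2 t hb hb' _ /congP [W [a [b [? [-> [hW hW'] pa pb /par_Inr_inv [t' -> p]]]]]].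
  eexists; first by apply: R_IntInr; [exact: par_isBase hb | exact: par_isBase hb'].
  by apply: par_cong; apply: K_Inr; apply: par_cong; apply: K_Int hW hW' pa pb p.
- move=> T t1 t2 t hb hb' [V /typedP [U [_ _ h1 h2 /typedP [X _ hX]]]] /congP.
  move=> [W [a [b [? [-> [hW hW'] pa pb /par_Lam_inv [t' -> p]]]]]].
  have ? := typed_uniq h1 hW; subst W.
  eexists; first by apply: R_IntLam; [exact: par_isBase hb | exact: par_isBase hb'].
  apply: par_cong; apply: K_Lam; apply: par_cong; apply: (K_Int (U := U)).
  + exact: typed_shift.
  + exact: typed_shift.
  + by apply: par_shift pa; exists U.
  + by apply: par_shift pb; exists U.
  + by apply: par_rename p; [case=> [|[|i]] | exists X].
- move=> t ts1 ts2 w ws hsz hw [V /typedP [U [_ hU h1 h2 ht]]] /congP.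
  move=> [W [? [? [t' [-> [hW hW'] /par_Tup_inv [ts1' -> p1] /par_Tup_inv [ts2' -> p2] pt]]]]].
  have ? := typed_uniq h1 hW; subst W.
  set F := fun ts1 ts2 t => [seq Int (nth (Var 0) ts1 i) (nth (Var 0) ts2 i)
           (Proj i (replace t (mixed i ts2 ts1))) | i <- iota 0 (size ts1)].
  have hF : List.Forall2 (par G) (F ts1 ts2 t) (F ts1' ts2' t').
    rewrite /F -(Forall2_size p1); apply: Forall2_mkseq => i hi.
    have [T1 [Ts [Ui [eU hUi dUi hn]]]] := typed_DerAt hU ht h1 hi; subst U.
    have hi2 := hi; rewrite hsz in hi2.
    have [? [? [? [[<- <-] hUi' _ hn']]]] := typed_DerAt hU ht h2 hi2.
    move: hUi'; rewrite hUi => -[?]; subst.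
    have hts1 := typed_Tup_nth h1; have hts2 := typed_Tup_nth h2.
    apply: par_cong; apply: (K_Int hn hn'); try exact: par_nth.
    apply: par_cong; apply: K_Proj.
    apply: (par_replace (typed_mixed hts2 hts1 hUi)) pt _; first by eexists; exact: ht.
    exact: (par_mixed _ _ hts2 hts1 p2 p1).
  have : size (F ts1' ts2' t') = size (w :: ws) by rewrite -hw -(Forall2_size hF).
  case eF: (F ts1' ts2' t') => [|w' ws'] // _.
  exists (bigPlus w' ws'); last by apply: par_bigPlus hF.
  by apply: R_IntBetweenTup => //; rewrite -(Forall2_size p1) -(Forall2_size p2).
- move=> ts us hsz _ /congP [? [? [-> /par_Tup_inv [ts' -> p] /par_Tup_inv [us' -> p']]]].
  eexists; first by apply: R_AddTup; rewrite -(Forall2_size p) -(Forall2_size p').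
  apply: par_cong; apply: K_Tup; apply: Forall2_zip => // *.
  exact: par_Plus.
- move=> T t u _ /congP [? [? [-> /par_Lam_inv [t' -> p] /par_Lam_inv [u' -> p']]]].
  exists (Lam T (Plus t' u')); first by constructor.
  by apply: par_cong; apply: K_Lam; apply: par_Plus.
- move=> ts us hsz _ /congP [? [? [-> /par_Tup_inv [ts' -> p] /par_Tup_inv [us' -> p']]]].
  eexists; first by apply: R_SubTup; rewrite -(Forall2_size p) -(Forall2_size p').
  apply: par_cong; apply: K_Tup; apply: Forall2_zip => // *.
  by apply: par_cong; constructor.
- move=> T t u _ /congP [? [? [-> /par_Lam_inv [t' -> p] /par_Lam_inv [u' -> p']]]].
  exists (Lam T (Minus t' u')); first by constructor.
  by apply: par_cong; apply: K_Lam; apply: par_cong; constructor.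
- move=> ts t0 hb _ /congP [? [t0' [-> /par_Tup_inv [ts' -> p] p0]]].
  eexists; first by apply: R_MulTup; exact: par_isBase hb.
  apply: par_cong; apply: K_Tup; apply: Forall2_map2 p => i x y _ _ pxy.
  by apply: par_cong; constructor.
- move=> T t t0 hb _ /congP [? [t0' [-> /par_Lam_inv [t' -> p] p0]]].
  eexists; first by apply: R_MulLam; exact: par_isBase hb.
  apply: par_cong; apply: K_Lam; apply: par_cong; constructor=> //.
  by apply: par_shift p0; case: hb => b hb; exists (TBase b).
- move=> T t t0 hb _ /congP [? [t0' [-> /par_Inl_inv [t' -> p] p0]]].
  eexists; first by apply: R_MulInl; exact: par_isBase hb.
  by apply: par_cong; apply: K_Inl; apply: par_cong; constructor.
- move=> T t t0 hb _ /congP [? [t0' [-> /par_Inr_inv [t' -> p] p0]]].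
  eexists; first by apply: R_MulInr; exact: par_isBase hb.
  by apply: par_cong; apply: K_Inr; apply: par_cong; constructor.
- move=> ts us w ws hsz hw _ /congP.
  move=> [? [? [-> /par_Tup_inv [ts' -> p] /par_Tup_inv [us' -> p']]]].
  have hF := Forall2_zip (op := @Times S)
    (fun t t' u u' h h' => par_cong (K_Times h h')) p p'.
  have := Forall2_size hF; rewrite hw.
  case eF: [seq Times q.1 q.2 | q <- zip ts' us'] => [|w' ws'] // _.
  exists (bigPlus w' ws'); last by apply: par_bigPlus hF.
  by apply: R_MulTupTup => //; rewrite -(Forall2_size p) -(Forall2_size p').
Qed.

Lemma isBase_Tup G ts : ~ isBase G (Tup ts).
Proof. by case=> b /typedP [? [? []]]. Qed.

(** Two rules could compete only when the point or the limits are tuples and the other argument is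
    an introduction form; there [isBase] excludes one of them. *)
Lemma contr_det G t u v : contr G t u -> contr G t v -> u = v.
Proof.
case=> {t u}; intros;
  match goal with H : contr _ _ v |- _ => inversion H; subst; clear H end;
  try congruence; try by match goal with H : isBase _ (Tup _) |- _ =>
    case: (isBase_Tup H) end.
Qed.

Definition join (R : seq (type (base S)) -> term S -> term S -> Prop) G t u :=
  exists2 v, R G t v & R G u v.

Definition par_local t := forall G a b, wt G t -> par G t a -> par G t b ->
  join par G a b.

Lemma cong_diamond G t a b : wt G t -> imm par_local t ->
  cong par G t a -> cong par G t b -> join (cong par) G a b.
Proof.
move=> [T hT] IH ha; case: ha T hT IH b => {t a} [||||ts ts' p X||||||||||].
5: { move=> /typedP [T1 [Ts [_ h]]] IH b /congP [us -> q].
  suff [vs q1 q2] : exists2 vs, List.Forall2 (par G) ts' vs & List.Forall2 (par G) us vs.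
    by exists (Tup vs); constructor.
  elim: p (T1 :: Ts) us h IH q => [|t t' {}ts {}ts' pt _ IHp] Us us h IH q.
    by inversion q; exists [::].
  case: us q => [|u us] q; first by inversion q.
  case: Us h => [|U Us] h; first by inversion h.
  case/List.Forall2_cons_iff: q => qu q; case/List.Forall2_cons_iff: h => hu h.
  case/List.Forall_cons_iff: IH => IHt IH.
  case: (IHt _ _ _ (ex_intro _ _ hu) pt qu) => v q1 q2.
  by case: (IHp _ _ h IH q) => vs q3 q4; exists (v :: vs); constructor. }
all: intros; match goal with H : cong par _ _ _ |- _ => apply congP in H; simpl in H end;
  simpl in *; destruct_all; invert_typed; unify_types;
  repeat match goal with IH : par_local ?t, p : par ?G ?t ?a, q : par ?G ?t ?b |- _ =>
    let h := fresh in have h : wt G t by [eapply typed_wt; eassumption]; destruct (IH G a b h p q); clear IH h end;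
  eexists; econstructor; eauto using par_typed.
Qed.

Lemma par_diamond t : par_local t.
Proof.
elim/imm_ind: t => t IH G a b hw [c hc ha] [d hd hb].
(* The interiors are joined at [e] by the hypothesis on subterms; every contraction performed at the
   root on either side is then repeated on [e]. *)
have [e hce hde] := cong_diamond hw IH hc hd.
have hwc : wt G c by apply: par_wt hw; exact: par_cong.
have hwd : wt G d by apply: par_wt hw; exact: par_cong.
case: ha hb => [<-|ha] [<-|hb].
- by exists e; exact: par_cong.
- have [b' hb' pb] := contr_par hwd hb hde.
  by exists b' => //; exists e => //; right.
- have [a' ha' pa] := contr_par hwc ha hce.
  by exists a' => //; exists e => //; right.
- have [b' hb' pb] := contr_par hwd hb hde.
  have [a' ha' pa] := contr_par hwc ha hce.
  by exists a' => //; rewrite (contr_det ha' hb').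
Qed.

Lemma steps_wt G t u : steps G t u -> wt G t -> wt G u.
Proof. by move=> h [T /(steps_typed h) hT]; exists T. Qed.

Lemma par_strip G t a b : wt G t -> par G t a -> steps G t b ->
  exists2 c, steps G a c & par G b c.
Proof.
move=> hw ha hb; elim: hb => [|u v hu [c hac huc] huv].
  by exists a => //; exact: steps_refl.
have hwu := steps_wt hu hw.
have [d hcd hvd] := par_diamond hwu huc (step_par hwu huv).
by exists d => //; apply: steps_trans hac _; exact: par_steps.
Qed.

Lemma confluence G t a b : wt G t -> steps G t a -> steps G t b -> join (@steps S) G a b.
Proof.
move=> hw ha hb; elim: ha => [|u v hu [c huc hbc] huv].
  by exists b => //; exact: steps_refl.
have hwu := steps_wt hu hw.
have [d hvd hcd] := par_strip hwu (step_par hwu huv) huc.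
by exists d => //; apply: steps_trans hbc _; exact: par_steps.
Qed.

Lemma irreducible_steps G t u : irreducible G t -> steps G t u -> u = t.
Proof. by move=> h; elim=> // v w _ -> /h. Qed.

Lemma steps_irreducible G t n u : wt G t -> irreducible G n -> steps G t n ->
  steps G t u -> steps G u n.
Proof.
by move=> hw hn htn /(confluence hw htn) [v /(irreducible_steps hn) -> ].
Qed.

(** Since [R] preserves types, the types recorded by the two congruences for their binders
    coincide. *)
Lemma cong_comp (R Q P : seq (type (base S)) -> term S -> term S -> Prop) G t u v :
  (forall G t u T, R G t u -> typed G t T -> typed G u T) ->
  (forall G t u v, R G t u -> Q G u v -> P G t v) ->
  cong R G t u -> cong Q G u v -> cong P G t v.
Proof.
move=> hR hP h; case: h => {t u}.
- by move=> i /congP ->; constructor.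
- by move=> A c /congP ->; constructor.
- by move=> T t t' p /congP [t'' -> q]; constructor; eauto.
- by move=> t t' u u' p p' /congP [? [? [-> q q']]]; constructor; eauto.
- move=> ts ts' p /congP [us -> q]; constructor; apply/Forall2_onth.
  split; first by rewrite (Forall2_size p) (Forall2_size q).
  move=> i x y hx hy; have [z hz pz] := Forall2_getl p hx.
  exact: hP pz (Forall2_get q hz hy).
- by move=> j t t' p /congP [t'' -> q]; constructor; eauto.
- by move=> t t' u u' p p' /congP [? [? [-> q q']]]; constructor; eauto.
- by move=> t t' u u' p p' /congP [? [? [-> q q']]]; constructor; eauto.
- by move=> t t' u u' p p' /congP [? [? [-> q q']]]; constructor; eauto.
- move=> U t t' u u' h p p' /congP [U' [? [? [-> h' q q']]]].
  have ? := typed_uniq h' (hR _ _ _ _ p' h); subst U'.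
  by apply: (K_Der (U := U)); eauto.
- move=> U t t' u u' x x' h1 h2 p p' p'' /congP [U' [? [? [? [-> [h' _] q q' q'']]]]].
  have ? := typed_uniq h' (hR _ _ _ _ p h1); subst U'.
  by apply: (K_Int (U := U)); eauto.
- by move=> T t t' p /congP [t'' -> q]; constructor; eauto.
- by move=> T t t' p /congP [t'' -> q]; constructor; eauto.
- move=> T U t t' u u' x x' h p p' p'' /congP [T' [U' [? [? [? [-> h' q q' q'']]]]]].
  have [? ?] := typed_uniq h' (hR _ _ _ _ p h); subst U' T'.
  by apply: (K_Case (T := T) (U := U)); eauto.
- by move=> t t' p /congP [t'' -> q]; constructor; eauto.
Qed.

(** The reduction is cut at its first contraction at the root: all that precedes happens inside
    immediate subterms and is collected into one [cong]. The inversion principles for normalization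
    start from this decomposition. *)
Lemma steps_head G t u : wt G t -> steps G t u ->
  exists2 c, cong (@steps S) G t c &
    c = u \/ exists2 v, contr G c v & steps G v u.
Proof.
move=> hw; elim=> [|u' v hu [c hc [e|[w h h']]] hs].
- by exists t; [apply: cong_refl => // *; exact: steps_refl | left].
- subst u'; case/stepP: (hs) => [h|/sub_step_cong h].
    by exists c => //; right; exists v => //; exact: steps_refl.
  have {}h := h (steps_wt hu hw).
  exists v; last by left.
  apply: cong_comp hc h => [|G' x y z hxy [_ [<- //|hyz]]].
    by move=> *; apply: steps_typed; eassumption.
  exact: steps_step hxy hyz.
- by exists c => //; right; exists w => //; exact: steps_step h' hs.
Qed.

(** Bodies are required to be irreducible only for types that the point, limits or scrutinee
    actually have, mirroring the premises of the congruence rules. *)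
Definition args_irreducible G t : Prop :=
  match t with
  | Var _ | Cst _ _ => True
  | Lam T a => irreducible (T :: G) a
  | Proj _ a | Inl _ a | Inr _ a | Fix a => irreducible G a
  | App a b | Plus a b | Minus a b | Times a b => irreducible G a /\ irreducible G b
  | Tup ts => List.Forall (irreducible G) ts
  | Der a b => irreducible G b /\ forall T, typed G b T -> irreducible (T :: G) a
  | Int a b c => [/\ irreducible G a, irreducible G b &
      forall T, typed G a T -> typed G b T -> irreducible (T :: G) c]
  | Case a b c => irreducible G a /\ forall T1 T2, typed G a (TSum T1 T2) ->
      irreducible (T1 :: G) b /\ irreducible (T2 :: G) c
  end.

Lemma irreducibleP G t :
  irreducible G t <-> args_irreducible G t /\ forall u, ~ contr G t u.
Proof.
split=> [h|[h hc] u /stepP [/hc //|hs]].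
  split; last by move=> u /contr_step /h.
  case: t h => [i|A c|T1 t|t u|ts|j t|t u|t u|t u|t u|t u v|T1 t|T1 t|t u v|t] h //=.
  all: try split; try (move=> ? hs; by eapply h; econstructor; eassumption).
  - apply/Forall_onth => i x hi y hs.
    have e : ts = take i ts ++ x :: drop i.+1 ts.
      by rewrite -(drop_onth hi) cat_take_drop.
    by apply: (h (Tup (take i ts ++ y :: drop i.+1 ts))); rewrite [in Tup ts]e; constructor.
  - by move=> T hT u' hs; apply: (h _ (C_Der1 hT hs)).
  - by move=> T hT hT' u' hs; apply: (h _ (C_Int3 hT hT' hs)).
  - move=> T1 T2 hT; split=> u' hs; first by apply: (h _ (C_Case1 _ hT hs)).
    by apply: (h _ (C_Case2 _ hT hs)).
case: t h hc hs => [i|A c|T1 t|t v|ts|j t|t v|t v|t v|t v|t v w|T1 t|T1 t|t v w|t] //=.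
- by move=> h _ [x _ /h].
- by move=> [h h'] _ [[x _ /h]|[x _ /h']].
- move=> h _ [us [x [x' [vs [e _ hs]]]]]; subst ts.
  by case/List.Forall_app: h => _ /List.Forall_cons_iff [/(_ _ hs)].
- by move=> h _ [x _ /h].
- by move=> [h h'] _ [[x _ /h]|[x _ /h']].
- by move=> [h h'] _ [[x _ /h]|[x _ /h']].
- by move=> [h h'] _ [[x _ /h]|[x _ /h']].
- by move=> [h h'] _ [[T [x [_ hT /(h' _ hT)]]]|[x _ /h]].
- by move=> [h h' h''] _ [[x _ /h]|[x _ /h']|[T [x [_ hT hT' /(h'' _ hT hT')]]]].
- by move=> h _ [x _ /h].
- by move=> h _ [x _ /h].
- by move=> [h h'] _ [[x _ /h]|[T1 [T2 [x [_ hT]]]]|[T1 [T2 [x [_ hT]]]]] //;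
    case: (h' _ _ hT) => h1 h2; [move/h1 | move/h2].
- by move=> h _ [x _ /h].
Qed.
End Confluence.

(** * Weak normalization *)

Section Strengthening.
Context {S : signature}.
Implicit Types (t u v : term S) (s : nat -> term S) (r : nat -> nat).
Implicit Types (T U : type (base S)) (G D : seq (type (base S))).

Lemma isBase_unrename r G D t : ren r G D -> wt G t ->
  isBase D (rename r t) -> isBase G t.
Proof.
move=> hr [T hT] hb.
by have [b e] := isBase_typed hb (typed_rename hr hT); exists b; rewrite -e.
Qed.

Lemma rename_eq_Tup r t us : Tup us = rename r t ->
  exists2 ts, t = Tup ts & us = map (rename r) ts.
Proof. by case: t => //= ts [->]; exists ts. Qed.

(** A tuple type has at least one component, so the list of summands is non-empty and [bigPlus] has
    a head. *)
Lemma contr_Int_Tup G ts us t U : typed G (Tup ts) U -> typed G (Tup us) U ->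
  exists v, contr G (Int (Tup ts) (Tup us) t) v.
Proof.
move=> /typed_TupP [T [Ts [-> hts]]] /typed_Tup_nth hus.
have hsz : size ts = size us by rewrite (Forall2_size hts) (Forall2_size hus).
case: ts hts hsz => [/Forall2_size|x ts _ hsz] //.
by eexists; apply: R_IntBetweenTup.
Qed.

(** The shape of a redex is visible through a renaming, and its side conditions come back by
    uniqueness of types, which is where well-typedness enters. *)
Lemma contr_unrename r G D t u : ren r G D -> wt G t ->
  contr D (rename r t) u -> exists v, contr G t v.
Proof.
move=> hr [T /typedP hw]; case: t hw => [i|A c|T1 t|t v|ts|j t|t v|t v|t v|t v|t v w|T1 t|T1 t|t v w|t] /= hw h.
all: try (by inversion h).
- by destruct t; inversion h; eexists; constructor.
- destruct t as [| | | |ts| | | | | | | | | |]; inversion h; subst.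
  move: H2; rewrite onth_mapE; case e: (onth ts j) => [x|//] _.
  by exists x; constructor.
- destruct t; try (by inversion h); destruct v; inversion h; subst; eexists.
    by constructor.
  by apply: R_AddTup; move: H2; rewrite !size_map.
- destruct t; try (by inversion h); destruct v; inversion h; subst; eexists.
    by constructor.
  by apply: R_SubTup; move: H2; rewrite !size_map.
- have [U [_ _ h1 h2]] := hw.
  have hb : isBase D (rename r v) -> isBase G v by apply: isBase_unrename => //; exists U.
  destruct t as [| | | |ts| | | | | | | | | |]; inversion h; subst; try (by eexists; constructor; auto).
  have [us' ev eus] := rename_eq_Tup H0; subst v us.
  move: H1; rewrite !size_map; case: ts us' H3 {h h1 hw hb h2 H0} => [|x ts] [|y us] //= _ [e].
  by eexists; apply: R_MulTupTup => //=; rewrite e.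
- have [V [U [_ _ h2 h1]]] := hw.
  have hb : isBase D (rename r v) -> isBase G v by apply: isBase_unrename => //; exists U.
  by destruct v; try (by eexists; apply: R_DerAtTup); destruct t; inversion h; subst;
    eexists; constructor; auto.
- have [U [_ _ h1 h2 h3]] := hw.
  have hb : isBase D (rename r t) -> isBase G t by apply: isBase_unrename => //; exists U.
  have hb' : isBase D (rename r v) -> isBase G v by apply: isBase_unrename => //; exists U.
  have hbt ts1 ts2 : Tup ts1 = rename r t -> Tup ts2 = rename r v ->
      exists x, contr G (Int t v w) x.
    move=> /rename_eq_Tup [us1 et _] /rename_eq_Tup [us2 ev _]; subst t v.
    exact: contr_Int_Tup h1 h2.
  by destruct w; inversion h; subst; by [eexists; constructor; auto | eapply hbt; eassumption].
- by destruct t; inversion h; eexists; constructor.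
- by eexists; constructor.
Qed.

(** Once some contraction is known to exist below, determinism identifies its renaming with the
    given one, which spares a comparison of contracta rule by rule. *)
Lemma contr_unrenameE r G D t u : ren r G D -> wt G t ->
  contr D (rename r t) u -> exists2 v, u = rename r v & contr G t v.
Proof.
move=> hr hw h; have [v hv] := contr_unrename hr hw h.
by exists v => //; apply: contr_det h (contr_rename hr hv).
Qed.

Lemma step_unrename r G D t u : ren r G D -> wt G t ->
  step D (rename r t) u -> exists2 v, u = rename r v & step G t v.
Proof.
elim/(@imm_ind S): t r G D u => t IH r G D u hr hw /stepP [h|h].
  by have [v -> /contr_step hv] := contr_unrenameE hr hw h; exists v.
have {}IH : imm (fun t => forall r G D u T, ren r G D -> typed G t T ->
    step D (rename r t) u -> exists2 v, u = rename r v & step G t v) t.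
  by apply: imm_impl IH => x hx *; eapply hx; eauto; eexists; eauto.
case: hw => T /typedP hw.
case: t IH h hw => [i|A c|T1 t|t v|ts|j t|t v|t v|t v|t v|t v w|T1 t|T1 t|t v w|t] //= IH h hw.
- case: hw => T2 _ hw; case: h => b -> /(IH _ _ _ _ _ (ren_up hr) hw) [v -> hv].
  by exists (Lam T1 v) => //; constructor.
- case: hw IH h => ? h1 h2 [IH1 IH2] [[b -> h]|[b -> h]].
    have [x -> hx] := IH1 _ _ _ _ _ hr h1 h.
    by exists (App x v) => //; constructor.
  have [x -> hx] := IH2 _ _ _ _ _ hr h2 h.
  by exists (App t x) => //; constructor.
- case: hw => ? [? [_ hw]]; case: h => us [x [x' [vs [e -> hs]]]].
  have ei : onth (map (rename r) ts) (size us) = Some x.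
    by rewrite e onth_cat ltnn subnn.
  move: ei; rewrite onth_mapE; case ei: (onth ts (size us)) => [y|//] [ex].
  have [V _ hV] := Forall2_getl hw ei.
  move/Forall_onth: IH => /(_ _ _ ei) IH; rewrite -ex in hs.
  have [z ez hz] := IH _ _ _ _ _ hr hV hs.
  have ets : ts = take (size us) ts ++ y :: drop (size us).+1 ts.
    by rewrite -(drop_onth ei) cat_take_drop.
  exists (Tup (take (size us) ts ++ z :: drop (size us).+1 ts)); last first.
    by rewrite {1}ets; constructor.
  rewrite /= map_cat /= -ez map_take map_drop e take_size_cat //.
  by rewrite drop_cat ltnNge leqnSn /= subSnn /= drop0.
- case: hw IH h => ? [? [h1 _]] IH [b -> h]; have [x -> hx] := IH _ _ _ _ _ hr h1 h.
  by exists (Proj j x) => //; constructor.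
- case: hw IH h => _ h1 h2 [IH1 IH2] [[b -> h]|[b -> h]].
    have [x -> hx] := IH1 _ _ _ _ _ hr h1 h.
    by exists (Plus x v) => //; constructor.
  have [x -> hx] := IH2 _ _ _ _ _ hr h2 h.
  by exists (Plus t x) => //; constructor.
- case: hw IH h => _ h1 h2 [IH1 IH2] [[b -> h]|[b -> h]].
    have [x -> hx] := IH1 _ _ _ _ _ hr h1 h.
    by exists (Minus x v) => //; constructor.
  have [x -> hx] := IH2 _ _ _ _ _ hr h2 h.
  by exists (Minus t x) => //; constructor.
- case: hw IH h => ? [_ _ h1 h2] [IH1 IH2] [[b -> h]|[b -> h]].
    have [x -> hx] := IH1 _ _ _ _ _ hr h1 h.
    by exists (Times x v) => //; constructor.
  have [x -> hx] := IH2 _ _ _ _ _ hr h2 h.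
  by exists (Times t x) => //; constructor.
- case: hw IH h => V [U [_ _ h2 h1]] [IH1 IH2] [[U' [b [-> hU' h]]]|[b -> h]].
    have ? := typed_uniq (typed_rename hr h2) hU'; subst U'.
    have [x -> hx] := IH1 _ _ _ _ _ (ren_up hr) h1 h.
    by exists (Der x v) => //; apply: C_Der1 h2 hx.
  have [x -> hx] := IH2 _ _ _ _ _ hr h2 h.
  by exists (Der t x) => //; apply: C_Der2.
- case: hw IH h => U [_ _ h1 h2 h3] [IH1 IH2 IH3] [[b -> h]|[b -> h]|[U' [b [-> hU' _ h]]]].
  + have [x -> hx] := IH1 _ _ _ _ _ hr h1 h.
    by exists (Int x v w) => //; constructor.
  + have [x -> hx] := IH2 _ _ _ _ _ hr h2 h.
    by exists (Int t x w) => //; apply: C_Int2.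
  + have ? := typed_uniq (typed_rename hr h1) hU'; subst U'.
    have [x -> hx] := IH3 _ _ _ _ _ (ren_up hr) h3 h.
    by exists (Int t v x) => //; apply: C_Int3 h1 h2 hx.
- case: hw IH h => ? _ h1 IH [b -> h]; have [x -> hx] := IH _ _ _ _ _ hr h1 h.
  by exists (Inl T1 x) => //; constructor.
- case: hw IH h => ? _ h1 IH [b -> h]; have [x -> hx] := IH _ _ _ _ _ hr h1 h.
  by exists (Inr T1 x) => //; constructor.
- case: hw IH h => T1 [T2 [h1 h2 h3]] [IH1 IH2 IH3]
    [[b -> h]|[U1 [U2 [b [-> hU' h]]]]|[U1 [U2 [b [-> hU' h]]]]].
  + have [x -> hx] := IH1 _ _ _ _ _ hr h1 h.
    by exists (Case x v w) => //; constructor.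
  + have [? ?] := typed_uniq (typed_rename hr h1) hU'; subst U1 U2.
    have [x -> hx] := IH2 _ _ _ _ _ (ren_up hr) h2 h.
    by exists (Case t x w) => //; apply: C_Case1 h1 hx.
  + have [? ?] := typed_uniq (typed_rename hr h1) hU'; subst U1 U2.
    have [x -> hx] := IH3 _ _ _ _ _ (ren_up hr) h3 h.
    by exists (Case t v x) => //; apply: C_Case2 h1 hx.
- have [b -> h'] := h; have [x -> hx] := IH _ _ _ _ _ hr hw h'.
  by exists (Fix x) => //; constructor.
Qed.

Lemma steps_unrename r G D t u : ren r G D -> wt G t ->
  steps D (rename r t) u -> exists2 v, u = rename r v & steps G t v.
Proof.
move=> hr hw; elim=> [|w x _ [v -> hv] /(step_unrename hr (steps_wt hv hw)) [y -> hy]].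
  by exists t => //; exact: steps_refl.
by exists y => //; exact: steps_step hv hy.
Qed.

Lemma irreducible_rename r G D t : ren r G D -> wt G t ->
  irreducible G t -> irreducible D (rename r t).
Proof. by move=> hr hw h u /(step_unrename hr hw) [v _ /h]. Qed.

Lemma irreducible_unrename r G D t : ren r G D ->
  irreducible D (rename r t) -> irreducible G t.
Proof.
move=> hr h u hs; apply: (h (rename r u)).
by rewrite !renameE; apply: step_subst hs; exact: tsub_ren.
Qed.
End Strengthening.

(** * Reducibility *)

Section Normalization.
Context {S : signature}.
Implicit Types (t u v : term S) (s : nat -> term S) (r : nat -> nat).
Implicit Types (T U : type (base S)) (G D : seq (type (base S))).

Fixpoint fixfree t : bool :=
  match t with
  | Var _ | Cst _ _ => true
  | Lam _ a | Proj _ a | Inl _ a | Inr _ a => fixfree a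
  | App a b | Plus a b | Minus a b | Times a b | Der a b => fixfree a && fixfree b
  | Tup ts => all fixfree ts
  | Int a b c | Case a b c => [&& fixfree a, fixfree b & fixfree c]
  | Fix _ => false
  end.

Definition is_value t : bool :=
  match t with Lam _ _ | Tup _ | Inl _ _ | Inr _ _ => true | _ => false end.

Definition neutral G t := irreducible G t /\ ~~ is_value t.

(* Contexts are arbitrary, not just interpretable: a normal form is reduced under
   abstractions over any type. *)
Fixpoint red T G t {struct T} : Prop :=
  typed G t T /\ exists2 w, steps G t w & neutral G w \/
  match T with
  | TBase _ => False
  | TTup T1 Ts => exists t1 ts, [/\ w = Tup (t1 :: ts), red T1 G t1 &
      (fix reds Ts ts {struct Ts} := match Ts, ts with
       | [::], [::] => True
       | T :: Ts, t :: ts => red T G t /\ reds Ts ts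
       | _, _ => False
       end) Ts ts]
  | TArr T1 T2 => exists2 b, w = Lam T1 b & forall D r u, ren r G D -> red T1 D u ->
      red T2 D (subst (scons u (fun i => Var (r i))) b)
  | TSum T1 T2 => (exists2 a, w = Inl T2 a & red T1 G a) \/
                  (exists2 a, w = Inr T1 a & red T2 G a)
  end.

(** Quantifying over renamings makes the arrow case Kripke-style: a reducible abstraction stays
    reducible in larger contexts, where fresh variables serve as arguments. *)
Definition red_body G T1 T b := forall D r u, ren r G D -> red T1 D u ->
  red T D (subst (scons u (fun i => Var (r i))) b).

(** One unfolding of [red], with the inner recursion over components replaced by [List.Forall2]. *)
Definition red_value T G w : Prop :=
  match T with
  | TBase _ => False
  | TTup T1 Ts => exists2 ts, w = Tup ts & List.Forall2 (fun t T => red T G t) ts (T1 :: Ts)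
  | TArr T1 T2 => exists2 b, w = Lam T1 b & red_body G T1 T2 b
  | TSum T1 T2 => (exists2 a, w = Inl T2 a & red T1 G a) \/
                  (exists2 a, w = Inr T1 a & red T2 G a)
  end.

Lemma redP T G t : red T G t <->
  typed G t T /\ exists2 w, steps G t w & neutral G w \/ red_value T G w.
Proof.
case: T => [b|T1 Ts|T1 T2|T1 T2] //=.
have H ts : (fix reds Ts ts {struct Ts} := match Ts, ts with
       | [::], [::] => True
       | T :: Ts, t :: ts => red T G t /\ reds Ts ts
       | _, _ => False
       end) Ts ts <-> List.Forall2 (fun t T => red T G t) ts Ts.
  elim: Ts ts => [|T Ts IH] [|x ts] /=; split=> //; try (by move=> h; inversion h).
    by case=> hx /IH; constructor.
  by move=> /List.Forall2_cons_iff [hx /IH].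
split=> -[ht [w hw h]]; split=> //; exists w => //; case: h => [|h]; auto; right.
  by case: h => t1 [ts [-> h1 /H h2]]; exists (t1 :: ts) => //; constructor.
case: h => -[|t1 ts] -> h; first by inversion h.
by case/List.Forall2_cons_iff: h => h1 /H h2; exists t1, ts.
Qed.

Lemma red_typed T G t : red T G t -> typed G t T.
Proof. by case/redP. Qed.

Lemma red_neutral T G t : typed G t T -> neutral G t -> red T G t.
Proof. by move=> h hn; apply/redP; split=> //; exists t; [exact: steps_refl | left]. Qed.

Lemma red_val T G t : typed G t T -> red_value T G t -> red T G t.
Proof. by move=> h hn; apply/redP; split=> //; exists t; [exact: steps_refl | right]. Qed.

(** [red] asks only for one good reduct, so closure under expansion is transitivity. This is the
    gain from aiming at weak normalization. *)
Lemma red_exp T G t u : typed G t T -> steps G t u -> red T G u -> red T G t.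
Proof.
move=> h hs /redP [_ [w hw h']]; apply/redP; split=> //; exists w => //.
exact: steps_trans hs hw.
Qed.

Lemma is_value_rename r t : is_value (rename r t) = is_value t.
Proof. by case: t. Qed.

Lemma neutral_rename r G D t : ren r G D -> wt G t -> neutral G t ->
  neutral D (rename r t).
Proof.
by move=> hr hw [h1 h2]; split; [exact: irreducible_rename hr hw h1 | rewrite is_value_rename].
Qed.

Lemma red_rename T r G D t : ren r G D -> red T G t -> red T D (rename r t).
Proof.
elim/type_nested_ind: T r G D t => [b|T1 Ts IHs|T1 T2 IH1 IH2|T1 T2 IH1 IH2] r G D t hr
  /redP [ht [w hw h]]; have hw' := ex_intro (typed G w) _ (steps_typed hw ht);
  apply/redP; (split; first exact: typed_rename hr ht);
  exists (rename r w); try exact: steps_rename hr hw;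
  (case: h => [h|h]; [by left; apply: (neutral_rename hr hw' h) | right => /=]).
- by [].
- case: h => ts -> h; exists (map (rename r) ts) => //; apply: Forall2_mapl.
  move: IHs.
  elim: h => [|x T xs Us hx _ IH] /=; first by constructor.
  by case/List.Forall_cons_iff => h1 h2; constructor; [exact: h1 hr hx | exact: IH].
- case: h => b -> h; exists (rename (upren r) b) => // D' r' u hr' hu.
  rewrite subst_rename; have := h D' (fun i => r' (r i)) u (ren_comp hr hr') hu.
  by congr (red _ _ _); apply: subst_ext => -[|i].
- by case: h => -[a -> h]; [left | right]; exists (rename r a) => //;
    [exact: IH1 hr h | exact: IH2 hr h].
Qed.

Lemma irreducible_Var G i : irreducible G (Var i).
Proof. by apply/irreducibleP; split=> // u h; inversion h. Qed.

Lemma red_Var G i T : onth G i = Some T -> red T G (Var i).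
Proof.
move=> h; apply: red_neutral; first by apply/typedP.
by split=> //; exact: irreducible_Var.
Qed.

(** The argument is the bound variable itself, reducible because it is neutral, in the context
    extended by it. *)
Lemma red_body_self G T1 T b : red_body G T1 T b -> red T (T1 :: G) b.
Proof.
move=> /(_ (T1 :: G) succn (Var 0) (@ren_succ _ T1 G)) h.
have /h : red T1 (T1 :: G) (Var 0) by exact: red_Var.
by rewrite -[in X in _ -> X](subst_id b); congr (red _ _ _); apply: subst_ext => -[|i].
Qed.

(** Weaker in form than [weak_normalizable]: the reduct must be irreducible but need not belong to
    the grammar [nf], which excludes, for instance, projections of a variable of tuple type. *)
Definition normalizing G t := exists2 n, steps G t n & irreducible G n.

Lemma irreducible_Lam G T t : irreducible (T :: G) t -> irreducible G (Lam T t).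
Proof. by move=> h; apply/irreducibleP; split=> // u h'; inversion h'. Qed.

Lemma irreducible_Tup G ts : List.Forall (irreducible G) ts -> irreducible G (Tup ts).
Proof. by move=> h; apply/irreducibleP; split=> // u h'; inversion h'. Qed.

Lemma irreducible_Inl G T t : irreducible G t -> irreducible G (Inl T t).
Proof. by move=> h; apply/irreducibleP; split=> // u h'; inversion h'. Qed.

Lemma irreducible_Inr G T t : irreducible G t -> irreducible G (Inr T t).
Proof. by move=> h; apply/irreducibleP; split=> // u h'; inversion h'. Qed.

Lemma normalizing_exp G t u : steps G t u -> normalizing G u -> normalizing G t.
Proof. by move=> h [n hn hi]; exists n => //; exact: steps_trans h hn. Qed.

Lemma steps_Lam G T t u : steps (T :: G) t u -> steps G (Lam T t) (Lam T u).
Proof. by move=> h; apply: cong_steps; constructor. Qed.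

Lemma steps_Inl G T t u : steps G t u -> steps G (Inl T t) (Inl T u).
Proof. by move=> h; apply: cong_steps; constructor. Qed.

Lemma steps_Inr G T t u : steps G t u -> steps G (Inr T t) (Inr T u).
Proof. by move=> h; apply: cong_steps; constructor. Qed.

Lemma normalizing_Tup G ts : List.Forall (normalizing G) ts -> normalizing G (Tup ts).
Proof.
move=> h; suff [ns h1 h2] : exists2 ns, List.Forall2 (steps G) ts ns & List.Forall (irreducible G) ns.
  by exists (Tup ns); [exact: steps_Tup | exact: irreducible_Tup].
elim: h => [|x xs [n hn hi] _ [ns h1 h2]]; first by exists [::].
by exists (n :: ns); constructor.
Qed.

Lemma normalizing_Lam G T t : normalizing (T :: G) t -> normalizing G (Lam T t).
Proof. by case=> n h1 h2; exists (Lam T n); [exact: steps_Lam | exact: irreducible_Lam]. Qed.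

Lemma red_normalizing T G t : red T G t -> normalizing G t.
Proof.
elim/type_nested_ind: T G t => [b|T1 Ts IHs|T1 T2 IH1 IH2|T1 T2 IH1 IH2] G t
  /redP [ht [w hw [[h _]|h]]]; try (by exists w); apply: normalizing_exp hw _.
- case: h => ts -> h; apply: normalizing_Tup.
  move: IHs.
  elim: h => [|x T xs Us hx _ IH] /=; first by constructor.
  by case/List.Forall_cons_iff => h1 h2; constructor; [exact: h1 hx | exact: IH].
- by case: h => b -> /red_body_self /IH2; exact: normalizing_Lam.
- case: h => -[a -> /= h].
    by case: (IH1 _ _ h) => n h1 h2; exists (Inl T2 n); [exact: steps_Inl | exact: irreducible_Inl].
  by case: (IH2 _ _ h) => n h1 h2; exists (Inr T1 n); [exact: steps_Inr | exact: irreducible_Inr].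
Qed.

Lemma red_neutral_exp T G t n : typed G t T -> steps G t n -> neutral G n -> red T G t.
Proof. by move=> ht hs hn; apply/redP; split=> //; exists n => //; left. Qed.

(** If the function becomes neutral, normalizing the argument makes the application neutral; if it
    becomes an abstraction, its body is used along the identity renaming. *)
Lemma red_App T1 T2 G t u : red (TArr T1 T2) G t -> red T1 G u -> red T2 G (App t u).
Proof.
move=> ht hu; have h : typed G (App t u) T2.
  by apply/typedP; exists T1; exact: red_typed.
case/redP: ht => _ [w hw [[hi hv]|[b eb hb]]].
  have [n hn hin] := red_normalizing hu.
  apply: (red_neutral_exp (n := App w n)) => //; first by apply: cong_steps; constructor.
  by split=> //; apply/irreducibleP; split=> // x hx; move: hv; inversion hx; subst.
subst w; have := hb G id u (@ren_id _ G) hu; apply: red_exp => //.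
apply: (@steps_trans _ _ _ (App (Lam T1 b) u)).
  by apply: cong_steps; constructor=> //; exact: steps_refl.
by apply: steps_contr; constructor.
Qed.

Lemma red_Proj T1 Ts T j G t : red (TTup T1 Ts) G t -> onth (T1 :: Ts) j = Some T ->
  red T G (Proj j t).
Proof.
move=> ht hj; have h : typed G (Proj j t) T.
  by apply/typedP; exists T1, Ts; split=> //; exact: red_typed.
case/redP: ht => _ [w hw [[hi hv]|[ts e hb]]].
  apply: (red_neutral_exp (n := Proj j w)) => //; first by apply: cong_steps; constructor.
  by split=> //; apply/irreducibleP; split=> // x hx; move: hv; inversion hx; subst.
subst w; have [x hx hr] := Forall2_getr hb hj; apply: red_exp hr => //.
apply: (@steps_trans _ _ _ (Proj j (Tup ts))); first by apply: cong_steps; constructor.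
by apply: steps_contr; constructor.
Qed.

(** On a stuck scrutinee the term is irreducible only after both branches have been normalized under
    their binders, hence the use of [red_body_self]. *)
Lemma red_Case T1 T2 T G t u v : red (TSum T1 T2) G t ->
  typed (T1 :: G) u T -> red_body G T1 T u -> typed (T2 :: G) v T -> red_body G T2 T v ->
  red T G (Case t u v).
Proof.
move=> ht tu hu tv hv; have h : typed G (Case t u v) T.
  by apply/typedP; exists T1, T2; split=> //; exact: red_typed.
have hT := red_typed ht.
case/redP: ht => _ [w hw [[hi hnv]|hw']].
  have [n1 hn1 hi1] := red_normalizing (red_body_self hu).
  have [n2 hn2 hi2] := red_normalizing (red_body_self hv).
  apply: (red_neutral_exp (n := Case w n1 n2)) => //.
    by apply: cong_steps; apply: K_Case hT _ _ _.
  split=> //; apply/irreducibleP; split=> /=.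
    split=> // U1 U2 hU; have [? ?] := typed_uniq (steps_typed hw hT) hU.
    by subst U1 U2.
  by move=> x hx; move: hnv; inversion hx; subst.
have hs : steps G (Case t u v) (Case w u v).
  by apply: cong_steps; apply: K_Case hT hw _ _; exact: steps_refl.
case: hw' => -[a ea ha]; subst w.
  have := hu G id a (@ren_id _ G) ha; apply: red_exp => //.
  by apply: steps_trans hs _; apply: steps_contr; constructor.
have := hv G id a (@ren_id _ G) ha; apply: red_exp => //.
by apply: steps_trans hs _; apply: steps_contr; constructor.
Qed.

Lemma red_Lam T1 T2 G b : typed (T1 :: G) b T2 -> red_body G T1 T2 b ->
  red (TArr T1 T2) G (Lam T1 b).
Proof. by move=> h hb; apply: red_val; [apply/typedP; exists T2 | exists b]. Qed.

Lemma red_Tup T1 Ts G ts : List.Forall2 (fun t T => red T G t) ts (T1 :: Ts) ->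
  red (TTup T1 Ts) G (Tup ts).
Proof.
move=> h; apply: red_val; last by exists ts.
apply/typedP; exists T1, Ts; split=> //; apply: Forall2_impl h => x y; exact: red_typed.
Qed.
End Normalization.

(** * Closure of reducibility and the fundamental lemma *)

Section Fundamental.
Context {S : signature}.
Implicit Types (t u v : term S) (s : nat -> term S) (r : nat -> nat).
Implicit Types (T U : type (base S)) (G D : seq (type (base S))).

(** Addition and subtraction obey the same typing and reduction rules, so both are treated at
    once. *)
Definition plusminus (b : bool) t u := if b then Plus t u else Minus t u.

Lemma typed_pm b G t u T : addable T -> typed G t T -> typed G u T ->
  typed G (plusminus b t u) T.
Proof. by move=> *; case: b; apply/typedP. Qed.

Lemma cong_pm b R G t t' u u' : R G t t' -> R G u u' ->
  cong R G (plusminus b t u) (plusminus b t' u').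
Proof. by case: b; constructor. Qed.

Lemma cong_pm_inv b R G t u c : cong R G (plusminus b t u) c ->
  exists t' u', [/\ c = plusminus b t' u', R G t t' & R G u u'].
Proof. by case: b => /congP. Qed.

Lemma steps_pm b G t t' u u' : steps G t t' -> steps G u u' ->
  steps G (plusminus b t u) (plusminus b t' u').
Proof. by move=> *; apply: cong_steps; apply: cong_pm. Qed.

Lemma contr_pm_Tup b G ts us : size ts = size us ->
  contr G (plusminus b (Tup ts) (Tup us)) (Tup [seq plusminus b p.1 p.2 | p <- zip ts us]).
Proof. by case: b => h; constructor. Qed.

Lemma contr_pm_Lam b G T t u :
  contr G (plusminus b (Lam T t) (Lam T u)) (Lam T (plusminus b t u)).
Proof. by case: b; constructor. Qed.

Variant contr_pm_spec b : term S -> term S -> term S -> Prop :=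
| Contr_pm_Tup ts us of size ts = size us :
    contr_pm_spec b (Tup ts) (Tup us) (Tup [seq plusminus b p.1 p.2 | p <- zip ts us])
| Contr_pm_Lam T t u : contr_pm_spec b (Lam T t) (Lam T u) (Lam T (plusminus b t u)).

Lemma contr_pm_inv b G t u v : contr G (plusminus b t u) v -> contr_pm_spec b t u v.
Proof. by case: b => h; inversion h; constructor. Qed.

Lemma subst_pm b s t u :
  subst s (plusminus b t u) = plusminus b (subst s t) (subst s u).
Proof. by case: b. Qed.

Lemma irreducible_pm b G t u : irreducible G t -> irreducible G u ->
  ~~ is_value t || ~~ is_value u -> irreducible G (plusminus b t u).
Proof.
move=> h1 h2 h; apply/irreducibleP; split; first by case: b.
by move=> v /contr_pm_inv hc; case: hc h.
Qed.

Lemma value_pm b t u : is_value (plusminus b t u) = false.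
Proof. by case: b. Qed.

Lemma red_pm_stuck b T G t u n1 n2 : typed G (plusminus b t u) T ->
  steps G t n1 -> steps G u n2 -> irreducible G n1 -> irreducible G n2 ->
  ~~ is_value n1 || ~~ is_value n2 -> red T G (plusminus b t u).
Proof.
move=> h h1 h2 i1 i2 hv; apply: red_neutral_exp h (steps_pm b h1 h2) _.
by split; [exact: irreducible_pm | rewrite value_pm].
Qed.

(** If one argument is neutral, normalizing the other gives a stuck term. If both are values, the
    rule moves the operation to components or bodies, whose types are smaller; base types have no
    values and sum types are not addable. *)
Lemma red_pm b T G t u : addable T -> red T G t -> red T G u ->
  red T G (plusminus b t u).
Proof.
elim/type_nested_ind: T G t u => [c|T1 Ts IHs|T1 T2 IH1 IH2|T1 T2 IH1 IH2] G t u ha ht hu //;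
have h := typed_pm b ha (red_typed ht) (red_typed hu).
all: have /redP [tt [w hw hwv]] := ht; have /redP [tu [x hx hxv]] := hu.
all: have hs := steps_pm b hw hx.
all: have [n hn hni] := red_normalizing ht; have [n' hn' hni'] := red_normalizing hu.
all: case: hwv => [[hi hv]|hwv]; [by apply: red_pm_stuck h hw hn' hi hni' _; rewrite hv |].
all: case: hxv => [[hi hv]|hxv]; [by apply: red_pm_stuck h hn hx hni hi _; rewrite hv orbT |].
all: apply: (red_exp h hs).
- by case: hwv.
- case: hwv => ts ew hts; case: hxv => us ex hus; subst w x.
  have hsz : size ts = size us by rewrite (Forall2_size hts) (Forall2_size hus).
  have hc := contr_pm_Tup b G hsz.
  apply: red_exp (steps_typed hs h) (steps_contr hc) _.
  apply: red_Tup; apply/Forall2_onth; split.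
    by rewrite size_map size_zip -hsz minnn (Forall2_size hts).
  move=> i y U; rewrite onth_mapE onth_zip.
  case ei: (onth ts i) => [a|//]; case ej: (onth us i) => [a'|//] /= [<-] hU.
  have hUa : addable U by apply: (@all_onth _ _ (T1 :: Ts) i).
  have IH := IHs.
  move/Forall_onth: IH => /(_ _ _ hU); apply=> //.
    exact: Forall2_get hts ei hU.
  exact: Forall2_get hus ej hU.
- case: hwv => p ew hp; case: hxv => q ex hq; subst w x.
  have hc := contr_pm_Lam b G T1 p q.
  have hL := steps_typed (steps_contr hc) (steps_typed hs h).
  apply: red_exp (steps_typed hs h) (steps_contr hc) _.
  apply: red_Lam; first by move/typedP: hL => [? [<-]].
  move=> D r y hr hy; rewrite subst_pm; apply: IH2 => //; [exact: hp | exact: hq].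
Qed.

Lemma red_bigPlus T G t ts : addable T -> red T G t -> List.Forall (red T G) ts ->
  red T G (bigPlus t ts).
Proof.
move=> ha; rewrite /bigPlus; elim: ts t => //= u ts IH t ht /List.Forall_cons_iff [hu hts].
by apply: IH => //; apply: (@red_pm true).
Qed.

Lemma red_base c G t : red (TBase c) G t ->
  exists n, [/\ steps G t n, irreducible G n & typed G n (TBase c)].
Proof.
by case/redP => ht [n hn [[hi _]|[]]]; exists n; split=> //; exact: steps_typed ht.
Qed.

(** The identity behind the rules that push a binder through an abstraction: instantiating the
    abstracted variable after the exchange amounts to instantiating it, with a shifted argument,
    under the other binder. *)
Lemma shift_up_swap u r t :
  subst (upsubst (scons u (fun i => Var (r i)))) (swap t) =
  subst (scons (shift u) (fun i => Var (upren r i))) t.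
Proof. by rewrite subst_rename; apply: subst_ext => -[|[|i]]. Qed.

Lemma subst_scons_shift u r t :
  subst (scons u (fun i => Var (r i))) (shift t) = rename r t.
Proof. by rewrite subst_shift renameE. Qed.

Lemma irreducible_Times G t u U : irreducible G t -> irreducible G u -> typed G u U ->
  ~~ is_value t || (~~ is_value u && ~~ if U is TBase _ then true else false) ->
  irreducible G (Times t u).
Proof.
move=> h1 h2 hu h; apply/irreducibleP; split=> // v hc; move: h.
by inversion hc; subst => //=; have [b ->] := isBase_typed H2 hu; rewrite andbF.
Qed.

(** Products, derivatives and integrals each take two inductions: at a base point on the type of the
    result, then on the type of the point, a tuple splitting it into components. The base point is
    normalized beforehand so that a stuck term is irreducible. *)
Lemma red_Times_base c T G t n : addable T -> typed G n (TBase c) -> irreducible G n ->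
  red T G t -> red T G (Times t n).
Proof.
elim/type_nested_ind: T G t n => [c'|T1 Ts IHs|T1 T2 IH1 IH2|T1 T2 IH1 IH2] G t n ha hn hin ht //;
have h T : addable T -> typed G t T -> typed G (Times t n) T by
  move=> *; apply/typedP; exists (TBase c).
all: have {}h := h _ ha (red_typed ht).
all: have /redP [tt [w hw hwv]] := ht; have hb : isBase G n by exists c.
all: have hs : steps G (Times t n) (Times w n) by apply: cong_steps; constructor=> //; exact: steps_refl.
all: case: hwv => [[hi hv]|hwv]; [by apply: red_neutral_exp h hs _; split=> //;
  apply: irreducible_Times hn _; rewrite ?hv |].
all: apply: (red_exp h hs).
- by case: hwv.
- case: hwv => ts ew hts; subst w.
  apply: red_exp (steps_typed hs h) (steps_contr (R_MulTup _ hb)) _.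
  apply: red_Tup; apply: Forall2_mapl; apply/Forall2_onth; split; first exact: Forall2_size hts.
  have IH := IHs.
  move=> i x U hx hU; move/Forall_onth: IH => /(_ _ _ hU); apply=> //.
    by apply: (@all_onth _ _ (T1 :: Ts) i).
  exact: Forall2_get hts hx hU.
- case: hwv => p ew hp; subst w.
  have hc := R_MulLam T1 p hb.
  have hL := steps_typed (steps_contr hc) (steps_typed hs h).
  apply: red_exp (steps_typed hs h) (steps_contr hc) _.
  apply: red_Lam; first by move/typedP: hL => [? [<-]].
  move=> D r y hr hy /=; rewrite subst_scons_shift; apply: IH2 => //.
  + exact: (typed_rename hr hn).
  + exact: (irreducible_rename hr (ex_intro _ _ hn)).
  + exact: hp.
Qed.

Lemma red_Times T U G t u : addable T -> diffable U -> red (dty T U) G t -> red U G u ->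
  red T G (Times t u).
Proof.
move=> ha; elim/type_nested_ind: U t u => [c|U1 Us IHs|U1 U2 _ _|U1 U2 _ _] t u hd ht hu //.
  have [n [hn hi hnt]] := red_base hu.
  apply: red_exp (red_Times_base ha hnt hi ht).
    by apply/typedP; exists (TBase c); split=> //; [exact: (red_typed ht) | exact: red_typed hu].
  by apply: cong_steps; constructor=> //; exact: steps_refl.
have h : typed G (Times t u) T.
  by apply/typedP; exists (TTup U1 Us); split=> //; [exact: (red_typed ht) | exact: red_typed hu].
have /redP [tt [w hw hwv]] := ht; have /redP [tu [x hx hxv]] := hu.
have hs : steps G (Times t u) (Times w x) by apply: cong_steps; constructor.
case: hxv => [[hi hv]|[us ex hus]].
  have [n hn hni] := red_normalizing ht.
  apply: (red_neutral_exp (n := Times n x)) => //; first by apply: cong_steps; constructor.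
  by split=> //; apply: irreducible_Times (steps_typed hx tu) _; rewrite ?hv ?orbT.
case: hwv => [[hi hv]|[ts ew hts]].
  have [n hn hni] := red_normalizing hu.
  apply: (red_neutral_exp (n := Times w n)) => //; first by apply: cong_steps; constructor.
  by split=> //; apply: irreducible_Times (steps_typed hn tu) _; rewrite ?hv ?orbT.
subst w x.
have hsz : size ts = size us.
  by rewrite (Forall2_size hts) (Forall2_size hus) /= size_map.
have : List.Forall (red T G) [seq Times p.1 p.2 | p <- zip ts us].
  apply/Forall_onth => i y; rewrite onth_mapE onth_zip.
  case ei: (onth ts i) => [a|//]; case ej: (onth us i) => [a'|//] /= [<-].
  have [U hU hr] := Forall2_getl hus ej.
  have IH := IHs.
  move/Forall_onth: IH => /(_ _ _ hU); apply=> //.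
    by apply: (@all_onth _ _ (U1 :: Us) i).
  apply: (Forall2_get hts ei).
  exact: (@onth_map_some _ _ (dty T) (U1 :: Us)).
case e: [seq Times p.1 p.2 | p <- zip ts us] => [|y ys].
  by move/(congr1 size): e; rewrite size_map size_zip hsz minnn (Forall2_size hus).
case/List.Forall_cons_iff => hy hys.
apply: red_exp (red_bigPlus ha hy hys) => //.
by apply: steps_trans hs _; apply: steps_contr; apply: R_MulTupTup.
Qed.

Lemma neutral_Der_base c G w n : typed G n (TBase c) -> irreducible G n ->
  neutral (TBase c :: G) w -> neutral G (Der w n).
Proof.
move=> hn hin [hi hv]; split=> //; apply/irreducibleP; split=> [/=|y hy].
  by split=> // T hT; rewrite (typed_uniq hT hn).
have hb : isBase G n by exists c.
by move: hv; inversion hy; subst => //; case: (isBase_Tup hb).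
Qed.

Lemma neutral_Int_base c G w n n' : typed G n (TBase c) -> irreducible G n ->
  typed G n' (TBase c) -> irreducible G n' ->
  neutral (TBase c :: G) w -> neutral G (Int n n' w).
Proof.
move=> hn hin hn' hin' [hi hv]; split=> //; apply/irreducibleP; split=> [/=|y hy].
  by split=> // T hT; rewrite (typed_uniq hT hn).
have hb : isBase G n by exists c.
by move: hv; inversion hy; subst => //; case: (isBase_Tup hb).
Qed.

Lemma red_Der_base c T G t n : typed G n (TBase c) -> irreducible G n ->
  red T (TBase c :: G) t -> red T G (Der t n).
Proof.
elim/type_nested_ind: T G t n => [c'|T1 Ts IHs|T1 T2 IH1 IH2|T1 T2 IH1 IH2] G t n hn hin ht //;
have h T : typed (TBase c :: G) t T -> typed G (Der t n) T by
  move=> tt; apply/typedP; exists T, (TBase c).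
all: have {}h := h _ (red_typed ht).
all: have /redP [tt [w hw hwv]] := ht; have hb : isBase G n by exists c.
all: have hs : steps G (Der t n) (Der w n) by
  apply: cong_steps; apply: (K_Der hn) => //; exact: steps_refl.
all: case: hwv => [hi|hwv]; [by apply: (red_neutral_exp h hs); apply: (neutral_Der_base hn) |].
all: apply: (red_exp h hs).
- by case: hwv.
- case: hwv => ts ew hts; subst w.
  apply: red_exp (steps_typed hs h) (steps_contr (R_DerTup _ hb)) _.
  apply: red_Tup; apply: Forall2_mapl; apply/Forall2_onth; split; first exact: Forall2_size hts.
  have IH := IHs.
  move=> i x U hx hU; move/Forall_onth: IH => /(_ _ _ hU); apply=> //.
  exact: Forall2_get hts hx hU.
- case: hwv => p ew hp; subst w.
  have hc := R_DerLam T1 p hb.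
  have hL := steps_typed (steps_contr hc) (steps_typed hs h).
  apply: red_exp (steps_typed hs h) (steps_contr hc) _.
  apply: red_Lam; first by move/typedP: hL => [? [<-]].
  move=> D r y hr hy /=; rewrite subst_scons_shift shift_up_swap; apply: IH2 => //.
  + exact: (typed_rename hr hn).
  + exact: (irreducible_rename hr (ex_intro _ _ hn)).
  + by apply: hp; [exact: ren_up | exact: (red_rename (@ren_succ _ _ _) hy)].
- case: hwv => -[a ew ha]; subst w.
    have hc := R_DerInl T2 a hb.
    apply: red_exp (steps_typed hs h) (steps_contr hc) _.
    apply: red_val; first exact: steps_typed (steps_contr hc) (steps_typed hs h).
    by left; eexists; first by []; exact: IH1.
  have hc := R_DerInr T1 a hb.
  apply: red_exp (steps_typed hs h) (steps_contr hc) _.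
  apply: red_val; first exact: steps_typed (steps_contr hc) (steps_typed hs h).
  by right; eexists; first by []; exact: IH2.
Qed.

Lemma red_Int_base c T G t n n' : addable T -> typed G n (TBase c) -> irreducible G n ->
  typed G n' (TBase c) -> irreducible G n' ->
  red T (TBase c :: G) t -> red T G (Int n n' t).
Proof.
elim/type_nested_ind: T G t n n' => [c'|T1 Ts IHs|T1 T2 IH1 IH2|T1 T2 IH1 IH2]
  G t n n' hA hn hin hn' hin' ht //;
have h T : addable T -> typed (TBase c :: G) t T -> typed G (Int n n' t) T by
  move=> hA' tt; apply/typedP; exists (TBase c).
all: have {}h := h _ hA (red_typed ht).
all: have /redP [tt [w hw hwv]] := ht; have hb : isBase G n by exists c.
all: have hb' : isBase G n' by exists c.
all: have hs : steps G (Int n n' t) (Int n n' w) by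
  apply: cong_steps; apply: (K_Int hn) => //; exact: steps_refl.
all: case: hwv => [hi|hwv]; [by apply: (red_neutral_exp h hs); apply: (neutral_Int_base hn) |].
all: apply: (red_exp h hs).
- by case: hwv.
- case: hwv => ts ew hts; subst w.
  apply: red_exp (steps_typed hs h) (steps_contr (R_IntTup _ hb hb')) _.
  apply: red_Tup; apply: Forall2_mapl; apply/Forall2_onth; split; first exact: Forall2_size hts.
  have IH := IHs.
  move=> i x U hx hU; move/Forall_onth: IH => /(_ _ _ hU); apply=> //.
    by apply: (@all_onth _ _ (T1 :: Ts) i).
  exact: Forall2_get hts hx hU.
- case: hwv => p ew hp; subst w.
  have hc := R_IntLam T1 p hb hb'.
  have hL := steps_typed (steps_contr hc) (steps_typed hs h).
  apply: red_exp (steps_typed hs h) (steps_contr hc) _.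
  apply: red_Lam; first by move/typedP: hL => [? [<-]].
  move=> D r y hr hy /=; rewrite !subst_scons_shift shift_up_swap; apply: IH2 => //.
  + exact: (typed_rename hr hn).
  + exact: (irreducible_rename hr (ex_intro _ _ hn)).
  + exact: (typed_rename hr hn').
  + exact: (irreducible_rename hr (ex_intro _ _ hn')).
  + by apply: hp; [exact: ren_up | exact: (red_rename (@ren_succ _ _ _) hy)].
Qed.

Lemma red_subst_mixed i us ts T1 Ts U G D r u : ren r G D ->
  List.Forall2 (fun t T => red T G t) us (T1 :: Ts) ->
  List.Forall2 (fun t T => red T G t) ts (T1 :: Ts) ->
  onth (T1 :: Ts) i = Some U -> red U D u ->
  red (TTup T1 Ts) D (subst (scons u (fun i => Var (r i))) (mixed i us ts)).
Proof.
move=> hr hus hts hi hu; rewrite /mixed /= map_cat /=; apply: red_Tup.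
rewrite -(cat_take_drop i (T1 :: Ts)) (drop_onth hi); apply: List.Forall2_app; last constructor=> //.
  do 2!apply: Forall2_mapl; apply: Forall2_impl (Forall2_take i hus) => x V hx /=.
  by rewrite subst_scons_shift; exact: (red_rename hr hx).
do 2!apply: Forall2_mapl; apply: Forall2_impl (Forall2_drop i.+1 hts) => x V hx /=.
by rewrite subst_scons_shift; exact: (red_rename hr hx).
Qed.

Lemma subst_scons_replace u r t m :
  subst (scons u (fun i => Var (r i))) (replace t m) =
  subst (scons (subst (scons u (fun i => Var (r i))) m) (fun i => Var (r i))) t.
Proof. by rewrite subst_subst; apply: subst_ext => -[|i]. Qed.

Lemma red_Forall2_typed G ts Ts : List.Forall2 (fun t T => red T G t) ts Ts ->
  List.Forall2 (typed G) ts Ts.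
Proof. by apply: Forall2_impl => x y; exact: red_typed. Qed.

Lemma red_Der U V G t t0 : diffable U -> typed (U :: G) t V -> red_body G U V t ->
  red U G t0 -> red (dty V U) G (Der t t0).
Proof.
elim/type_nested_ind: U t t0 => [c|U1 Us IHs|U1 U2 _ _|U1 U2 _ _] t t0 hd ht hb h0 //.
  have [n [hn hi hnt]] := red_base h0.
  apply: red_exp (red_Der_base hnt hi (red_body_self hb)).
    by apply/typedP; exists V, (TBase c); split=> //; exact: red_typed h0.
  by apply: cong_steps; apply: (K_Der (red_typed h0)) => //; exact: steps_refl.
have h : typed G (Der t t0) (dty V (TTup U1 Us)).
  by apply/typedP; exists V, (TTup U1 Us); split=> //; exact: red_typed h0.
have /redP [tt [w hw hwv]] := h0.
case: hwv => [[hi hv]|[ts ew hts]].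
  have [n hn hni] := red_normalizing (red_body_self hb).
  apply: (red_neutral_exp (n := Der n w)) => //; first by apply: cong_steps; apply: (K_Der tt).
  have tw := steps_typed hw tt.
  split=> //; apply/irreducibleP; split=> [/=|y hy].
    by split=> // T hT; rewrite (typed_uniq hT tw).
  by move: hv; inversion hy; subst => //; have [? ?] := isBase_typed H2 tw.
subst w; have tts := red_Forall2_typed hts.
have hs : steps G (Der t t0) (Der t (Tup ts)).
  by apply: cong_steps; apply: (K_Der tt) => //; exact: steps_refl.
apply: (red_exp h hs); have {}h := steps_typed hs h.
apply: red_exp h (steps_contr (R_DerAtTup _ _ _)) _.
apply: red_Tup; rewrite -[dty V U1 :: _]/(map (dty V) (U1 :: Us)); apply/Forall2_onth.
split; first by rewrite !size_map size_iota (Forall2_size hts).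
move=> i y T; rewrite onth_mkseq onth_mapE; case: ifP => // hi [<-].
have [x hx] := lt_onth hi; have [U hU hxU] := Forall2_getl hts hx.
rewrite hU (onth_nth (Var 0) _ _ _ hx) => -[<-].
have IH := IHs.
move/Forall_onth: IH => /(_ _ _ hU); apply=> //.
- by apply: (@all_onth _ _ (U1 :: Us) i).
- by apply: typed_replace ht _; apply: typed_mixed hU.
(* Instantiating the i-th partial body at [z] is instantiating [t] at the tuple with [z] in position
   i, which is again reducible. *)
- move=> D r z hr hz; rewrite subst_scons_replace; apply: hb => //.
  exact: (red_subst_mixed hr hts hts hU hz).
Qed.

Lemma red_Int T U G t1 t2 t : addable T -> diffable U -> red U G t1 -> red U G t2 ->
  typed (U :: G) t (dty T U) -> red_body G U (dty T U) t -> red T G (Int t1 t2 t).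
Proof.
move=> hA.
elim/type_nested_ind: U t1 t2 t => [c|U1 Us IHs|U1 U2 _ _|U1 U2 _ _] t1 t2 t hd h1 h2 ht hb //.
  have [n [hn hi hnt]] := red_base h1; have [n' [hn' hi' hnt']] := red_base h2.
  apply: red_exp (red_Int_base hA hnt hi hnt' hi' (red_body_self hb)).
    by apply/typedP; exists (TBase c); split=> //; exact: red_typed.
  by apply: cong_steps; apply: (K_Int (red_typed h1) (red_typed h2)) => //; exact: steps_refl.
have tt1 := red_typed h1; have tt2 := red_typed h2.
have h : typed G (Int t1 t2 t) T by apply/typedP; exists (TTup U1 Us).
have /redP [_ [w hw hwv]] := h1; have /redP [_ [x hx hxv]] := h2.
have tw := steps_typed hw tt1; have tx := steps_typed hx tt2.
(* One limit that does not become a tuple blocks the integral; the other limit and the body are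
   still normalized so as to reach an irreducible term. *)
have stuck n1 n2 n : steps G t1 n1 -> steps G t2 n2 -> steps (TTup U1 Us :: G) t n ->
    irreducible G n1 -> irreducible G n2 -> irreducible (TTup U1 Us :: G) n ->
    ~~ is_value n1 || ~~ is_value n2 -> red T G (Int t1 t2 t).
  move=> s1 s2 s3 i1 i2 i3 hv.
  have tn := steps_typed s1 tt1.
  apply: (red_neutral_exp (n := Int n1 n2 n)) => //; first by apply: cong_steps; apply: (K_Int tt1).
  split=> //; apply/irreducibleP; split=> [/=|y hy].
    by split=> // V hV; rewrite (typed_uniq hV tn).
  by move: hv; inversion hy; subst => //; have [? ?] := isBase_typed H3 tn.
have [n hn hni] := red_normalizing (red_body_self hb).
case: hwv => [[hi hv]|[ts1 ew hts1]].
  have [n2 hn2 hni2] := red_normalizing h2.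
  by apply: (stuck w n2 n) => //; rewrite hv.
case: hxv => [[hi hv]|[ts2 ex hts2]].
  have [n1 hn1 hni1] := red_normalizing h1.
  by apply: (stuck n1 x n) => //; rewrite hv orbT.
subst w x; have tts1 := red_Forall2_typed hts1; have tts2 := red_Forall2_typed hts2.
have hsz : size ts1 = size ts2 by rewrite (Forall2_size hts1) (Forall2_size hts2).
have hs : steps G (Int t1 t2 t) (Int (Tup ts1) (Tup ts2) t).
  by apply: cong_steps; apply: (K_Int tt1 tt2) => //; exact: steps_refl.
set L := [seq Int (nth (Var 0) ts1 i) (nth (Var 0) ts2 i)
           (Proj i (replace t (mixed i ts2 ts1))) | i <- iota 0 (size ts1)].
have hL : List.Forall (red T G) L.
  apply/Forall_onth => i y; rewrite onth_mkseq; case: ifP => // hi [<-].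
  have [a ea] := lt_onth hi; have [U hU haU] := Forall2_getl hts1 ea.
  have [b eb hbU] := Forall2_getr hts2 hU.
  rewrite (onth_nth (Var 0) _ _ _ ea) (onth_nth (Var 0) _ _ _ eb).
  have hU' := @onth_map_some _ _ (dty T) (U1 :: Us) _ _ hU.
  have IH := IHs.
  move/Forall_onth: IH => /(_ _ _ hU); apply=> //.
  - by apply: (@all_onth _ _ (U1 :: Us) i).
  - apply/typedP; exists (dty T U1), (map (dty T) Us); split=> //.
    by apply: typed_replace ht _; apply: typed_mixed hU.
  - move=> D r z hr hz; rewrite /= subst_scons_replace.
    apply: red_Proj hU'; apply: hb => //.
    exact: (red_subst_mixed hr hts2 hts1 hU hz).
case eL: L hL => [|y ys].
  by move/(congr1 size): eL; rewrite size_map size_iota (Forall2_size hts1).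
case/List.Forall_cons_iff => hy hys.
apply: red_exp (red_bigPlus hA hy hys) => //.
by apply: steps_trans hs _; apply: steps_contr; apply: R_IntBetweenTup.
Qed.

(** The fundamental lemma: every constructor has its closure property except [Fix], whose unfolding
    need not terminate. *)
Lemma red_subst t s G D T : typed G t T -> fixfree t ->
  (forall i U, onth G i = Some U -> red U D (s i)) -> red T D (subst s t).
Proof.
(* Bodies of binders satisfy [red_body]: the images of the substitution can be renamed into the new
   context, and the argument is one more reducible image. *)
have body b s' G' D' U V : typed (U :: G') b V ->
    (forall s G D T, typed G b T -> fixfree b ->
      (forall i U, onth G i = Some U -> red U D (s i)) -> red T D (subst s b)) ->
    fixfree b -> (forall i U, onth G' i = Some U -> red U D' (s' i)) ->
    typed (U :: D') (subst (upsubst s') b) V /\ red_body D' U V (subst (upsubst s') b).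
  move=> hb IH hf hs; split.
    by apply: typed_subst hb; apply: tsub_up => i W /hs; exact: red_typed.
  move=> D1 r u hr hu; rewrite subst_subst.
  have -> : subst (fun i => subst (scons u (fun i => Var (r i))) (upsubst s' i)) b =
            subst (scons u (fun i => rename r (s' i))) b.
    by apply: subst_ext => -[|i] //=; rewrite subst_scons_shift.
  by apply: IH hb hf _ => -[|i] W /=; [case=> <- | move=> /hs; exact: red_rename].
elim/(@term_nested_ind S): t s G D T => /=.
- by move=> i s G D T /typedP hi _; apply.
- move=> A c s G D T /typedP -> _ _; apply: red_neutral; first by apply/typedP.
  by split=> //; apply/irreducibleP; split=> // u h; inversion h.
- move=> T1 t IH s G D T /typedP [T2 -> h] hf hs.
  by have [h1 h2] := body _ _ _ _ _ _ h IH hf hs; apply: red_Lam.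
- move=> t u IHt IHu s G D T /typedP [T1 h1 h2] /andP [f1 f2] hs.
  by apply: (@red_App _ T1); [apply: IHt h1 f1 hs | apply: IHu h2 f2 hs].
- move=> ts IH s G D T /typedP [T1 [Ts [-> h]]] hf hs; apply: red_Tup.
  apply: Forall2_mapl; apply/Forall2_onth; split; first exact: Forall2_size h.
  move=> i x U hx hU; move/Forall_onth: IH => /(_ _ _ hx) IH.
  by apply: IH (Forall2_get h hx hU) (all_onth hf hx) hs.
- move=> j t IH s G D T /typedP [T1 [Ts [h1 h2]]] hf hs.
  by apply: red_Proj h2; apply: IH h1 hf hs.
- move=> t u IHt IHu s G D T /typedP [ha h1 h2] /andP [f1 f2] hs.
  by apply: (@red_pm true) => //; [apply: IHt h1 f1 hs | apply: IHu h2 f2 hs].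
- move=> t u IHt IHu s G D T /typedP [ha h1 h2] /andP [f1 f2] hs.
  by apply: (@red_pm false) => //; [apply: IHt h1 f1 hs | apply: IHu h2 f2 hs].
- move=> t u IHt IHu s G D T /typedP [U [ha hd h1 h2]] /andP [f1 f2] hs.
  by apply: (@red_Times _ U) => //; [apply: IHt h1 f1 hs | apply: IHu h2 f2 hs].
- move=> t u IHt IHu s G D T /typedP [V [U [-> hd h2 h1]]] /andP [f1 f2] hs.
  have [hb1 hb2] := body _ _ _ _ _ _ h1 IHt f1 hs.
  by apply: red_Der => //; apply: IHu h2 f2 hs.
- move=> t u v IHt IHu IHv s G D T /typedP [U [ha hd h1 h2 h3]] /and3P [f1 f2 f3] hs.
  have [hb1 hb2] := body _ _ _ _ _ _ h3 IHv f3 hs.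
  by apply: (@red_Int _ U) => //; [apply: IHt h1 f1 hs | apply: IHu h2 f2 hs].
- move=> T1 t IH s G D T /typedP [T2 -> h] hf hs.
  have hr := IH _ _ _ _ h hf hs.
  apply: red_val; first by apply/typedP; exists T2 => //; exact: red_typed hr.
  by left; exists (subst s t).
- move=> T1 t IH s G D T /typedP [T2 -> h] hf hs.
  have hr := IH _ _ _ _ h hf hs.
  apply: red_val; first by apply/typedP; exists T2 => //; exact: red_typed hr.
  by right; exists (subst s t).
- move=> t u v IHt IHu IHv s G D T /typedP [T1 [T2 [h1 h2 h3]]] /and3P [f1 f2 f3] hs.
  have [hb1 hb2] := body _ _ _ _ _ _ h2 IHu f2 hs.
  have [hb3 hb4] := body _ _ _ _ _ _ h3 IHv f3 hs.
  by apply: (@red_Case _ T1 T2) => //; apply: IHt h1 f1 hs.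
- by [].
Qed.

Lemma fixfree_red G t T : typed G t T -> fixfree t -> red T G t.
Proof. by move=> h hf; rewrite -(subst_id t); apply: red_subst h hf _ => i U; exact: red_Var. Qed.

Lemma fixfree_normalizing G t T : typed G t T -> fixfree t -> normalizing G t.
Proof. by move=> h /(fixfree_red h); exact: red_normalizing. Qed.
End Fundamental.

(** * Normal forms *)

Section NormalForms.
Context {S : signature}.
Implicit Types (t u v : term S) (s : nat -> term S) (r : nat -> nat).
Implicit Types (T U : type (base S)) (G D : seq (type (base S))).

Lemma diffable_ity (A : itype (base S)) : diffable (ity A) -> exists b, A = IBase b.
Proof. by case: A => // b _; exists b. Qed.

(** Stuck terms start from constants and variables of interpretable types, and the eliminations
    allowed in [nb] keep types interpretable. In derivatives, integrals and products the other type
    is both interpretable and differentiable, hence a base type, where [dty] is the identity. *)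
Lemma nb_ity G t T : nb G t -> typed G t T -> exists A, T = ity A.
Proof.
elim/(@term_nested_ind S): t G T => /=; try (by move=> *;
  match goal with H : nb _ _ |- _ => inversion H end).
- move=> i G T h /typedP /= hT; inversion h; subst.
  by exists A; move: H0; rewrite hT => -[].
- by move=> A c G T _ /typedP ->; exists A.
- move=> t u IHt _ G T h /typedP [T1 h1 _]; inversion h; subst.
  by have [[b|A1 A2] //= [_ ->]] := IHt _ _ H1 h1; exists A2.
- by move=> t u IHt IHu G T h /typedP [_ h1 h2]; inversion h; subst; eauto.
- by move=> t u IHt IHu G T h /typedP [_ h1 h2]; inversion h; subst; eauto.
- move=> t u IHt IHu G T h /typedP [U [_ hd h1 h2]]; inversion h; subst.
  have [A eA] := IHu _ _ H2 h2; subst U; have [b eb] := diffable_ity hd; subst A.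
  exact: IHt H1 h1.
- move=> t u IHt IHu G T h /typedP [V [U [-> hd h2 h1]]].
  have [W [q1 q2 q3]] : exists W, [/\ typed G u W, nb (W :: G) t & nb G u].
    by inversion h; eexists; split; eassumption.
  have [A eA] := IHu _ _ q3 h2; subst U; have [b eb] := diffable_ity hd; subst A.
  by have ? := typed_uniq q1 h2; subst W; apply: IHt q2 h1.
- move=> t u v IHt IHu IHv G T h /typedP [U [_ hd h1 h2 h3]].
  have [W [q1 q2 q3]] : exists W, [/\ typed G t W, nb (W :: G) v & nb G t].
    by inversion h; eexists; split; eassumption.
  have [A eA] := IHt _ _ q3 h1; subst U; have [b eb] := diffable_ity hd; subst A.
  by have ? := typed_uniq q1 h1; subst W; apply: IHv q2 h3.
Qed.

Lemma nb_not_value G t : nb G t -> ~~ is_value t.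
Proof. by case. Qed.

(** Each rule except the unfolding of [Fix], which occurs in no [nb], inspects introduction forms at
    positions where [nb] has a stuck term. *)
Lemma nf_nb_irreducible t G : wt G t ->
  (nf G t -> irreducible G t) /\ (nb G t -> irreducible G t).
Proof.
elim/(@imm_ind S): t G => t IH G [T /typedP hw].
have hnb : nb G t -> irreducible G t.
  move=> h; have hw' := hw; case: h IH hw'.
  4-7: by move=> t' u ht hu [IH1 IH2] [_ h1 h2];
    (apply: (@irreducible_pm _ true) || apply: (@irreducible_pm _ false));
    [by case: (IH1 _ (ex_intro _ _ h1)); auto | by case: (IH2 _ (ex_intro _ _ h2)); auto |
     apply/orP; by [left; apply: nb_not_value ht | right; apply: nb_not_value hu]].
  - by move=> A c _ _; apply/irreducibleP; split=> // u h; inversion h.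
  - by move=> i A _ _ _; exact: irreducible_Var.
  - move=> t' u ht hu [IH1 IH2] [T1 h1 h2]; apply/irreducibleP; split=> /=.
      by split; [apply: (IH1 _ (ex_intro _ _ h1)).2 | apply: (IH2 _ (ex_intro _ _ h2)).1].
    by move=> v hv; move: (nb_not_value ht); inversion hv; subst.
  - move=> t' u ht hu [IH1 IH2] [U [_ _ h1 h2]]; apply: (irreducible_Times _ _ h2).
    + exact: (IH1 _ (ex_intro _ _ h1)).2.
    + exact: (IH2 _ (ex_intro _ _ h2)).2.
    + by rewrite (nb_not_value ht).
  - move=> T' t' u hT' ht hu [IH1 IH2] [V [U [_ _ h2 h1]]].
    have ? := typed_uniq hT' h2; subst T'.
    apply/irreducibleP; split=> [/=|v hv].
      split; first exact: (IH2 _ (ex_intro _ _ h2)).2.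
      move=> T' h3; have ? := typed_uniq h3 h2; subst T'.
      exact: (IH1 _ (ex_intro _ _ h1)).2.
    by move: (nb_not_value ht) (nb_not_value hu); inversion hv; subst.
  - move=> T' t' u v hT' _ ht hu hv [IH1 IH2 IH3] [U [_ _ h1 h2 h3]].
    have ? := typed_uniq hT' h1; subst T'.
    apply/irreducibleP; split=> [/=|x hx].
      split; [exact: (IH1 _ (ex_intro _ _ h1)).2 | exact: (IH2 _ (ex_intro _ _ h2)).2 |].
      move=> T' h4 _; have ? := typed_uniq h4 h1; subst T'.
      exact: (IH3 _ (ex_intro _ _ h3)).2.
    by move: (nb_not_value ht) (nb_not_value hv); inversion hx; subst.
split=> // h; case: h hnb IH hw; first by move=> t' h' hnb _ _; exact: hnb.
- move=> ts hts _ /= IH [T1 [Ts [_ h]]]; apply: irreducible_Tup.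
  apply/Forall_onth => i x hx; have [U _ hU] := Forall2_getl h hx.
  move/Forall_onth: IH => /(_ _ _ hx G (ex_intro _ _ hU)) [h1 _]; apply: h1.
  by move/Forall_onth: hts; apply; exact: hx.
- by move=> T' b hb _ _ _; exact: irreducible_Lam.
- by move=> T' a ha _ /= IH [T2 _ hT]; apply: irreducible_Inl; apply: (IH _ (ex_intro _ _ hT)).1.
- by move=> T' a ha _ /= IH [T2 _ hT]; apply: irreducible_Inr; apply: (IH _ (ex_intro _ _ hT)).1.
Qed.

Lemma nf_irreducible G t : wt G t -> nf G t -> irreducible G t.
Proof. by move=> h; case: (nf_nb_irreducible h). Qed.

Lemma value_type G t T : is_value t -> typed G t T ->
  match T with
  | TBase _ => False
  | TTup _ _ => exists ts, t = Tup ts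
  | TArr T1 _ => exists b, t = Lam T1 b
  | TSum T1 T2 => (exists a, t = Inl T2 a) \/ (exists a, t = Inr T1 a)
  end.
Proof.
case: t => //= [T1 b|ts|T2 a|T1 a] _ /typedP /=.
- by case=> T2 ->; exists b.
- by case=> T1 [Ts [->]]; exists ts.
- by case=> T1 ->; left; exists a.
- by case=> T2 ->; right; exists a.
Qed.

Lemma nf_value G t : nf G t -> nb G t \/ is_value t.
Proof. by case; auto. Qed.

Lemma nf_base G t b : nf G t -> typed G t (TBase b) -> nb G t.
Proof. by case/nf_value => // /value_type h /h. Qed.

Lemma not_interpretable G t T : nf G t -> typed G t T -> ~ (exists A, T = ity A) ->
  is_value t.
Proof. by case/nf_value => // h hT []; exact: nb_ity h hT. Qed.

(** A projection or case analysis of a variable can be irreducible without being in [nf]. Contexts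
    of interpretable types rule this out, and in them irreducible typed terms are exactly the normal
    forms. *)
Definition ictx G := forall i T, onth G i = Some T -> exists A, T = ity A.

Lemma ictx_cons G A : ictx G -> ictx (ity A :: G).
Proof. by move=> h [|i] T /=; [case=> <-; exists A | exact: h]. Qed.

Lemma ictx_nil : ictx [::].
Proof. by case. Qed.

Ltac no_redex := exfalso; match goal with
  H : forall u, ~ _ |- _ => eapply H; constructor; eassumption end.

Lemma irreducible_nf G t T : ictx G -> typed G t T -> irreducible G t -> nf G t.
Proof.
elim/(@term_nested_ind S): t G T => /=.
- by move=> i G T hG /typedP /= /[dup] hi /hG [A e] _; apply: nf_nb; apply: (nb_Var (A := A)); rewrite -e.
- by move=> A c G T _ _ _; apply: nf_nb; constructor.
- by move=> T1 t _ G T _ _ /irreducibleP [h _]; apply: nf_Lam.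
- move=> t u IHt IHu G T hG /typedP [T1 h1 h2] /irreducibleP [[i1 i2] hc].
  case: (nf_value (IHt _ _ hG h1 i1)) => [h|/value_type /(_ h1) [b eb]].
    by apply: nf_nb; apply: nb_App => //; exact: IHu h2 i2.
  by subst t; case: (hc _ (R_Beta _ _ _ _)).
- move=> ts IH G T hG /typedP [T1 [Ts [_ h]]] /irreducibleP [hi _]; apply: nf_Tup.
  apply/Forall_onth => i x hx; have [U _ hU] := Forall2_getl h hx.
  move/Forall_onth: IH => /(_ _ _ hx) IH; apply: IH hG hU _.
  by move/Forall_onth: hi; apply; exact: hx.
- move=> j t IH G T hG /typedP [T1 [Ts [h1 hj]]] /irreducibleP [i1 hc].
  have hv : is_value t by apply: not_interpretable (IH _ _ hG h1 i1) h1 _ => -[[]].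
  have [ts e] := value_type hv h1; subst t.
  have [x hx _] := Forall2_getr (typed_Tup_nth h1) hj.
  by case: (hc _ (R_Proj _ hx)).
- move=> t u IHt IHu G T hG /typedP [ha h1 h2] /irreducibleP [[i1 i2] hc].
  have n1 := IHt _ _ hG h1 i1; have n2 := IHu _ _ hG h2 i2.
  case: (nf_value n1) => [h|/value_type /(_ h1) v1]; first by apply: nf_nb; apply: nb_Add1.
  case: (nf_value n2) => [h|/value_type /(_ h2) v2]; first by apply: nf_nb; apply: nb_Add2.
  case: T ha h1 h2 v1 v2 => // [T1 Ts|T1 T2] ha h1 h2 [x ex] [y ey]; subst t u.
    have hsz : size x = size y.
      by rewrite (Forall2_size (typed_Tup_nth h1)) (Forall2_size (typed_Tup_nth h2)).
    by case: (hc _ (R_AddTup _ hsz)).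
  by case: (hc _ (R_AddLam _ _ _ _)).
- move=> t u IHt IHu G T hG /typedP [ha h1 h2] /irreducibleP [[i1 i2] hc].
  have n1 := IHt _ _ hG h1 i1; have n2 := IHu _ _ hG h2 i2.
  case: (nf_value n1) => [h|/value_type /(_ h1) v1]; first by apply: nf_nb; apply: nb_Sub1.
  case: (nf_value n2) => [h|/value_type /(_ h2) v2]; first by apply: nf_nb; apply: nb_Sub2.
  case: T ha h1 h2 v1 v2 => // [T1 Ts|T1 T2] ha h1 h2 [x ex] [y ey]; subst t u.
    have hsz : size x = size y.
      by rewrite (Forall2_size (typed_Tup_nth h1)) (Forall2_size (typed_Tup_nth h2)).
    by case: (hc _ (R_SubTup _ hsz)).
  by case: (hc _ (R_SubLam _ _ _ _)).
- move=> t u IHt IHu G T hG /typedP [U [ha hd h1 h2]] /irreducibleP [[i1 i2] hc].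
  have n1 := IHt _ _ hG h1 i1; have n2 := IHu _ _ hG h2 i2.
  case: (nf_value n2) => [h|/value_type /(_ h2) v2].
    have [A eA] := nb_ity h h2; subst U; have [b eb] := diffable_ity hd; subst A.
    have hb : isBase G u by exists b.
    case: (nf_value n1) => [h'|hv]; first by apply: nf_nb; apply: nb_Mul.
    by case: t hv {h1 i1 n1 IHt} hc => //= *; no_redex.
  case: U hd h1 h2 v2 => // U1 Us hd h1 h2 [us eu]; subst u.
  have hv : is_value t by apply: not_interpretable n1 h1 _ => -[[]].
  have [ts e] := value_type hv h1; subst t.
  have h1' := typed_Tup_nth h1; have h2' := typed_Tup_nth h2.
  have hsz : size ts = size us.
    by rewrite (Forall2_size h1') (Forall2_size h2') /= size_map.
  case: ts us hsz h1' {h1 h2 h2' hv n1 n2 i1 i2 IHt IHu} hc => [|x ts] [|y us] //= hsz h1' hc.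
    by inversion h1'.
  by exfalso; eapply hc; apply: R_MulTupTup.
- move=> t u IHt IHu G T hG /typedP [V [U [_ hd h2 h1]]] /irreducibleP [[i2 i1] hc].
  have n2 := IHu _ _ hG h2 i2.
  case: (nf_value n2) => [h|/value_type /(_ h2) v2].
    have [A eA] := nb_ity h h2; subst U; have [b eb] := diffable_ity hd; subst A.
    have hb : isBase G u by exists b.
    have n1 := IHt _ _ (@ictx_cons _ (IBase b) hG) h1 (i1 _ h2).
    case: (nf_value n1) => [h'|hv]; first by apply: nf_nb; apply: nb_Der h2 h' h.
    by case: t hv {h1 i1 n1 IHt} hc => //= *; no_redex.
  case: U hd h1 h2 v2 {i1} => // U1 Us hd h1 h2 [us eu]; subst u.
  by case: (hc _ (R_DerAtTup _ _ _)).
- move=> t u v IHt IHu IHv G T hG /typedP [U [ha hd h1 h2 h3]] /irreducibleP [[i1 i2 i3] hc].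
  have n1 := IHt _ _ hG h1 i1; have n2 := IHu _ _ hG h2 i2.
  case: U hd h1 h2 h3 => // [b|U1 Us] hd h1 h2 h3.
    have m1 := nf_base n1 h1; have m2 := nf_base n2 h2.
    have hb : isBase G t by exists b.
    have hb' : isBase G u by exists b.
    have n3 := IHv _ _ (@ictx_cons _ (IBase b) hG) h3 (i3 _ h1 h2).
    case: (nf_value n3) => [h'|hv]; first by apply: nf_nb; apply: nb_Int h1 h2 m1 m2 h'.
    by case: v hv {h3 i3 n3 IHv} hc => //= *; no_redex.
  have hv : is_value t by apply: not_interpretable n1 h1 _ => -[[]].
  have hv' : is_value u by apply: not_interpretable n2 h2 _ => -[[]].
  have [ts e] := value_type hv h1; have [us e'] := value_type hv' h2; subst t u.
  by have [x /hc] := contr_Int_Tup v h1 h2.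
- move=> T1 t IH G T hG /typedP [T2 _ h] /irreducibleP [hi _]; apply: nf_Inl; exact: IH h hi.
- move=> T1 t IH G T hG /typedP [T2 _ h] /irreducibleP [hi _]; apply: nf_Inr; exact: IH h hi.
- move=> t u v IHt _ _ G T hG /typedP [T1 [T2 [h1 _ _]]] /irreducibleP [[i1 _] hc].
  have hv : is_value t by apply: not_interpretable (IHt _ _ hG h1 i1) h1 _ => -[[]].
  by case: (value_type hv h1) => -[a e]; subst t; exfalso; eapply hc; constructor.
- by move=> t _ G T _ _ /irreducibleP [_ hc]; case: (hc _ (R_Fix _ _)).
Qed.

(** [Fix] always unfolds. Typing ensures that reduction is allowed inside every subterm, including
    the bodies that depend on the type of a point or scrutinee. *)
Lemma irreducible_fixfree G t T : typed G t T -> irreducible G t -> fixfree t.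
Proof.
elim/(@term_nested_ind S): t G T => //= [||ts IH G T|||||||||t u v IHt IHu IHv G T|t _ G T].
3: { move=> /typedP [T1 [Ts [_ h]]] /irreducibleP [hi _].
  move: hi => /= hi; elim: h hi IH => //= x U xs Us hx _ IHx /List.Forall_cons_iff [ix hi].
  by case/List.Forall_cons_iff => h1 h2; rewrite (h1 _ _ hx ix) IHx. }
11: { move=> /typedP [T1 [T2 [h1 h2 h3]]] /irreducibleP [[i1 /(_ _ _ h1) [i2 i3]] _].
  by apply/and3P; split; [apply: IHt h1 i1 | apply: IHu h2 i2 | apply: IHv h3 i3]. }
11: by move=> _ /irreducibleP [_ hc]; case: (hc _ (R_Fix _ _)).
all: intros; invert_typed; match goal with H : irreducible _ _ |- _ =>
  apply irreducibleP in H; destruct H as [H _]; simpl in H; destruct_all end;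
  repeat (apply/andP; split); eauto.
Qed.

Lemma weak_normalizable_normalizing G t : wt G t -> weak_normalizable G t -> normalizing G t.
Proof. by move=> hw [n hn hi]; exists n => //; apply: (nf_irreducible (steps_wt hn hw) hi). Qed.

(** The normal form is fix-free, hence reducible, and reducibility expands back. This is how terms
    containing [Fix] profit from the closure properties of [red]. *)
Lemma normalizing_red G t T : typed G t T -> normalizing G t -> red T G t.
Proof.
move=> h [n hn hi]; have tn := steps_typed hn h; apply: (red_exp h hn).
exact: (fixfree_red tn (irreducible_fixfree tn hi)).
Qed.
End NormalForms.

(** * Evaluation *)

Ltac inversion_nf H := inversion H;
  try match goal with H' : nb _ _ |- _ => inversion H' end.

Section Evaluation.
Context {S : signature} {M : interpretation S}.
Implicit Types (t u v : term S) (s : nat -> term S) (r : nat -> nat).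
Implicit Types (T U : type (base S)) (G D : seq (type (base S))).
Implicit Types (rho : seq (value M)) (A : itype (base S)).

(** Values whose interpretable types are not known to coincide are compared through [Tagged]. *)
Definition eval_inv rho t A (v : dom M A) : Prop :=
  match t with
  | Var i => onth rho i = Some (Tagged (dom M) v)
  | Cst A' c => Tagged (dom M) v = Tagged (dom M) (cval M c)
  | Lam T b => exists A1 A2 (f : dom M (IArr A1 A2)),
      [/\ T = ity A1, Tagged (dom M) v = Tagged (dom M) f &
       forall d : dom M A1, eval (Tagged (dom M) d :: rho) b (app f d)]
  | App a b => exists A1 (f : dom M (IArr A1 A)) d,
      [/\ eval rho a f, eval rho b d & v = app f d]
  | Plus a b => exists x y, [/\ eval rho a x, eval rho b y & v = Defs.add x y]
  | Minus a b => exists x y, [/\ eval rho a x, eval rho b y & v = Defs.sub x y]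
  | Times a b => exists b' x (y : dom M (IBase b')),
      [/\ eval rho a x, eval rho b y & v = Defs.mul x y]
  | Der a b => exists b' (f : dom M (IArr (IBase b') A)) x,
      [/\ forall d : dom M (IBase b'), eval (Tagged (dom M) d :: rho) a (app f d),
       eval rho b x & v = der f x]
  | Int a b c => exists b' (f : dom M (IArr (IBase b') A)) x y,
      [/\ eval rho a x, eval rho b y,
       forall d : dom M (IBase b'), eval (Tagged (dom M) d :: rho) c (app f d) &
       v = integ f x y]
  | _ => False
  end.

Lemma evalP rho t A (v : dom M A) : eval rho t v -> eval_inv rho t v.
Proof.
case=> {t A v} //=.
- by move=> A1 A2 t f h; exists A1, A2, f.
- by move=> A1 A2 t u f d h1 h2; exists A1, f, d.
- by move=> A t u v w h1 h2; exists v, w.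
- by move=> A t u v w h1 h2; exists v, w.
- by move=> A b t u v w h1 h2; exists b, v, w.
- by move=> b A t t0 f a h1 h2; exists b, f, a.
- by move=> b A t1 t2 t f a1 a2 h1 h2 h3; exists b, f, a1, a2.
Qed.

(** Base types form an arbitrary type, without decidable equality, so injectivity of dependent pairs
    is taken from [Eqdep]. *)
Lemma Tagged_inj A (v w : dom M A) : Tagged (dom M) v = Tagged (dom M) w -> v = w.
Proof. exact: inj_pair2. Qed.

Lemma eval_Lam_inv rho T b A1 A2 (v : dom M (IArr A1 A2)) : eval rho (Lam T b) v ->
  T = ity A1 /\ forall d : dom M A1, eval (Tagged (dom M) d :: rho) b (app v d).
Proof.
move=> /evalP [B1 [B2 [f [-> e h]]]].
have [e1 e2] : IArr A1 A2 = IArr B1 B2 by exact: (congr1 (@tag _ _) e).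
by subst B1 B2; rewrite (Tagged_inj e).
Qed.

(* When [dom M A1] is empty, a term of type [ity A1 -> T] may also be assigned
   values of other interpretable types [IArr A1 A2]. *)
Fixpoint agrees A T : Prop :=
  match A, T with
  | IBase b, TBase b' => b = b'
  | IArr A1 A2, TArr T1 T2 => T1 = ity A1 /\ (inhabited (dom M A1) -> agrees A2 T2)
  | _, _ => False
  end.

Lemma agrees_ity A : agrees A (ity A).
Proof. by elim: A => //= A1 _ A2 IH; split. Qed.

Lemma agrees_base b T : agrees (IBase b) T -> T = TBase b.
Proof. by case: T => //= b' ->. Qed.

Lemma eval_agrees rho t A (v : dom M A) T :
  eval rho t v -> typed (env_ctx rho) t T -> agrees A T.
Proof.
move=> h; elim: h T => {rho t A v}.
- move=> rho i A v hi T /typedP /=; rewrite onth_mapE hi => -[<-]; exact: agrees_ity.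
- by move=> rho A c T /typedP /= ->; exact: agrees_ity.
- by move=> rho A1 A2 t f _ IH T /typedP [T2 -> h]; split=> // -[d]; apply: IH h.
- by move=> rho A1 A2 t u f d _ IH1 _ _ T /typedP [T1 /IH1 [_ h] _]; apply: h.
- by move=> rho A t u v w _ IH _ _ T /typedP [_ /IH].
- by move=> rho A t u v w _ IH _ _ T /typedP [_ /IH].
- move=> rho A b t u v w _ IH1 _ IH2 T /typedP [U [_ _ h1 /IH2 /agrees_base e]].
  by subst U; apply: IH1 h1.
- move=> rho b A t t0 f a _ IH1 _ IH2 T /typedP [V [U [-> _ /IH2 /agrees_base e h]]].
  by subst U; apply: (IH1 a).
- move=> rho b A t1 t2 t f a1 a2 _ IH1 _ _ _ IH3 T /typedP [U [_ _ /IH1 /agrees_base e _ h]].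
  by subst U; apply: (IH3 a1).
Qed.

Lemma ictx_env rho : ictx (env_ctx rho).
Proof.
move=> i T; rewrite onth_mapE; case: (onth rho i) => [x|//] [<-]; by exists (tag x).
Qed.

Lemma eval_rename r rho rho' t A (v : dom M A) :
  (forall i x, onth rho i = Some x -> onth rho' (r i) = Some x) ->
  eval rho t v -> eval rho' (rename r t) v.
Proof.
have up rh rh' r' y : (forall i x, onth rh i = Some x -> onth rh' (r' i) = Some x) ->
  forall i (x : value M), onth (y :: rh) i = Some x -> onth (y :: rh') (upren r' i) = Some x.
  by move=> h [|i] x //=; exact: h.
move=> hr h; elim: h r rho' hr => /= {rho t A v}; try (by move=> *; constructor; eauto).
Qed.

(** Meant to meet the premise of [eval_total]. Every stuck subterm has an interpretable type by
    [nb_ity], so its arguments do too, and tuples, injections and projections cannot occur. *)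
Lemma nf_interpretable t G A : ictx G -> typed G t (ity A) -> nf G t -> interpretable_term t.
Proof.
elim/(@term_nested_ind S): t G A => /=.
- by constructor.
- by constructor.
- move=> T1 t IH G A hG /typedP [T2 e h] hn; case: A e => // A1 A2 [e1 e2]; subst T1 T2.
  constructor; apply: (IH _ _ _ h); first exact: ictx_cons.
  apply: irreducible_nf (h) _; first exact: ictx_cons.
  by inversion_nf hn.
- move=> t u IHt IHu G A hG /typedP [T1 h1 h2] hn.
  have {hn} [n1 n2] : nb G t /\ nf G u.
    by inversion_nf hn.
  have [[b|A1 A2] //= [e1 e2]] := nb_ity n1 h1; subst T1.
  constructor; last exact: IHu h2 n2.
  exact: (IHt G (IArr A1 A) hG h1 (nf_nb n1)).
- by move=> ts IH G A hG /typedP [? [? []]]; case: A.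
- by move=> j t IH G A hG _ hn; inversion_nf hn.
- move=> t u IHt IHu G A hG /typedP [ha h1 h2] hn.
  have {hn} [n1 n2] : nf G t /\ nf G u.
    by inversion_nf hn;
      split=> //; exact: nf_nb.
  by constructor; [exact: IHt h1 n1 | exact: IHu h2 n2].
- move=> t u IHt IHu G A hG /typedP [ha h1 h2] hn.
  have {hn} [n1 n2] : nf G t /\ nf G u.
    by inversion_nf hn;
      split=> //; exact: nf_nb.
  by constructor; [exact: IHt h1 n1 | exact: IHu h2 n2].
- move=> t u IHt IHu G A hG /typedP [U [ha hd h1 h2]] hn.
  have {hn} [n1 n2] : nb G t /\ nb G u.
    by inversion_nf hn.
  have [B eB] := nb_ity n2 h2; have [B' eB'] := nb_ity n1 h1.
  rewrite eB' in h1; rewrite eB in h2.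
  by constructor; [exact: IHt h1 (nf_nb n1) | exact: IHu h2 (nf_nb n2)].
- move=> t u IHt IHu G A hG /typedP [V [U [eA hd h2 h1]]] hn.
  have {hn} [n2 [W [hW n1]]] : nb G u /\ exists W, typed G u W /\ nb (W :: G) t.
    by inversion_nf hn; eauto.
  have ? := typed_uniq hW h2; subst W.
  have [B eB] := nb_ity n2 h2; subst U; have [B' eB'] := nb_ity n1 h1; subst V.
  by constructor; [apply: IHt h1 (nf_nb n1); exact: ictx_cons | exact: IHu h2 (nf_nb n2)].
- move=> t u w IHt IHu IHw G A hG /typedP [U [ha hd h1 h2 h3]] hn.
  have {hn} [n1 n2 [W [hW n3]]] : [/\ nb G t, nb G u & exists W, typed G t W /\ nb (W :: G) w].
    by inversion_nf hn; split; eauto.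
  have ? := typed_uniq hW h1; subst W.
  have [B eB] := nb_ity n1 h1; subst U; have [B' eB'] := nb_ity n3 h3; rewrite eB' in h3.
  constructor; [exact: IHt h1 (nf_nb n1) | exact: IHu h2 (nf_nb n2) |].
  by apply: IHw h3 (nf_nb n3); exact: ictx_cons.
- by move=> T1 t IH G A hG /typedP [? e]; case: A e.
- by move=> T1 t IH G A hG /typedP [? e]; case: A e.
- by move=> t u w _ _ _ G A hG _ hn; inversion_nf hn.
- by move=> t _ G A hG _ hn; inversion_nf hn.
Qed.

Lemma nf_rename r G D t T : ren r G D -> ictx D -> typed G t T -> nf G t -> nf D (rename r t).
Proof.
move=> hr hD ht hn; have hw : wt G t by exists T.
exact: (irreducible_nf hD (typed_rename hr ht) (irreducible_rename hr hw (nf_irreducible hw hn))).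
Qed.

Lemma nb_rename r G D t T : ren r G D -> ictx D -> typed G t T -> nb G t -> nb D (rename r t).
Proof.
move=> hr hD ht hn; case: (nf_value (nf_rename hr hD ht (nf_nb hn))) => //.
by rewrite is_value_rename (negbTE (nb_not_value hn)).
Qed.

Lemma nb_subst_of_nf t s G D T : typed G t T ->
  (forall i U, onth G i = Some U -> nb D (s i)) -> nf D (subst s t) -> nb G t ->
  nb D (subst s t).
Proof.
move=> ht hnb h /nb_not_value hv; case: (nf_value h) => // hv'.
by case: t ht h hv hv' => //= i /typedP /= hi *; apply: hnb hi.
Qed.

(** Replacing variables by stuck terms creates no redex, as stuck terms are not introduction forms.
    The case of interest puts a limit of base type, whose normal form is stuck, for the variable of
    integration. *)
Lemma nf_subst t s G D A : ictx G -> ictx D -> typed G t (ity A) -> tsub s G D ->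
  (forall i T, onth G i = Some T -> nb D (s i)) -> nf G t -> nf D (subst s t).
Proof.
have up s' G' D' A' : ictx D' -> tsub s' G' D' ->
    (forall i T, onth G' i = Some T -> nb D' (s' i)) ->
    forall i T, onth (ity A' :: G') i = Some T -> nb (ity A' :: D') (upsubst s' i).
  move=> hD hs hnb [|i] T /= hi'; first by apply: (nb_Var (A := A')).
  exact: (nb_rename (@ren_succ _ _ _) (@ictx_cons _ _ A' hD) (hs _ _ hi') (hnb _ _ hi')).
elim/(@term_nested_ind S): t s G D A => /=.
- by move=> i s G D A hG hD /typedP /= hi hs hnb _; apply: nf_nb; exact: hnb hi.
- by move=> *; apply: nf_nb; constructor.
- move=> T1 t IH s G D A hG hD /typedP [T2 e h] hs hnb hn.
  case: A e => // A1 A2 [e1 e2]; subst T1 T2.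
  have hi : irreducible (ity A1 :: G) t.
    by inversion_nf hn.
  have hG' := @ictx_cons _ _ A1 hG; have hD' := @ictx_cons _ _ A1 hD.
  apply: nf_Lam; apply: nf_irreducible; first by exists (ity A2); exact: (typed_subst (tsub_up hs) h).
  apply: (IH _ (ity A1 :: G) _ A2) => //; [exact: tsub_up | exact: up | exact: irreducible_nf h hi].
- move=> t u IHt IHu s G D A hG hD /typedP [T1 h1 h2] hs hnb hn.
  have {hn} [n1 n2] : nb G t /\ nf G u.
    by inversion_nf hn.
  have [[b|A1 A2] //= [e1 e2]] := nb_ity n1 h1; subst T1.
  apply: nf_nb; apply: nb_App; last exact: (IHu s G D A1).
  exact: nb_subst_of_nf h1 hnb (IHt s G D (IArr A1 A) hG hD h1 hs hnb (nf_nb n1)) n1.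
- by move=> ts IH s G D A hG hD /typedP [? [? []]]; case: A.
- by move=> j t IH s G D A hG hD _ _ _ hn; inversion_nf hn.
- move=> t u IHt IHu s G D A hG hD /typedP [ha h1 h2] hs hnb hn.
  have q1 n := IHt s G D A hG hD h1 hs hnb n; have q2 n := IHu s G D A hG hD h2 hs hnb n.
  have [[n1 n2]|[n1 n2]] : nb G t /\ nf G u \/ nf G t /\ nb G u.
    by inversion_nf hn; auto.
    by apply: nf_nb; apply: nb_Add1; [exact: (nb_subst_of_nf h1 hnb (q1 (nf_nb n1)) n1) | exact: q2].
  by apply: nf_nb; apply: nb_Add2; [exact: q1 | exact: (nb_subst_of_nf h2 hnb (q2 (nf_nb n2)) n2)].
- move=> t u IHt IHu s G D A hG hD /typedP [ha h1 h2] hs hnb hn.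
  have q1 n := IHt s G D A hG hD h1 hs hnb n; have q2 n := IHu s G D A hG hD h2 hs hnb n.
  have [[n1 n2]|[n1 n2]] : nb G t /\ nf G u \/ nf G t /\ nb G u.
    by inversion_nf hn; auto.
    by apply: nf_nb; apply: nb_Sub1; [exact: (nb_subst_of_nf h1 hnb (q1 (nf_nb n1)) n1) | exact: q2].
  by apply: nf_nb; apply: nb_Sub2; [exact: q1 | exact: (nb_subst_of_nf h2 hnb (q2 (nf_nb n2)) n2)].
- move=> t u IHt IHu s G D A hG hD /typedP [U [ha hd h1 h2]] hs hnb hn.
  have {hn} [n1 n2] : nb G t /\ nb G u.
    by inversion_nf hn.
  have [B eB] := nb_ity n2 h2; have [B' eB'] := nb_ity n1 h1.
  rewrite eB' in h1; rewrite eB in h2.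
  apply: nf_nb; apply: nb_Mul.
    exact: (nb_subst_of_nf h1 hnb (IHt s G D B' hG hD h1 hs hnb (nf_nb n1)) n1).
  exact: (nb_subst_of_nf h2 hnb (IHu s G D B hG hD h2 hs hnb (nf_nb n2)) n2).
- move=> t u IHt IHu s G D A hG hD /typedP [V [U [eA hd h2 h1]]] hs hnb hn.
  have {hn} [n2 [W [hW n1]]] : nb G u /\ exists W, typed G u W /\ nb (W :: G) t.
    by inversion_nf hn; eauto.
  have ? := typed_uniq hW h2; subst W.
  have [B eB] := nb_ity n2 h2; subst U; have [B' eB'] := nb_ity n1 h1; subst V.
  have hG' := @ictx_cons _ _ B hG; have hD' := @ictx_cons _ _ B hD.
  have hs' := @tsub_up _ s G D (ity B) hs; have hnb' := up s G D B hD hs hnb.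
  apply: nf_nb; apply: nb_Der (typed_subst hs h2) _ _.
    exact: (nb_subst_of_nf h1 hnb' (IHt _ _ _ B' hG' hD' h1 hs' hnb' (nf_nb n1)) n1).
  exact: (nb_subst_of_nf h2 hnb (IHu s G D B hG hD h2 hs hnb (nf_nb n2)) n2).
- move=> t u w IHt IHu IHw s G D A hG hD /typedP [U [ha hd h1 h2 h3]] hs hnb hn.
  have {hn} [n1 n2 [W [hW n3]]] : [/\ nb G t, nb G u & exists W, typed G t W /\ nb (W :: G) w].
    by inversion_nf hn; split; eauto.
  have ? := typed_uniq hW h1; subst W.
  have [B eB] := nb_ity n1 h1; subst U; have [B' eB'] := nb_ity n3 h3; rewrite eB' in h3.
  have hG' := @ictx_cons _ _ B hG; have hD' := @ictx_cons _ _ B hD.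
  have hs' := @tsub_up _ s G D (ity B) hs; have hnb' := up s G D B hD hs hnb.
  apply: nf_nb; apply: nb_Int (typed_subst hs h1) (typed_subst hs h2) _ _ _.
  + exact: (nb_subst_of_nf h1 hnb (IHt s G D B hG hD h1 hs hnb (nf_nb n1)) n1).
  + exact: (nb_subst_of_nf h2 hnb (IHu s G D B hG hD h2 hs hnb (nf_nb n2)) n2).
  + exact: (nb_subst_of_nf h3 hnb' (IHw _ _ _ B' hG' hD' h3 hs' hnb' (nf_nb n3)) n3).
- by move=> T1 t IH s G D A hG hD /typedP [? e]; case: A e.
- by move=> T1 t IH s G D A hG hD /typedP [? e]; case: A e.
- by move=> t u w _ _ _ s G D A hG hD _ _ _ hn; inversion_nf hn.
- by move=> t _ s G D A hG hD _ _ _ hn; inversion_nf hn.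
Qed.

Lemma nb_inst G p a A b : ictx G -> nb (TBase b :: G) p ->
  typed (TBase b :: G) p (ity A) -> nf G a -> typed G a (TBase b) -> nb G (inst p a).
Proof.
move=> hG hp htp ha hta.
have hs : tsub (scons a Var) (TBase b :: G) G by exact: tsub_scons (@tsub_id _ G).
have hnb i T : onth (TBase b :: G) i = Some T -> nb G (scons a Var i).
  case: i => [_|i /= hi]; first exact: nf_base ha hta.
  by have [B eB] := hG _ _ hi; apply: (nb_Var (A := B)); rewrite -eB.
apply: (nb_subst_of_nf htp hnb) => //.
exact: (nf_subst (@ictx_cons _ _ (IBase b) hG) hG htp hs hnb (nf_nb hp)).
Qed.

Context (HM : base_laws M).

Lemma nf_eval rho t A : nf (env_ctx rho) t -> typed (env_ctx rho) t (ity A) ->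
  exists v : dom M A, eval rho t v.
Proof.
move=> hn ht; apply: (eval_total HM) => //.
by apply: nf_interpretable ht hn; exact: ictx_env.
Qed.

(** Typing pins down, through [agrees], the types of the intermediate values in the two evaluations;
    functions are compared by extensionality. *)
Lemma eval_det rho t A (v w : dom M A) T : typed (env_ctx rho) t T ->
  eval rho t v -> eval rho t w -> v = w.
Proof.
move=> ht h; elim: h w T ht => {rho t A v}.
- by move=> rho i A v hi w T _ /evalP /=; rewrite hi => /(@Some_inj _ _ _)/Tagged_inj.
- by move=> rho A c w T _ /evalP /= /Tagged_inj ->.
- move=> rho A1 A2 t f _ IH w T /typedP [T2 _ h] /eval_Lam_inv [_ h'].
  by apply: (app_ext HM) => d; apply: IH h (h' d).
- move=> rho A1 A2 t u f d ef IH1 ed IH2 w T /typedP [T1 h1 h2] /evalP [B1 [g [x [eg ex ->]]]].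
  have [e1 _] := eval_agrees ef h1; have [e2 _] := eval_agrees eg h1.
  have ? : A1 = B1 by apply: ity_inj; rewrite -e1 -e2.
  by subst B1; rewrite (IH1 _ _ h1 eg) (IH2 _ _ h2 ex).
- move=> rho A t u x y _ IH1 _ IH2 w T /typedP [_ h1 h2] /evalP [x' [y' [ex ey ->]]].
  by rewrite (IH1 _ _ h1 ex) (IH2 _ _ h2 ey).
- move=> rho A t u x y _ IH1 _ IH2 w T /typedP [_ h1 h2] /evalP [x' [y' [ex ey ->]]].
  by rewrite (IH1 _ _ h1 ex) (IH2 _ _ h2 ey).
- move=> rho A b t u x y _ IH1 hy IH2 w T /typedP [U [_ _ h1 h2]] /evalP [b' [x' [y' [ex ey ->]]]].
  have e1 := agrees_base (eval_agrees hy h2); have := agrees_base (eval_agrees ey h2).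
  rewrite e1 => -[?]; subst b'.
  by rewrite (IH1 _ _ h1 ex) (IH2 _ _ h2 ey).
- move=> rho b A t u f a _ IH1 ha IH2 w T /typedP [V [U [_ _ h2 h1]]] /evalP [b' [g [x [eg ex ->]]]].
  have e1 := agrees_base (eval_agrees ha h2); have := agrees_base (eval_agrees ex h2).
  rewrite e1 => -[?]; subst b' U.
  rewrite (IH2 _ _ h2 ex); congr der; apply: (app_ext HM) => d.
  exact: IH1 h1 (eg d).
- move=> rho b A t1 t2 t f a1 a2 ha1 IH1 ha2 IH2 hf IH3 w T /typedP [U [_ _ h1 h2 h3]].
  move=> /evalP [b' [g [x [y [ex ey eg ->]]]]].
  have e1 := agrees_base (eval_agrees ha1 h1); have := agrees_base (eval_agrees ex h1).
  rewrite e1 => -[?]; subst b' U.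
  rewrite (IH1 _ _ h1 ex) (IH2 _ _ h2 ey); congr integ; apply: (app_ext HM) => d.
  exact: IH3 h3 (eg d).
Qed.

(** * Values of sums and of integrals of derivatives at interpretable types *)

Definition addsub b A (v w : dom M A) := if b then Defs.add v w else Defs.sub v w.

Lemma addable_ity A : addable (ity A).
Proof. by elim: A. Qed.

(** Two abstractions form a redex, so normalization continues under the binder; the value is
    unaffected because addition and subtraction of functions are pointwise. *)
Lemma pm_nf b A G p q : ictx G -> nf G p -> nf G q -> typed G p (ity A) -> typed G q (ity A) ->
  exists n, [/\ steps G (plusminus b p q) n, nf G n &
    forall rho (v w : dom M A), env_ctx rho = G -> eval rho p v -> eval rho q w ->
    eval rho n (addsub b v w)].
Proof.
elim: A G p q => [c|A1 IH1 A2 IH2] G p q hG np nq hp hq.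
  exists (plusminus b p q); split; first exact: steps_refl.
    by case: b; apply: nf_nb; constructor=> //; exact: nf_base np hp.
  by move=> rho v w _ hv hw; case: (b); constructor.
(* With one stuck argument the sum is already normal. *)
have triv : nb G p \/ nb G q -> exists n, [/\ steps G (plusminus b p q) n, nf G n &
    forall rho (v w : dom M (IArr A1 A2)), env_ctx rho = G -> eval rho p v -> eval rho q w ->
    eval rho n (addsub b v w)].
  move=> h; exists (plusminus b p q); split; first exact: steps_refl.
    by case: (b); apply: nf_nb; case: h => h; by [apply: nb_Add1 | apply: nb_Add2 | apply: nb_Sub1 | apply: nb_Sub2].
  by move=> rho v w _ hv hw; case: (b); constructor.
case: (nf_value np) => [h|vp]; first by apply: triv; left.
case: (nf_value nq) => [h|vq]; first by apply: triv; right.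
have [p' ep] := value_type vp hp; have [q' eq] := value_type vq hq; subst p q.
move: hp hq => /typedP [? [<-] hp] /typedP [? [<-] hq].
have hG' := @ictx_cons _ _ A1 hG.
have ip : irreducible (ity A1 :: G) p'.
  by inversion_nf np.
have iq : irreducible (ity A1 :: G) q'.
  by inversion_nf nq.
have [n [h1 h2 h3]] := IH2 _ p' q' hG' (irreducible_nf hG' hp ip) (irreducible_nf hG' hq iq) hp hq.
exists (Lam (ity A1) n); split.
- apply: steps_trans (steps_contr (contr_pm_Lam _ _ _ _ _)) _; exact: steps_Lam.
- apply: nf_Lam; apply: nf_irreducible h2; exists (ity A2).
  apply: steps_typed h1 _; apply: typed_pm => //; exact: addable_ity.
- move=> rho v w eG /eval_Lam_inv [_ hv] /eval_Lam_inv [_ hw]; constructor=> d.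
  have := h3 (Tagged (dom M) d :: rho) _ _ (congr1 (cons (ity A1)) eG) (hv d) (hw d).
  by rewrite /addsub; case: (b); rewrite ?(app_add HM) ?(app_sub HM).
Qed.

(** At a function type both sides are applied to an argument [d]. A stuck [p] applied to a variable
    standing for [d] is again stuck, of smaller type, and the laws [app_integ] and [app_der] move
    the application inside the integral and the derivative. *)
Lemma nl_nb b A rho p a1 a2 (v w : dom M A) :
  nb (TBase b :: env_ctx rho) p -> typed (TBase b :: env_ctx rho) p (ity A) ->
  nf (env_ctx rho) a1 -> typed (env_ctx rho) a1 (TBase b) ->
  nf (env_ctx rho) a2 -> typed (env_ctx rho) a2 (TBase b) ->
  eval rho (int_der a1 a2 p) v -> eval rho (Minus (inst p a2) (inst p a1)) w -> v = w.
Proof.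
elim: A rho p a1 a2 v w => [c|A1 _ A2 IH] rho p a1 a2 v w np hp n1 h1 n2 h2 hv hw.
  exact: (newton_leibniz_base HM) (nf_nb np) hp n1 h1 n2 h2 hv hw.
apply: (app_ext HM) => d; set rho' := Tagged (dom M) d :: rho.
(* Index 0 remains the variable of integration; [d] is inserted just behind it, as index 1. *)
set p' := App (rename (upren succn) p) (Var 1).
have hr := ren_up (T := TBase b) (@ren_succ _ (ity A1) (env_ctx rho)).
have hD : ictx (TBase b :: env_ctx rho') by exact: (@ictx_cons _ _ (IBase b) (@ictx_env rho')).
have hpr := typed_rename hr hp.
have np' : nb (TBase b :: env_ctx rho') p'.
  apply: nb_App; first exact: (nb_rename hr hD hp np).
  by apply: nf_nb; apply: (nb_Var (A := A1)).
have hp' : typed (TBase b :: env_ctx rho') p' (ity A2).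
  by apply/typedP; exists (ity A1) => //; apply/typedP.
have hs := @ren_succ _ (ity A1) (env_ctx rho).
have n1' : nf (env_ctx rho') (shift a1) by exact: nf_rename hs (@ictx_env rho') h1 n1.
have n2' : nf (env_ctx rho') (shift a2) by exact: nf_rename hs (@ictx_env rho') h2 n2.
have h1' : typed (env_ctx rho') (shift a1) (TBase b) by exact: typed_shift.
have h2' : typed (env_ctx rho') (shift a2) (TBase b) by exact: typed_shift.
have wk : forall i x, onth rho i = Some x -> onth rho' i.+1 = Some x by [].
have hx a : inst p' (shift a) = App (shift (inst p a)) (Var 0).
  rewrite /inst /= /shift [in RHS]renameE subst_subst subst_rename; congr (App _ (Var 0)).
  by apply: subst_ext => -[|i] //=; rewrite renameE.
have hw' : eval rho' (Minus (inst p' (shift a2)) (inst p' (shift a1))) (app w d).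
  move: hw => /evalP [x [y [ex ey ->]]]; rewrite (app_sub HM) !hx.
  by constructor; (apply: E_App; [exact: eval_rename wk _ | exact: E_Var]).
have htl : typed (env_ctx rho') (int_der (shift a1) (shift a2) p') (ity A2).
  apply/typedP; exists (TBase b); split=> //; first exact: addable_ity.
  apply/typedP; exists (ity A2), (TBase b); split=> //; first by apply/typedP.
  exact: typed_avoid.
have nl : nf (env_ctx rho') (int_der (shift a1) (shift a2) p').
  have hD2 : ictx (TBase b :: TBase b :: env_ctx rho').
    exact: (@ictx_cons _ _ (IBase b)).
  apply: nf_nb; apply: nb_Int h1' h2' (nf_base n1' h1') (nf_base n2' h2') _.
  apply: (nb_Der (T := TBase b)); first by apply/typedP.
    by apply: (nb_rename (ren_up (@ren_succ _ _ _)) hD2 hp' np').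
  by apply: (nb_Var (A := IBase b)).
(* The integral for [p'] is normal and so has a value, which the induction hypothesis identifies
   with [app w d]. *)
have [v2 hv2] := nf_eval nl htl.
rewrite -(IH rho' p' _ _ v2 _ np' hp' n1' h1' n2' h2' hv2 hw').
move: hv2 => /evalP [b2 [f2 [x2 [y2 [ex2 ey2 ef2 ->]]]]].
move: hv => /evalP [b1 [f1 [x1 [y1 [ex1 ey1 ef1 ->]]]]].
have [?] := agrees_base (eval_agrees ex1 h1); subst b1.
have [?] := agrees_base (eval_agrees ex2 h1'); subst b2.
rewrite -(eval_det h1' (eval_rename wk ex1) ex2) -(eval_det h2' (eval_rename wk ey1) ey2).
(* Limits having been identified, it remains to compare the integrands at each point [e], and then
   the functions under the derivative at each [e']. *)
apply: (app_integ HM) => e.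
move: (ef1 e) => /evalP [b1 [g1 [z1 [eg1 ez1 ->]]]].
move: (ef2 e) => /evalP [b2 [g2 [z2 [eg2 ez2 ->]]]].
have hV1 rho1 : typed (env_ctx (Tagged (dom M) e :: rho1)) (Var 0) (TBase b) by apply/typedP.
have [?] := agrees_base (eval_agrees ez1 (hV1 _)); subst b1.
have [?] := agrees_base (eval_agrees ez2 (hV1 _)); subst b2.
have ev rho1 : eval (Tagged (dom M) e :: rho1) (Var 0) e by apply: E_Var.
rewrite (eval_det (hV1 _) ez1 (ev _)) (eval_det (hV1 _) ez2 (ev _)).
symmetry; apply: (app_der HM) => e'.
move: (eg2 e') => /evalP [B [h [d' [eh ed ->]]]].
have hT : typed (env_ctx (Tagged (dom M) e' :: Tagged (dom M) e :: rho'))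
  (rename (upren succn) (rename (upren succn) p)) (ity (IArr A1 A2)).
  by apply: typed_rename (typed_rename hr hp); exact: ren_up.
have [eB _] := eval_agrees eh hT; have ? := ity_inj eB; subst B.
(* Behind the variable of differentiation [e'] and that of integration [e], the argument [d] has
   index 2. *)
have eV : eval (Tagged (dom M) e' :: Tagged (dom M) e :: rho') (Var 2) d by apply: E_Var.
have hV2 : typed (env_ctx (Tagged (dom M) e' :: Tagged (dom M) e :: rho')) (Var 2) (ity A1).
  by apply/typedP.
rewrite (eval_det hV2 ed eV); congr app.
apply: (eval_det hT eh).
have wk2 : forall i x, onth (Tagged (dom M) e' :: Tagged (dom M) e :: rho) i = Some x ->
    onth (Tagged (dom M) e' :: Tagged (dom M) e :: rho') (upren (upren succn) i) = Some x.
  by case=> [|[|i]].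
rewrite (_ : rename _ (rename _ p) = rename (upren (upren succn)) (avoid p)).
  exact: eval_rename wk2 (eg1 e').
by rewrite /avoid !renameE !subst_subst; apply: subst_ext => -[|i].
Qed.

(** The derivative passes under the abstraction, then the integral does; each exchanges its own
    bound variable with the abstracted one. *)
Lemma steps_int_der_Lam G b T a1 a2 p : typed G a1 (TBase b) -> typed G a2 (TBase b) ->
  steps G (int_der a1 a2 (Lam T p)) (Lam T (int_der (shift a1) (shift a2) (swap p))).
Proof.
move=> h1 h2; have hV : typed (TBase b :: G) (@Var S 0) (TBase b) by apply/typedP.
have hb1 : isBase G a1 by exists b. have hb2 : isBase G a2 by exists b.
apply: (@steps_trans _ _ _ (Int a1 a2 (Lam T (Der (swap (rename (upren (upren succn)) p)) (Var 1))))).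
  apply: steps1; apply: C_Int3 h1 h2 _; apply: contr_step.
  by apply: (R_DerLam T (rename (upren (upren succn)) p) (t0 := Var 0)); exists b.
apply: steps1; rewrite (_ : int_der _ _ _ =
  Int (shift a1) (shift a2) (swap (Der (swap (rename (upren (upren succn)) p)) (Var 1)))).
  exact: S_IntLam.
rewrite /int_der /swap /=; congr (Int _ _ (Der _ _)).
by rewrite /avoid !renameE !subst_subst; apply: subst_ext => -[|[|i]].
Qed.

Lemma inst_Lam T p a : inst (Lam T p) a = Lam T (inst (swap p) (shift a)).
Proof.
rewrite /inst /= /swap subst_rename; congr Lam; apply: subst_ext => -[|[|i]] //.
Qed.

Lemma typed_int_der G a1 a2 p T (U : base S) : addable T -> typed G a1 (TBase U) ->
  typed G a2 (TBase U) -> typed (TBase U :: G) p T -> typed G (int_der a1 a2 p) T.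
Proof.
move=> hT h1 h2 hp; apply/typedP; exists (TBase U); split=> //.
by apply/typedP; exists T, (TBase U); split=> //; [apply/typedP | exact: typed_avoid].
Qed.

(** With a stuck integrand both sides are normal as they stand. The comparison of values over all
    environments of context [G] is what lets the statement pass under abstractions. *)
Lemma nl_nf_nb b A G p a1 a2 : ictx G -> nb (TBase b :: G) p -> typed (TBase b :: G) p (ity A) ->
  nf G a1 -> typed G a1 (TBase b) -> nf G a2 -> typed G a2 (TBase b) ->
  exists n1 n2, [/\ steps G (int_der a1 a2 p) n1 /\ nf G n1,
    steps G (Minus (inst p a2) (inst p a1)) n2 /\ nf G n2 &
    forall rho (v : dom M A), env_ctx rho = G -> eval rho n1 v -> eval rho n2 v].
Proof.
move=> hG hb hp m1 h1 m2 h2; exists (int_der a1 a2 p), (Minus (inst p a2) (inst p a1)).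
have hm : nf G (Minus (inst p a2) (inst p a1)).
  by apply: nf_nb; apply: nb_Sub1; last apply: nf_nb; exact: nb_inst hG hb hp _ _.
split.
- split; first exact: steps_refl.
  have hGb := @ictx_cons _ _ (IBase b) hG; have hGbb := @ictx_cons _ _ (IBase b) hGb.
  apply: nf_nb; apply: nb_Int h1 h2 (nf_base m1 h1) (nf_base m2 h2) _.
  apply: (nb_Der (T := TBase b)); first by apply/typedP.
    by apply: (nb_rename (ren_up (@ren_succ _ _ _)) hGbb hp hb).
  by apply: (nb_Var (A := IBase b)).
- by split=> //; exact: steps_refl.
move=> rho v eG hv; subst G.
have ht : typed (env_ctx rho) (Minus (inst p a2) (inst p a1)) (ity A).
  apply/typedP; split; first exact: addable_ity.
    exact: typed_inst hp h2.
  exact: typed_inst hp h1.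
have [w hw] := nf_eval hm ht.
by rewrite (nl_nb hb hp m1 h1 m2 h2 hv hw).
Qed.

(** An abstraction is moved outwards on both sides, and the normal forms of the bodies come from the
    induction hypothesis in the context extended by the abstracted variable. *)
Lemma nl_nf b A G p a1 a2 : ictx G -> nf (TBase b :: G) p -> typed (TBase b :: G) p (ity A) ->
  nf G a1 -> typed G a1 (TBase b) -> nf G a2 -> typed G a2 (TBase b) ->
  exists n1 n2, [/\ steps G (int_der a1 a2 p) n1 /\ nf G n1,
    steps G (Minus (inst p a2) (inst p a1)) n2 /\ nf G n2 &
    forall rho (v : dom M A), env_ctx rho = G -> eval rho n1 v -> eval rho n2 v].
Proof.
elim: A G p a1 a2 => [c|A1 _ A2 IH] G p a1 a2 hG np hp m1 h1 m2 h2.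
  have hb := nf_base np hp; exact: nl_nf_nb hG hb hp m1 h1 m2 h2.
case: (nf_value np) => [hb|hv]; first exact: nl_nf_nb hG hb hp m1 h1 m2 h2.
have [q eq] := value_type hv hp; subst p; move: hp => /typedP [? [<-] hq].
have hG' := @ictx_cons _ _ A1 hG.
have hGb := @ictx_cons _ _ (IBase b) hG.
have iq : irreducible (ity A1 :: TBase b :: G) q.
  by inversion_nf np.
have nq := irreducible_nf (@ictx_cons _ _ A1 hGb) hq iq.
have nq' : nf (TBase b :: ity A1 :: G) (swap q).
  by apply: (nf_rename _ _ hq nq); [case=> [|[|i]] | exact: (@ictx_cons _ _ (IBase b) hG')].
have hq' := typed_swap hq; have hs := @ren_succ _ (ity A1) G.
have [n1 [n2 [[s1 k1] [s2 k2] hev]]] := IH _ _ _ _ hG' nq' hq'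
  (nf_rename hs hG' h1 m1) (typed_shift _ h1) (nf_rename hs hG' h2 m2) (typed_shift _ h2).
have tl : typed (ity A1 :: G) (int_der (shift a1) (shift a2) (swap q)) (ity A2).
  exact: typed_int_der (addable_ity _) (typed_shift _ h1) (typed_shift _ h2) hq'.
have tr : typed (ity A1 :: G) (Minus (inst (swap q) (shift a2)) (inst (swap q) (shift a1))) (ity A2).
  apply/typedP; split; first exact: addable_ity.
    exact: typed_inst hq' (typed_shift _ h2).
  exact: typed_inst hq' (typed_shift _ h1).
exists (Lam (ity A1) n1), (Lam (ity A1) n2); split.
- split; first by apply: (steps_trans _ (steps_Lam s1)); apply: steps_int_der_Lam h1 h2.
  by apply: nf_Lam; apply: nf_irreducible k1; exists (ity A2); exact: steps_typed s1 tl.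
- split; last by apply: nf_Lam; apply: nf_irreducible k2; exists (ity A2); exact: steps_typed s2 tr.
  rewrite !inst_Lam; apply: (steps_trans _ (steps_Lam s2)); apply: steps_contr; exact: R_SubLam.
- move=> rho v eG /eval_Lam_inv [_ hv']; constructor=> d.
  exact: (hev (Tagged (dom M) d :: rho) _ (congr1 (cons (ity A1)) eG) (hv' d)).
Qed.
End Evaluation.

(** * Newton-Leibniz formula *)

Section NormalizationInversion.
Context {S : signature}.
Implicit Types (t u v : term S) (s : nat -> term S) (r : nat -> nat).
Implicit Types (T U : type (base S)) (G D : seq (type (base S))).

Lemma normalizing_red_step G t u : wt G t -> steps G t u -> normalizing G t -> normalizing G u.
Proof. by move=> hw hu [n hn hi]; exists n => //; exact: steps_irreducible hw hi hn hu. Qed.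

Lemma normalizing_unrename r G D t : ren r G D -> wt G t -> normalizing D (rename r t) ->
  normalizing G t.
Proof.
move=> hr hw [n hn hi]; have [m e hm] := steps_unrename hr hw hn; subst n.
by exists m => //; exact: irreducible_unrename hr hi.
Qed.

(** No rule contracts an introduction form at the root, so by [steps_head] its reduction takes place
    inside the parts. *)
Lemma normalizing_Tup_inv G ts : wt G (Tup ts) -> normalizing G (Tup ts) ->
  List.Forall (normalizing G) ts.
Proof.
move=> hw [n hn hi]; have [c /congP [ns -> hc] [e|[v hv]]] := steps_head hw hn; last by inversion hv.
subst n; move/irreducibleP: hi => [/= hi _]; apply/Forall_onth => i x hx.
have [y hy hxy] := Forall2_getl hc hx; exists y => //.
by move/Forall_onth: hi; apply; exact: hy.
Qed.

Lemma normalizing_Lam_inv G T t : wt G (Lam T t) -> normalizing G (Lam T t) ->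
  normalizing (T :: G) t.
Proof.
move=> hw [n hn hi]; have [c /congP [m -> hc] [e|[v hv]]] := steps_head hw hn; last by inversion hv.
by subst n; move/irreducibleP: hi => [/= hi _]; exists m.
Qed.

Lemma normalizing_Inl_inv G T t : wt G (Inl T t) -> normalizing G (Inl T t) -> normalizing G t.
Proof.
move=> hw [n hn hi]; have [c /congP [m -> hc] [e|[v hv]]] := steps_head hw hn; last by inversion hv.
by subst n; move/irreducibleP: hi => [/= hi _]; exists m.
Qed.

Lemma normalizing_Inr_inv G T t : wt G (Inr T t) -> normalizing G (Inr T t) -> normalizing G t.
Proof.
move=> hw [n hn hi]; have [c /congP [m -> hc] [e|[v hv]]] := steps_head hw hn; last by inversion hv.
by subst n; move/irreducibleP: hi => [/= hi _]; exists m.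
Qed.

Lemma normalizing_Inl G T t : normalizing G t -> normalizing G (Inl T t).
Proof. by case=> n h1 h2; exists (Inl T n); [exact: steps_Inl | exact: irreducible_Inl]. Qed.

Lemma normalizing_Inr G T t : normalizing G t -> normalizing G (Inr T t).
Proof. by case=> n h1 h2; exists (Inr T n); [exact: steps_Inr | exact: irreducible_Inr]. Qed.

Lemma normalizing_pm_head b G t u : wt G (plusminus b t u) ->
  normalizing G (plusminus b t u) ->
  exists t' u', [/\ steps G t t', steps G u u' & (irreducible G t' /\ irreducible G u') \/
    exists2 v, contr G (plusminus b t' u') v & normalizing G v].
Proof.
move=> hw [n hn hi]; have [c' hc hd] := steps_head hw hn.
have [t' [u' [e ht hu]]] := cong_pm_inv hc; subst c'.
exists t', u'; split=> //; case: hd => [e|[v hv hvn]].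
  by left; subst n; move/irreducibleP: hi => [hi _]; case: b hi {hw hn hc}.
by right; exists v => //; exists n.
Qed.

(** Unlike an application, a sum never discards an argument: its contraction redistributes both over
    components or bodies, where the induction on the type takes over. *)
Lemma normalizing_pm_inv b T G t u : typed G (plusminus b t u) T ->
  normalizing G (plusminus b t u) -> normalizing G t /\ normalizing G u.
Proof.
elim/type_nested_ind: T G t u => [c|T1 Ts IHs|T1 T2 IH1 IH2|T1 T2 IH1 IH2] G t u h hN;
have hw := ex_intro (typed G (plusminus b t u)) _ h;
have [t' [u' [ht hu [[it iu]|[v hv hvN]]]]] := normalizing_pm_head hw hN;
try (by split; [exists t' | exists u']);
have tv := contr_typed hv (steps_typed (steps_pm b ht hu) h);
have hwv := ex_intro (typed G v) _ tv;
move: (contr_pm_inv hv) => {}hv; case: hv ht hu hvN tv hwv => [ts us hsz|W p q] ht hu hvN tv hwv;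
  try (by move/typedP: tv => /= [? []]); try (by move/typedP: tv => /= [? [? []]]).
- have IH := IHs.
  have hall := normalizing_Tup_inv hwv hvN; have tv' := typed_Tup_nth tv.
  have key i x y : onth ts i = Some x -> onth us i = Some y -> normalizing G x /\ normalizing G y.
    move=> hx hy; set l := [seq plusminus b p.1 p.2 | p <- zip ts us] in hall tv'.
    have hl : onth l i = Some (plusminus b x y) by rewrite onth_mapE onth_zip hx hy.
    have [U hU tU] := Forall2_getl tv' hl.
    move/Forall_onth: IH => /(_ _ _ hU) IH; apply: IH tU _.
    by move/Forall_onth: hall; apply; exact: hl.
  split; [apply: (normalizing_exp ht) | apply: (normalizing_exp hu)]; apply: normalizing_Tup;
    apply/Forall_onth => i x hx; have hi := onth_lt hx.
    by rewrite hsz in hi; have [y hy] := lt_onth hi; case: (key i x y).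
  by rewrite -hsz in hi; have [y hy] := lt_onth hi; case: (key i y x).
- move/typedP: tv => [T [? e] tv]; subst W T.
  have [hp hq] := IH2 _ _ _ tv (normalizing_Lam_inv hwv hvN).
  by split; [apply: (normalizing_exp ht) | apply: (normalizing_exp hu)]; exact: normalizing_Lam.
Qed.

(** At a base point no rule substitutes into the body or drops part of it: the derivative only moves
    into components, and the exchange of variables under an abstraction is a renaming, which
    normalization reflects. *)
Lemma normalizing_Der_inv b V G q n : typed G n (TBase b) -> typed (TBase b :: G) q V ->
  normalizing G (Der q n) -> normalizing (TBase b :: G) q.
Proof.
have head G0 q0 n0 V0 : typed G0 n0 (TBase b) -> typed (TBase b :: G0) q0 V0 ->
    normalizing G0 (Der q0 n0) -> exists q' n', [/\ steps (TBase b :: G0) q0 q', steps G0 n0 n' &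
    irreducible (TBase b :: G0) q' \/
    exists2 v, contr G0 (Der q' n') v & typed G0 v V0 /\ normalizing G0 v].
  move=> hn hq [m hm hi].
  have tD : typed G0 (Der q0 n0) V0 by apply/typedP; exists V0, (TBase b).
  have [c hc hd] := steps_head (ex_intro _ _ tD) hm.
  have tc := steps_typed (cong_steps hc) tD.
  move/congP: hc tc hd => [U [q' [n' [-> hU sq sn]]]] tc hd.
  have ? := typed_uniq hU hn; subst U; exists q', n'; split=> //.
  have hn' := steps_typed sn hn.
  case: hd => [e|[v hv hvm]].
    by left; subst m; move/irreducibleP: hi => [[_ /(_ _ hn')] ].
  by right; exists v => //; split; [exact: contr_typed hv tc | exists m].
elim/type_nested_ind: V G q n => [c|T1 Ts IHs|T1 T2 IH1 IH2|T1 T2 IH1 IH2] G q n hn hq hN;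
have [q' [n' [sq sn [hi|[v hv [tv nv]]]]]] := head _ _ _ _ hn hq hN; try (by exists q');
have hn' := steps_typed sn hn; have hq' := steps_typed sq hq; have hwv := ex_intro (typed G v) _ tv;
apply: (normalizing_exp sq); have hb : isBase G n' by exists b.
all: inversion hv; subst; try (by case: (isBase_Tup hb)); try (by move/typedP: hq' => /= [? []]);
  try (by move/typedP: hq' => /= [? [? []]]).
- have IH := IHs.
  apply: normalizing_Tup; apply/Forall_onth => i x hx.
  have [U hU tx] := Forall2_getl (typed_Tup_nth hq') hx.
  move/Forall_onth: IH => /(_ _ _ hU) IH; apply: IH hn' tx _.
  have /Forall_onth := normalizing_Tup_inv hwv nv; apply.
  exact: onth_map_some hx.
- move/typedP: hq' => [T' [? e] hq']; subst.
  apply: normalizing_Lam.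
  have := normalizing_Lam_inv hwv nv.
  move/(IH2 _ _ _ (typed_shift _ hn') (typed_swap hq')) => h.
  by apply: normalizing_unrename h; [case=> [|[|i]] | exists T'].
- move/typedP: hq' => [T' [? e] hq']; subst; apply: normalizing_Inl.
  exact: IH1 hn' hq' (normalizing_Inl_inv hwv nv).
- move/typedP: hq' => [T' [? e] hq']; subst; apply: normalizing_Inr.
  exact: IH2 hn' hq' (normalizing_Inr_inv hwv nv).
Qed.

(** The argument for derivatives applies, and the limits are copied into the components, so they are
    recovered as well. *)
Lemma normalizing_Int_inv b T G a1 a2 d : typed G a1 (TBase b) ->
  typed G (Int a1 a2 d) T -> normalizing G (Int a1 a2 d) ->
  [/\ normalizing G a1, normalizing G a2 & normalizing (TBase b :: G) d].
Proof.
have head G0 x0 y0 d0 T0 : typed G0 x0 (TBase b) -> typed G0 (Int x0 y0 d0) T0 ->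
    normalizing G0 (Int x0 y0 d0) -> exists x y d, [/\ steps G0 x0 x, steps G0 y0 y,
    steps (TBase b :: G0) d0 d & [/\ irreducible G0 x, irreducible G0 y & irreducible (TBase b :: G0) d] \/
    exists2 v, contr G0 (Int x y d) v & [/\ typed G0 x (TBase b), typed (TBase b :: G0) d T0, typed G0 v T0 & normalizing G0 v]].
  move=> hn tD [m hm hi].
  have [c hc hd] := steps_head (ex_intro _ _ tD) hm.
  have tc := steps_typed (cong_steps hc) tD.
  move/congP: hc tc hd => [U [x [y [d' [-> [hU hU'] sx sy sd]]]]] tc hd.
  have ? := typed_uniq hU hn; subst U; exists x, y, d'; split=> //.
  have hx := steps_typed sx hn; have hy := steps_typed sy hU'.
  case: hd => [e|[v hv hvm]].
    by left; subst m; move/irreducibleP: hi => [[? ? /(_ _ hx hy)]].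
  right; exists v => //; split=> //; [|exact: contr_typed hv tc|by exists m].
  by move/typedP: tc => [U [_ _ /(typed_uniq hx) <-]].
elim/type_nested_ind: T G a1 a2 d => [c|T1 Ts IHs|T1 T2 IH1 IH2|T1 T2 IH1 IH2] G a1 a2 d h1 h hN;
have [x [y [d' [sx sy sd [[ix iy id]|[v hv [tx td tv nv]]]]]]] := head _ _ _ _ _ h1 h hN;
try (by split; [exists x | exists y | exists d']);
have hb : isBase G x by exists b.
all: have hwv := ex_intro (typed G v) _ tv; have [_ [ha _ _ _ _]] := (typedP _ _ _).1 h.
all: suff : [/\ normalizing G x, normalizing G y & normalizing (TBase b :: G) d'] by
  case=> *; split; [apply: (normalizing_exp sx) | apply: (normalizing_exp sy) | apply: (normalizing_exp sd)].
all: inversion hv; subst; try (by case: (isBase_Tup hb)); try (by move/typedP: td => /= [? []]);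
  try (by move/typedP: td => /= [? [? []]]).
- have IH := IHs.
  have hall := normalizing_Tup_inv hwv nv.
  have key i z : onth ts i = Some z -> [/\ normalizing G x, normalizing G y & normalizing (TBase b :: G) z].
    move=> hz; have hz' := onth_map_some (fun t => Int x y t) hz.
    have [U hU tU] := Forall2_getl (typed_Tup_nth tv) hz'.
    move/Forall_onth: IH => /(_ _ _ hU) IH; apply: IH tx tU _.
    by move/Forall_onth: hall; apply; exact: hz'.
  (* A tuple has a first component, and the integral of that one already shows that the limits
     normalize. *)
  have [z0 hz0 _] := Forall2_getr (typed_Tup_nth td) (erefl : onth (T1 :: Ts) 0 = Some T1).
  have [? ? _] := key _ _ hz0; split=> //.
  by apply: normalizing_Tup; apply/Forall_onth => i z /key [].
- move/typedP: (td) => [T' [? e] td']; subst.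
  move/typedP: (tv) => [T'' [e] tv']; subst.
  have [q1 q2 q3] := IH2 _ _ _ _ (typed_shift _ tx) tv' (normalizing_Lam_inv hwv nv).
  have hty : wt G y by case: H4 => c hc; exists (TBase c).
  split; [| |apply: normalizing_Lam].
  + by apply: normalizing_unrename q1; [exact: ren_succ | exists (TBase b)].
  + by apply: normalizing_unrename q2; [exact: ren_succ |].
  + by apply: normalizing_unrename q3; [case=> [|[|i]] | eexists; exact: td'].
Qed.
End NormalizationInversion.

(** * Observational equality of closed terms and telescoping *)

Section SemanticEquality.
Context {S : signature} {M : interpretation S}.
Implicit Types (t u v m n : term S) (s : nat -> term S) (r : nat -> nat).
Implicit Types (T U : type (base S)) (G D : seq (type (base S))).

(** Partial inverse of [ity], by which [sem_eq] recognizes the types compared by evaluation. *)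
Fixpoint itype_of T : option (itype (base S)) :=
  match T with
  | TBase b => Some (IBase b)
  | TArr T1 T2 =>
      if itype_of T1 is Some A1 then omap (IArr A1) (itype_of T2) else None
  | _ => None
  end.

Lemma itype_of_ity A : itype_of (ity A) = Some A.
Proof. by elim: A => //= A1 -> A2 ->. Qed.

Lemma itype_ofK T A : itype_of T = Some A -> T = ity A.
Proof.
elim/type_nested_ind: T A => //= [b A [<-] //|T1 T2 IH1 IH2 A].
case: (itype_of T1) IH1 => // A1 /(_ _ erefl) ->.
by case: (itype_of T2) IH2 => //= A2 /(_ _ erefl) -> [<-].
Qed.

Definition interp_eq A m n := exists p q (v : dom M A),
  [/\ steps [::] m p /\ nf [::] p, steps [::] n q /\ nf [::] q,
   eval [::] p v & eval [::] q v].

(* Unlike [closed_eq], it observes terms by projection and application only, which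
   makes it invariant under conversion. *)
Fixpoint sem_eq T m n {struct T} : Prop :=
  if itype_of T is Some A then interp_eq A m n else
  match T with
  | TTup T1 Ts => [/\ normalizing [::] m, normalizing [::] n &
      sem_eq T1 (Proj 0 m) (Proj 0 n) /\
      (fix go j Ts {struct Ts} := if Ts is T :: Ts then
         sem_eq T (Proj j m) (Proj j n) /\ go j.+1 Ts else True) 1 Ts]
  | TArr T1 T2 => [/\ normalizing [::] m, normalizing [::] n &
      forall u, typed [::] u T1 -> normalizing [::] u ->
        sem_eq T2 (App m u) (App n u)]
  | _ => False
  end.

Lemma sem_eq_interp A m n : sem_eq (ity A) m n <-> interp_eq A m n.
Proof. by case: A => [b|A1 A2] //=; rewrite !itype_of_ity. Qed.

Lemma sem_eq_Tup T1 Ts m n : sem_eq (TTup T1 Ts) m n <->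
  [/\ normalizing [::] m, normalizing [::] n &
   forall j T, onth (T1 :: Ts) j = Some T -> sem_eq T (Proj j m) (Proj j n)].
Proof.
have H k Us : (fix go j Ts {struct Ts} := if Ts is T :: Ts then
    sem_eq T (Proj j m) (Proj j n) /\ go j.+1 Ts else True) k Us <->
    forall j T, onth Us j = Some T -> sem_eq T (Proj (k + j) m) (Proj (k + j) n).
  elim: Us k => [|U Us IH] k; first by split=> // _ [].
  split=> [[h /IH h'] [|j] T /= hj|h].
  - by case: hj => <-; rewrite addn0.
  - by rewrite addnS -addSn; exact: h'.
  - split; first by have := h 0 U erefl; rewrite addn0.
    by apply/IH => j T hj; rewrite addSn -addnS; exact: (h j.+1).
split=> [/= [h1 h2 [h3 /H h4]]|[h1 h2 h3]].
  by split=> // -[|j] T /= hj; [case: hj => <- | exact: (h4 j)].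
by split=> //; split; [exact: (h3 0) | apply/H => j T hj; exact: (h3 j.+1)].
Qed.

Lemma sem_eq_Arr T1 T2 m n : itype_of (TArr T1 T2) = None ->
  sem_eq (TArr T1 T2) m n <->
  [/\ normalizing [::] m, normalizing [::] n &
   forall u, typed [::] u T1 -> normalizing [::] u -> sem_eq T2 (App m u) (App n u)].
Proof. by move=> /= e; rewrite e. Qed.

Lemma sem_eq_sym T m n : sem_eq T m n -> sem_eq T n m.
Proof.
elim/type_nested_ind: T m n => [b|T1 Ts IHs|T1 T2 IH1 IH2|//] m n.
- by move=> [p [q [v [h1 h2 h3 h4]]]]; exists q, p, v.
- move=> /sem_eq_Tup [h1 h2 h3]; apply/sem_eq_Tup; split=> // j T hj.
  have /Forall_onth IH := IHs.
  exact: IH hj _ _ (h3 _ _ hj).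
- case e: (itype_of (TArr T1 T2)) => [A|].
    rewrite (itype_ofK e) => /sem_eq_interp [p [q [v [h1 h2 h3 h4]]]].
    by apply/sem_eq_interp; exists q, p, v.
  move=> /(sem_eq_Arr _ _ e) [h1 h2 h3]; apply/(sem_eq_Arr _ _ e); split=> // u hu nu.
  exact: IH2 (h3 _ hu nu).
Qed.

Lemma join_normalizing G t u : wt G t -> join (@steps S) G t u -> normalizing G t -> normalizing G u.
Proof.
by move=> hw [v h1 h2] /(normalizing_red_step hw h1); exact: normalizing_exp.
Qed.

Lemma join_sym G t u : join (@steps S) G t u -> join (@steps S) G u t.
Proof. by case=> v h1 h2; exists v. Qed.

Lemma join_steps G t u : steps G t u -> join (@steps S) G t u.
Proof. by move=> h; exists u => //; exact: steps_refl. Qed.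

Lemma steps_Proj G j t u : steps G t u -> steps G (Proj j t) (Proj j u).
Proof. by move=> h; apply: cong_steps; constructor. Qed.

Lemma steps_App G t t' u : steps G t t' -> steps G (App t u) (App t' u).
Proof. by move=> h; apply: cong_steps; constructor=> //; exact: steps_refl. Qed.

(** By confluence joinable terms share their normal form, and a common reduct persists under
    projections and applications. *)
Lemma sem_eq_convl T m m' n : typed [::] m T -> join (@steps S) [::] m m' ->
  sem_eq T m n -> sem_eq T m' n.
Proof.
elim/type_nested_ind: T m m' n => [b|T1 Ts IHs|T1 T2 IH1 IH2|//] m m' n hm hj h.
- have [k hk hk'] := hj; have hw := ex_intro (typed [::] m) _ hm.
  case: h => p [q [v [[s1 n1] h2 h3 h4]]]; exists p, q, v; split=> //; split=> //.
  apply: steps_trans hk' (steps_irreducible hw _ s1 hk).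
  exact: nf_irreducible (steps_wt s1 hw) n1.
- have hw := ex_intro (typed [::] m) _ hm.
  move: h => /sem_eq_Tup [h1 h2 h3]; apply/sem_eq_Tup; split=> //; first exact: join_normalizing hw hj h1.
  move=> j T hT.
  have /Forall_onth IH := IHs.
  apply: (IH _ _ hT) (h3 _ _ hT); first by apply/typedP; exists T1, Ts.
  by case: hj => k s1 s2; exists (Proj j k); exact: steps_Proj.
- have hw := ex_intro (typed [::] m) _ hm.
  case e: (itype_of (TArr T1 T2)) => [A|].
    rewrite (itype_ofK e) in h *; apply/sem_eq_interp.
    case/sem_eq_interp: h => p [q [v [[s1 n1] h2 h3 h4]]]; exists p, q, v; split=> //; split=> //.
    have [k hk hk'] := hj; apply: steps_trans hk' (steps_irreducible hw _ s1 hk).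
    exact: nf_irreducible (steps_wt s1 hw) n1.
  move: h => /(sem_eq_Arr _ _ e) [h1 h2 h3]; apply/(sem_eq_Arr _ _ e); split=> //.
    exact: join_normalizing hw hj h1.
  move=> u hu nu; apply: IH2 (h3 _ hu nu); first by apply/typedP; exists T1.
  by case: hj => k s1 s2; exists (App k u); exact: steps_App.
Qed.

Lemma sem_eq_conv T m m' n n' : typed [::] m T -> typed [::] n T ->
  join (@steps S) [::] m m' -> join (@steps S) [::] n n' ->
  sem_eq T m n -> sem_eq T m' n'.
Proof.
move=> hm hn jm jn /(sem_eq_convl hm jm) /sem_eq_sym /(sem_eq_convl hn jn).
exact: sem_eq_sym.
Qed.

Lemma normalizing_nf t T : typed [::] t T -> normalizing [::] t ->
  exists n, [/\ steps [::] t n, nf [::] n & typed [::] n T].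
Proof.
move=> ht [n hn hi]; have tn := steps_typed hn ht; exists n; split=> //.
exact: irreducible_nf (@ictx_nil S) tn hi.
Qed.

(** A stuck normal form would have an interpretable type, so at tuple type only tuples remain. *)
Lemma normalizing_Tup_nf G t T1 Ts : ictx G -> typed G t (TTup T1 Ts) -> normalizing G t ->
  exists ts, [/\ steps G t (Tup ts), List.Forall (irreducible G) ts &
    List.Forall2 (typed G) ts (T1 :: Ts)].
Proof.
move=> hG ht [n hn hi]; have tn := steps_typed hn ht.
have hv := not_interpretable (irreducible_nf hG tn hi) tn.
have {}hv : is_value n by apply: hv => -[[]].
have [ts e] := value_type hv tn; subst n; exists ts; split=> //; last exact: typed_Tup_nth.
by case/irreducibleP: hi.
Qed.

Lemma normalizing_Lam_nf G t T1 T2 : ictx G -> itype_of (TArr T1 T2) = None ->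
  typed G t (TArr T1 T2) -> normalizing G t ->
  exists p, [/\ steps G t (Lam T1 p), irreducible (T1 :: G) p & typed (T1 :: G) p T2].
Proof.
move=> hG hT ht [n hn hi]; have tn := steps_typed hn ht.
have hv := not_interpretable (irreducible_nf hG tn hi) tn.
have {}hv : is_value n by apply: hv => -[A eA]; rewrite eA itype_of_ity in hT.
have [p e] := value_type hv tn; subst n; exists p; split=> //.
  by case/irreducibleP: hi.
by move/typedP: tn => [? [<-]].
Qed.

(** [closed_eq] compares parts of normal forms. Projections or applications of [m] and [n] convert
    to those of their normal forms, so the observations of [sem_eq] transfer. *)
Lemma sem_eq_closed T m n : typed [::] m T -> typed [::] n T -> sem_eq T m n -> closed_eq M m n.
Proof.
have interp A m' n' : typed [::] m' (ity A) -> typed [::] n' (ity A) -> interp_eq A m' n' ->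
    closed_eq M m' n'.
  move=> hm hn [p [q [v [[s1 n1] [s2 n2] e1 e2]]]].
  by apply: (closed_eq_nf s1 n1 s2 n2);
    exact: nf_eq_interp (steps_typed s1 hm) (steps_typed s2 hn) e1 e2.
elim/type_nested_ind: T m n => [b|T1 Ts IHs|T1 T2 IH1 IH2|//] m n hm hn h.
- exact: (interp (IBase b)).
- move/sem_eq_Tup: (h) => [h1 h2 h3].
  have [ps [s1 i1 t1]] := normalizing_Tup_nf (@ictx_nil S) hm h1.
  have [qs [s2 i2 t2]] := normalizing_Tup_nf (@ictx_nil S) hn h2.
  have nfl l : List.Forall (irreducible [::]) l -> List.Forall2 (typed [::]) l (T1 :: Ts) ->
      nf [::] (Tup l).
    move=> /Forall_onth hi ht; apply: nf_Tup; apply/Forall_onth => i x hx.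
    have [U _ hU] := Forall2_getl ht hx.
    exact: (irreducible_nf (@ictx_nil S) hU (hi _ _ hx)).
  apply: (closed_eq_nf s1 (nfl _ i1 t1) s2 (nfl _ i2 t2)); apply: nf_eq_Tup.
  apply/Forall2_onth; split; first by rewrite (Forall2_size t1) (Forall2_size t2).
  move=> j x y hx hy; have [T hT tx] := Forall2_getl t1 hx.
  have ty := Forall2_get t2 hy hT.
  have /Forall_onth IH := IHs.
  apply: (IH _ _ hT) tx ty _.
  apply: (sem_eq_conv _ _ _ _ (h3 _ _ hT)); try (by apply/typedP; exists T1, Ts).
    by apply: join_steps; apply: steps_step (steps_Proj j s1) _; apply: S_Proj.
  by apply: join_steps; apply: steps_step (steps_Proj j s2) _; apply: S_Proj.
- case e: (itype_of (TArr T1 T2)) => [A|].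
    by rewrite (itype_ofK e) in hm hn h; apply: interp hm hn _; apply/sem_eq_interp.
  move: h => /(sem_eq_Arr _ _ e) [h1 h2 h3].
  have [p [s1 i1 t1]] := normalizing_Lam_nf (@ictx_nil S) e hm h1.
  have [q [s2 i2 t2]] := normalizing_Lam_nf (@ictx_nil S) e hn h2.
  apply: (closed_eq_nf s1 (nf_Lam i1) s2 (nf_Lam i2)); apply: nf_eq_Lam => u hu wu.
  have nu := weak_normalizable_normalizing (ex_intro _ _ hu) wu.
  have tm := steps_typed s1 hm; have tn := steps_typed s2 hn.
  apply: IH2; try (by apply/typedP; exists T1).
  apply: (sem_eq_conv _ _ _ _ (h3 _ hu nu)); try (by apply/typedP; exists T1).
    by apply: join_steps; exact: steps_App.
  by apply: join_steps; exact: steps_App.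
Qed.

Context (HM : base_laws M).

(** At base types [z] is rewritten as (z - y) + ((y - x) + x) and the last [x] cancels; at function
    types the claim is pointwise. *)
Lemma telescope_val A (x y z : dom M A) :
  Defs.add (Defs.sub y x) (Defs.sub z y) = Defs.sub z x.
Proof.
elim: A x y z => [b|A1 _ A2 IH] x y z; last first.
  by apply: (app_ext HM) => d; rewrite (app_add HM) !(app_sub HM).
rewrite -[in RHS](base_subK HM z y) -[in X in Defs.sub (Defs.add _ X) _](base_subK HM y x).
by rewrite (base_addA HM) (base_addK HM) (base_addC HM).
Qed.

Lemma normalizing_pm b T G t u : addable T -> typed G t T -> typed G u T ->
  normalizing G t -> normalizing G u -> normalizing G (plusminus b t u).
Proof.
move=> ha ht hu nt nu; apply: red_normalizing (red_pm b ha _ _).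
  exact: normalizing_red ht nt.
exact: normalizing_red hu nu.
Qed.

Lemma interp_pm b A t u nt nu (v w : dom M A) : typed [::] t (ity A) -> typed [::] u (ity A) ->
  steps [::] t nt -> nf [::] nt -> eval [::] nt v ->
  steps [::] u nu -> nf [::] nu -> eval [::] nu w ->
  exists n, [/\ steps [::] (plusminus b t u) n, nf [::] n & eval [::] n (addsub b v w)].
Proof.
move=> ht hu st ft et su fu eu.
have [n [h1 h2 h3]] := pm_nf HM b (@ictx_nil S) ft fu (steps_typed st ht) (steps_typed su hu).
exists n; split=> //; first exact: steps_trans (steps_pm b st su) h1.
exact: (h3 [::]).
Qed.

Lemma nf_uniq t n n' : wt [::] t -> steps [::] t n -> nf [::] n -> steps [::] t n' -> nf [::] n' -> n = n'.
Proof.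
move=> hw s1 f1 s2 f2.
have i1 := nf_irreducible (steps_wt s1 hw) f1; have i2 := nf_irreducible (steps_wt s2 hw) f2.
exact: (irreducible_steps i2 (steps_irreducible hw i1 s1 s2)).
Qed.

(** Normalization turns both arguments into tuples; then either side reduces to the combination of
    the j-th components. *)
Lemma join_Proj_pm b G T1 Ts j t u T : ictx G -> typed G t (TTup T1 Ts) -> typed G u (TTup T1 Ts) ->
  normalizing G t -> normalizing G u -> onth (T1 :: Ts) j = Some T ->
  join (@steps S) G (Proj j (plusminus b t u)) (plusminus b (Proj j t) (Proj j u)).
Proof.
move=> hG ht hu nt nu hj.
have [ts [st _ tt]] := normalizing_Tup_nf hG ht nt.
have [us [su _ tu]] := normalizing_Tup_nf hG hu nu.
have [x hx _] := Forall2_getr tt hj; have [y hy _] := Forall2_getr tu hj.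
have hsz : size ts = size us by rewrite (Forall2_size tt) (Forall2_size tu).
exists (plusminus b x y).
  apply: steps_trans (steps_Proj j (steps_pm b st su)) _.
  apply: steps_trans (steps_Proj j (steps_contr (contr_pm_Tup b G hsz))) _.
  by apply: steps_contr; constructor; rewrite onth_mapE onth_zip hx hy.
apply: steps_pm; [apply: steps_step (steps_Proj j st) _ | apply: steps_step (steps_Proj j su) _];
  exact: S_Proj.
Qed.

Lemma join_App_pm b G T1 T2 x t u : ictx G -> itype_of (TArr T1 T2) = None ->
  typed G t (TArr T1 T2) -> typed G u (TArr T1 T2) -> normalizing G t -> normalizing G u ->
  join (@steps S) G (App (plusminus b t u) x) (plusminus b (App t x) (App u x)).
Proof.
move=> hG e ht hu nt nu.
have [p [st _ _]] := normalizing_Lam_nf hG e ht nt.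
have [q [su _ _]] := normalizing_Lam_nf hG e hu nu.
exists (plusminus b (inst p x) (inst q x)).
  apply: steps_trans (steps_App x (steps_pm b st su)) _.
  apply: steps_trans (steps_App x (steps_contr (contr_pm_Lam b G T1 p q))) _.
  by apply: steps_contr; rewrite /inst -subst_pm; constructor.
apply: steps_pm; [apply: steps_step (steps_App x st) _ | apply: steps_step (steps_App x su) _];
  exact: S_Beta.
Qed.

Lemma normalizing_Proj G t j T1 Ts T : typed G t (TTup T1 Ts) -> normalizing G t ->
  onth (T1 :: Ts) j = Some T -> normalizing G (Proj j t).
Proof. by move=> ht nt hj; apply: red_normalizing (red_Proj (normalizing_red ht nt) hj). Qed.

Lemma normalizing_App G t u T1 T2 : typed G t (TArr T1 T2) -> normalizing G t ->
  typed G u T1 -> normalizing G u -> normalizing G (App t u).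
Proof.
move=> ht nt hu nu.
exact: red_normalizing (red_App (normalizing_red ht nt) (normalizing_red hu nu)).
Qed.

(** Normal forms are unique, so the normal forms given for the two differences are those computed
    from [a], [b], [c], and their values are differences of three fixed values. *)
Lemma sem_eq_telescope_interp A x y a b c :
  typed [::] x (ity A) -> typed [::] y (ity A) ->
  typed [::] a (ity A) -> typed [::] b (ity A) -> typed [::] c (ity A) ->
  normalizing [::] a -> normalizing [::] b -> normalizing [::] c ->
  sem_eq (ity A) x (Minus b a) -> sem_eq (ity A) y (Minus c b) ->
  sem_eq (ity A) (Plus x y) (Minus c a).
Proof.
move=> tx ty ta tb tc na nb nc /sem_eq_interp [p [q [v [[s1 f1] [s2 f2] e1 e2]]]].
move=> /sem_eq_interp [p' [q' [v' [[s1' f1'] [s2' f2'] e1' e2']]]]; apply/sem_eq_interp.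
have ev t : typed [::] t (ity A) -> normalizing [::] t ->
    exists n (w : dom M A), [/\ steps [::] t n, nf [::] n & eval [::] n w].
  move=> ht /(normalizing_nf ht) [n [h1 h2 h3]].
  have [w hw] := nf_eval HM (rho := [::]) h2 h3; by exists n, w.
have [na' [va [sa fa ea]]] := ev _ ta na; have [nb' [vb [sb fb eb]]] := ev _ tb nb.
have [nc' [vc [sc fc ec]]] := ev _ tc nc.
have [k1 [g1 g2 g3]] := interp_pm false tb ta sb fb eb sa fa ea.
have [k2 [g4 g5 g6]] := interp_pm false tc tb sc fc ec sb fb eb.
have [k3 [g7 g8 g9]] := interp_pm false tc ta sc fc ec sa fa ea.
have [k4 [g10 g11 g12]] := interp_pm true tx ty s1 f1 e1 s1' f1' e1'.
have t1 := typed_pm false (addable_ity A) tb ta; have t2 := typed_pm false (addable_ity A) tc tb.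
have ? : q = k1 by apply: nf_uniq s2 f2 g1 g2; exists (ity A).
have ? : q' = k2 by apply: nf_uniq s2' f2' g4 g5; exists (ity A).
subst k1 k2.
exists k4, k3, (Defs.sub vc va); split=> //.
have ev1 : v = Defs.sub vb va := eval_det HM (rho := [::]) (steps_typed g1 t1) e2 g3.
have ev2 : v' = Defs.sub vc vb := eval_det HM (rho := [::]) (steps_typed g4 t2) e2' g6.
by rewrite -(telescope_val va vb vc) -ev1 -ev2.
Qed.

(** Addition and subtraction commute with projections and applications up to a common reduct, so the
    observations bring the claim down to interpretable types. *)
Lemma sem_eq_telescope T x y a b c : addable T ->
  typed [::] x T -> typed [::] y T -> typed [::] a T -> typed [::] b T -> typed [::] c T ->
  normalizing [::] x -> normalizing [::] y ->
  normalizing [::] a -> normalizing [::] b -> normalizing [::] c ->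
  sem_eq T x (Minus b a) -> sem_eq T y (Minus c b) -> sem_eq T (Plus x y) (Minus c a).
Proof.
elim/type_nested_ind: T x y a b c => [k|T1 Ts IHs|T1 T2 IH1 IH2|//] x y a b c
  hA tx ty ta tb tc nx ny na nb nc hx hy.
- exact: (@sem_eq_telescope_interp (IBase k) _ _ _ _ _ tx ty ta tb tc na nb nc hx hy).
- move/sem_eq_Tup: (hx) => [_ nm hx']; move/sem_eq_Tup: (hy) => [_ nm' hy'].
  have hs := @ictx_nil S.
  apply/sem_eq_Tup; split; [exact: (normalizing_pm true hA) | exact: (normalizing_pm false hA) |].
  move=> j T hT.
  have hAT : addable T by apply: (@all_onth _ _ (T1 :: Ts) j).
  have tp t : typed [::] t (TTup T1 Ts) -> typed [::] (Proj j t) T.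
    by move=> ht; apply/typedP; exists T1, Ts.
  have np t : typed [::] t (TTup T1 Ts) -> normalizing [::] t -> normalizing [::] (Proj j t).
    by move=> ht nt; apply: normalizing_Proj ht nt hT.
  have /Forall_onth IH := IHs.
  apply: (sem_eq_conv _ _ (join_sym (join_Proj_pm true hs tx ty nx ny hT))
                          (join_sym (join_Proj_pm false hs tc ta nc na hT))).
  + by apply: (typed_pm true) => //; exact: tp.
  + by apply: (typed_pm false) => //; exact: tp.
  apply: (IH _ _ hT _ _ _ (Proj j b)) => //; try exact: tp; try exact: np.
  + apply: sem_eq_conv (hx' _ _ hT) => //; [exact: tp | exact: (tp _ (typed_pm false hA tb ta)) | |].
      by apply: join_steps; exact: steps_refl.
    exact: (join_Proj_pm false hs tb ta nb na hT).
  + apply: sem_eq_conv (hy' _ _ hT) => //; [exact: tp | exact: (tp _ (typed_pm false hA tc tb)) | |].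
      by apply: join_steps; exact: steps_refl.
    exact: (join_Proj_pm false hs tc tb nc nb hT).
- case e: (itype_of (TArr T1 T2)) => [A|].
    rewrite (itype_ofK e) in tx ty ta tb tc hx hy *.
    exact: (@sem_eq_telescope_interp A _ _ _ _ _ tx ty ta tb tc na nb nc hx hy).
  move: (hx) => /(sem_eq_Arr _ _ e) [_ nm hx']; move: (hy) => /(sem_eq_Arr _ _ e) [_ nm' hy'].
  have hs := @ictx_nil S.
  apply/(sem_eq_Arr _ _ e); split; [exact: (normalizing_pm true hA) | exact: (normalizing_pm false hA) |].
  move=> u hu nu.
  have tp t : typed [::] t (TArr T1 T2) -> typed [::] (App t u) T2.
    by move=> ht; apply/typedP; exists T1.
  have np t : typed [::] t (TArr T1 T2) -> normalizing [::] t -> normalizing [::] (App t u).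
    by move=> ht nt; apply: normalizing_App ht nt hu nu.
  apply: (sem_eq_conv _ _ (join_sym (join_App_pm true u hs e tx ty nx ny))
                          (join_sym (join_App_pm false u hs e tc ta nc na))).
  + by apply: (typed_pm true) => //; exact: tp.
  + by apply: (typed_pm false) => //; exact: tp.
  apply: (IH2 _ _ _ (App b u)) => //; try exact: tp; try exact: np.
  + apply: sem_eq_conv (hx' _ hu nu) => //; [exact: tp | exact: (tp _ (typed_pm false hA tb ta)) | |].
      by apply: join_steps; exact: steps_refl.
    exact: (join_App_pm false u hs e tb ta nb na).
  + apply: sem_eq_conv (hy' _ hu nu) => //; [exact: tp | exact: (tp _ (typed_pm false hA tc tb)) | |].
      by apply: join_steps; exact: steps_refl.
    exact: (join_App_pm false u hs e tc tb nc nb).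
Qed.
End SemanticEquality.

(** * The formula for closed limits *)

Section NewtonLeibniz.
Context {S : signature} {M : interpretation S} (HM : base_laws M).
Implicit Types (t u v m n p : term S) (s : nat -> term S) (r : nat -> nat).
Implicit Types (T U : type (base S)) (G D : seq (type (base S))).

Lemma steps_inst G t t' u u' T U : typed (U :: G) t T -> typed G u U ->
  steps (U :: G) t t' -> steps G u u' -> steps G (inst t u) (inst t' u').
Proof.
move=> ht hu st su; apply: (@steps_trans _ _ _ (inst t' u)).
  by apply: steps_subst st; exact: tsub_scons (@tsub_id _ G).
have ht' := steps_typed st ht.
elim: su => [|v w hv IH hs]; first exact: steps_refl.
(* One step of [u] becomes many, one for each occurrence in [t'], possibly under binders; parallel
   reduction performs them together. *)
have tv := steps_typed hv hu; apply: steps_trans IH (par_steps _).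
apply: (par_inst tv); try (by exists T); first by apply: par_refl; exists T.
by apply: step_par => //; exists U.
Qed.

Lemma red_inst G t u T U : typed (U :: G) t T -> fixfree t -> red U G u -> red T G (inst t u).
Proof. by move=> ht hf hu; apply: red_subst ht hf _ => -[|i] W /=; [case=> <- | exact: red_Var]. Qed.

(** Instantiation may create new redexes, but the normal form of [t] is fix-free, so the fundamental
    lemma covers its instance at a reducible argument. *)
Lemma normalizing_inst G t u T U : typed (U :: G) t T -> normalizing (U :: G) t ->
  typed G u U -> normalizing G u -> normalizing G (inst t u).
Proof.
move=> ht [n hn hi] hu nu; have tn := steps_typed hn ht.
apply: (normalizing_exp (steps_inst ht hu hn (steps_refl _ _))).
apply: red_normalizing (red_inst tn (irreducible_fixfree tn hi) (normalizing_red hu nu)).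
Qed.

(** The derivative of [t] has type [dty V U] and the integral expects [dty T U]; injectivity of
    [dty] identifies [V] with [T]. *)
Lemma typed_int_derE G a1 a2 t T : typed G (int_der a1 a2 t) T <->
  exists U, [/\ addable T, diffable U, typed G a1 U, typed G a2 U & typed (U :: G) t T].
Proof.
split=> [/typedP [U [hA hd h1 h2 h]]|[U [hA hd h1 h2 h]]].
  exists U; split=> //; move/typedP: h => [V [W [e _ /typedP /= [?] h]]]; subst W.
  by rewrite (dty_inj hd e); apply: typed_unrename h => -[|i].
apply/typedP; exists U; split=> //; apply/typedP; exists T, U; split=> //; first by apply/typedP.
exact: typed_avoid.
Qed.

Lemma steps_int_der G a1 a1' a2 a2' t t' T : typed G (int_der a1 a2 t) T ->
  (forall U, typed G a1 U -> steps (U :: G) t t') -> steps G a1 a1' -> steps G a2 a2' ->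
  steps G (int_der a1 a2 t) (int_der a1' a2' t').
Proof.
move=> /typed_int_derE [U [hA hd h1 h2 h]] st s1 s2.
apply: cong_steps; apply: (K_Int h1 h2) => //; apply: cong_steps.
apply: (K_Der (U := U)); [by apply/typedP | | exact: steps_refl].
by apply: steps_rename (st _ h1); apply: ren_up.
Qed.

Lemma normalizing_int_der b G a1 a2 t T : typed G (int_der a1 a2 t) T -> typed G a1 (TBase b) ->
  normalizing G a1 -> normalizing G a2 -> normalizing (TBase b :: G) t ->
  normalizing G (int_der a1 a2 t).
Proof.
move=> h h1 [n1 s1 i1] [n2 s2 i2] [p sp ip].
have hs : steps G (int_der a1 a2 t) (int_der n1 n2 p).
  by apply: (steps_int_der h) => // U hU; rewrite (typed_uniq hU h1).
apply: (normalizing_exp hs); have h' := steps_typed hs h.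
have /typed_int_derE [U [hA hd q1 q2 q3]] := h'.
have ? := typed_uniq q1 (steps_typed s1 h1); subst U.
apply: (fixfree_normalizing h'); rewrite /int_der /= andbT.
rewrite (irreducible_fixfree q1 i1) (irreducible_fixfree q2 i2) /=.
have hr := ren_up (T := TBase b) (@ren_succ _ (TBase b) G).
apply: (irreducible_fixfree (typed_rename hr q3)).
by apply: irreducible_rename hr _ ip; exists T.
Qed.

Lemma join_Proj_int_der b G j a1 a2 ps p : typed G a1 (TBase b) -> typed G a2 (TBase b) ->
  onth ps j = Some p -> steps G (Proj j (int_der a1 a2 (Tup ps))) (int_der a1 a2 p).
Proof.
move=> h1 h2 hj; have hb1 : isBase G a1 by exists b.
have hb2 : isBase G a2 by exists b.
apply: (@steps_trans _ _ _ (Proj j (Tup (map (fun p => int_der a1 a2 p) ps)))).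
  apply: steps_Proj.
  apply: (@steps_trans _ _ _ (Int a1 a2 (Tup (map (fun p => Der (avoid p) (Var 0)) ps)))).
    apply: steps1; apply: C_Int3 h1 h2 _; apply: contr_step.
    have hV : isBase (TBase b :: G) (Var 0) by exists b; apply/typedP.
    by move: (R_DerTup (map avoid ps) hV); rewrite map_mapE.
  apply: steps_contr; move: (R_IntTup (map (fun p => Der (avoid p) (Var 0)) ps) hb1 hb2).
  by rewrite map_mapE.
by apply: steps_contr; constructor; rewrite onth_mapE hj.
Qed.

Lemma steps_Proj_minus G j ps a1 a2 p : onth ps j = Some p ->
  steps G (Proj j (Minus (inst (Tup ps) a2) (inst (Tup ps) a1))) (Minus (inst p a2) (inst p a1)).
Proof.
move=> hj; apply: (steps_trans (steps_Proj j (steps_contr (R_SubTup _ _)))).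
  by rewrite !size_map.
apply: steps_contr; constructor.
by rewrite onth_mapE onth_zip !onth_mapE hj.
Qed.

Lemma inst_shift_swap p u a : inst (inst (swap p) (shift a)) u = inst (inst p (shift u)) a.
Proof.
rewrite /inst /swap !subst_rename !subst_subst; apply: subst_ext => -[|[|i]] //=;
  by rewrite subst_shift subst_id.
Qed.

Lemma newton_leibniz_interp A b a1 a2 t :
  typed [::] a1 (TBase b) -> typed [::] a2 (TBase b) -> typed [:: TBase b] t (ity A) ->
  irreducible [::] a1 -> irreducible [::] a2 -> normalizing [:: TBase b] t ->
  sem_eq (M := M) (ity A) (int_der a1 a2 t) (Minus (inst t a2) (inst t a1)).
Proof.
move=> h1 h2 ht i1 i2 [p sp ip]; have tp := steps_typed sp ht; have hn := @ictx_nil S.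
have hb : ictx [:: TBase b] by exact: (@ictx_cons _ _ (IBase b) hn).
have hI : typed [::] (int_der a1 a2 t) (ity A).
  by apply/typed_int_derE; exists (TBase b); split=> //; exact: addable_ity.
have s1 : steps [::] (int_der a1 a2 t) (int_der a1 a2 p).
  by apply: (steps_int_der hI); try exact: steps_refl; move=> U hU; rewrite (typed_uniq hU h1).
have s2 : steps [::] (Minus (inst t a2) (inst t a1)) (Minus (inst p a2) (inst p a1)).
  by apply: (steps_pm false); apply: (steps_inst ht) => //; exact: steps_refl.
have [n1 [n2 [[q1 f1] [q2 f2] hev]]] := nl_nf HM hn (irreducible_nf hb tp ip) tp
  (irreducible_nf hn h1 i1) h1 (irreducible_nf hn h2 i2) h2.
have tn1 := steps_typed q1 (steps_typed s1 hI).
have [v hv] := nf_eval HM (rho := [::]) f1 tn1.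
apply/sem_eq_interp; exists n1, n2, v; split=> //.
- by split=> //; exact: steps_trans s1 q1.
- by split=> //; exact: steps_trans s2 q2.
- exact: (hev [::]).
Qed.

(** Observing both sides by a projection or an application gives the same formula for a component or
    an instantiated body, of smaller type. An instantiated body is no longer normal, which is why
    [t] is assumed to be normalizing and not irreducible. *)
Lemma newton_leibniz_base_irreducible b T a1 a2 t : addable T ->
  typed [::] a1 (TBase b) -> typed [::] a2 (TBase b) -> typed [:: TBase b] t T ->
  irreducible [::] a1 -> irreducible [::] a2 -> normalizing [:: TBase b] t ->
  sem_eq (M := M) T (int_der a1 a2 t) (Minus (inst t a2) (inst t a1)).
Proof.
have hb : ictx [:: TBase b] by exact: (@ictx_cons _ _ (IBase b) (@ictx_nil S)).
elim/type_nested_ind: T t => [c|T1 Ts IHs|T1 T2 IH1 IH2|//] t hA h1 h2 ht i1 i2 nt.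
- exact: (@newton_leibniz_interp (IBase c) _ _ _ _ h1 h2 ht i1 i2 nt).
- have hI : typed [::] (int_der a1 a2 t) (TTup T1 Ts) by apply/typed_int_derE; exists (TBase b).
  have hi1 := typed_inst ht h1; have hi2 := typed_inst ht h2.
  have hMi := typed_pm false hA hi2 hi1.
  have n1 : normalizing [::] a1 by exists a1 => //; exact: steps_refl.
  have n2 : normalizing [::] a2 by exists a2 => //; exact: steps_refl.
  have [ps [sp _ tp]] := normalizing_Tup_nf hb ht nt.
  apply/sem_eq_Tup; split.
  + exact: normalizing_int_der hI h1 n1 n2 nt.
  + by apply: (normalizing_pm false hA hi2 hi1); apply: normalizing_inst ht nt _ _.
  move=> j T hT; have [p hp hpT] := Forall2_getr tp hT.
  have hAT : addable T by apply: (@all_onth _ _ (T1 :: Ts) j).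
  have /Forall_onth IH := IHs.
  have np : normalizing [:: TBase b] p.
    have nT : normalizing [:: TBase b] (Tup ps) by apply: normalizing_red_step sp nt; exists (TTup T1 Ts).
    have /Forall_onth := normalizing_Tup_inv (ex_intro _ _ (steps_typed sp ht)) nT.
    by apply; exact: hp.
  have tI : typed [::] (int_der a1 a2 p) T by apply/typed_int_derE; exists (TBase b).
  have tM : typed [::] (Minus (inst p a2) (inst p a1)) T.
    by apply/typedP; split=> //; [exact: typed_inst hpT h2 | exact: typed_inst hpT h1].
  apply: (sem_eq_conv tI tM _ _ (IH _ _ hT p hAT h1 h2 hpT i1 i2 np)); apply: join_sym; apply: join_steps.
    apply: steps_trans (join_Proj_int_der h1 h2 hp); apply: steps_Proj.
    apply: (steps_int_der hI); try exact: steps_refl.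
    by move=> U hU; rewrite (typed_uniq hU h1).
  apply: steps_trans (steps_Proj_minus _ _ _ hp); apply: steps_Proj.
  by apply: (steps_pm false); apply: (steps_inst ht) => //; exact: steps_refl.
- case e: (itype_of (TArr T1 T2)) => [A|].
    by rewrite (itype_ofK e) in hA ht *; exact: (newton_leibniz_interp h1 h2 ht i1 i2 nt).
  have hI : typed [::] (int_der a1 a2 t) (TArr T1 T2) by apply/typed_int_derE; exists (TBase b).
  have hi1 := typed_inst ht h1; have hi2 := typed_inst ht h2.
  have hMi := typed_pm false hA hi2 hi1.
  have n1 : normalizing [::] a1 by exists a1 => //; exact: steps_refl.
  have n2 : normalizing [::] a2 by exists a2 => //; exact: steps_refl.
  have [p [sp ip tp]] := normalizing_Lam_nf hb e ht nt.
  apply/(sem_eq_Arr _ _ e); split.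
  + exact: normalizing_int_der hI h1 n1 n2 nt.
  + by apply: (normalizing_pm false hA hi2 hi1); apply: normalizing_inst ht nt _ _.
  (* Both sides applied to [u] convert to the two sides for [q], the body of [t] with its argument
     fixed. The closed [u] is shifted past the variable of integration. *)
  move=> u hu nu; set q := inst p (shift u).
  have hu' : typed [:: TBase b] (shift u) T1 by exact: typed_shift.
  have tq : typed [:: TBase b] q T2 by exact: typed_inst tp hu'.
  have nq : normalizing [:: TBase b] q.
    apply: red_normalizing (red_inst tp (irreducible_fixfree tp ip) _).
    exact: (red_rename (@ren_succ _ _ _) (normalizing_red hu nu)).
  have tI : typed [::] (int_der a1 a2 q) T2 by apply/typed_int_derE; exists (TBase b).
  have tM : typed [::] (Minus (inst q a2) (inst q a1)) T2.
    by apply/typedP; split=> //; [exact: typed_inst tq h2 | exact: typed_inst tq h1].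
  apply: (sem_eq_conv tI tM _ _ (IH2 q hA h1 h2 tq i1 i2 nq)); apply: join_sym; apply: join_steps.
    apply: (@steps_trans _ _ _ (App (Lam T1 (int_der (shift a1) (shift a2) (swap p))) u)).
      apply: steps_App; apply: steps_trans (steps_int_der_Lam T1 p h1 h2).
      apply: (steps_int_der hI); try exact: steps_refl.
      by move=> U hU; rewrite (typed_uniq hU h1).
    apply: steps_contr; rewrite (_ : int_der a1 a2 q = inst (int_der (shift a1) (shift a2) (swap p)) u).
      exact: R_Beta.
    rewrite /inst subst_int_der !subst_shift !subst_id; congr int_der.
    rewrite /q /inst /swap subst_rename; apply: subst_ext => -[|[|i]] //.
  apply: (@steps_trans _ _ _ (App (Lam T1 (Minus (inst (swap p) (shift a2)) (inst (swap p) (shift a1)))) u)).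
    apply: steps_App; apply: (@steps_trans _ _ _ (Minus (inst (Lam T1 p) a2) (inst (Lam T1 p) a1))).
      by apply: (steps_pm false); apply: (steps_inst ht) => //; exact: steps_refl.
    by rewrite !inst_Lam; apply: steps_contr; exact: R_SubLam.
  by apply: steps_contr; rewrite /q -(inst_shift_swap p u a1) -(inst_shift_swap p u a2); exact: R_Beta.
Qed.

Lemma newton_leibniz_base b T a1 a2 t : addable T ->
  typed [::] a1 (TBase b) -> typed [::] a2 (TBase b) -> typed [:: TBase b] t T ->
  normalizing [::] a1 -> normalizing [::] a2 -> normalizing [:: TBase b] t ->
  sem_eq (M := M) T (int_der a1 a2 t) (Minus (inst t a2) (inst t a1)).
Proof.
move=> hA h1 h2 ht [n1 s1 i1] [n2 s2 i2] nt.
have k1 := steps_typed s1 h1; have k2 := steps_typed s2 h2.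
have tI : typed [::] (int_der n1 n2 t) T by apply/typed_int_derE; exists (TBase b).
have tI' : typed [::] (int_der a1 a2 t) T by apply/typed_int_derE; exists (TBase b).
have tM : typed [::] (Minus (inst t n2) (inst t n1)) T.
  by apply/typedP; split=> //; [exact: typed_inst ht k2 | exact: typed_inst ht k1].
apply: (sem_eq_conv tI tM _ _ (newton_leibniz_base_irreducible hA k1 k2 ht i1 i2 nt));
  apply: join_sym; apply: join_steps.
  by apply: (steps_int_der tI') => // *; exact: steps_refl.
by apply: (steps_pm false); apply: (steps_inst ht) => //; exact: steps_refl.
Qed.

Lemma typed_bigPlus_inv G w ws T : typed G (bigPlus w ws) T ->
  typed G w T /\ List.Forall (fun x => typed G x T) ws.
Proof.
rewrite /bigPlus; elim: ws w => [|x ws IH] w /= h; first by split=> //; constructor.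
by have [/typedP [_ h1 h2] h3] := IH _ h; split=> //; constructor.
Qed.

Lemma normalizing_bigPlus_inv G w ws T : typed G (bigPlus w ws) T ->
  normalizing G (bigPlus w ws) -> normalizing G w /\ List.Forall (normalizing G) ws.
Proof.
rewrite /bigPlus; elim: ws w => [|x ws IH] w /= h hN; first by split=> //; constructor.
have [tp _] := typed_bigPlus_inv h; have [n1 n2] := IH _ h hN.
by have [n3 n4] := normalizing_pm_inv (b := true) tp n1; split=> //; constructor.
Qed.

Lemma steps_bigPlus G l l' w ws w' ws' : l = w :: ws -> l' = w' :: ws' ->
  List.Forall2 (steps G) l l' -> steps G (bigPlus w ws) (bigPlus w' ws').
Proof.
move=> -> -> /List.Forall2_cons_iff [h hs]; rewrite /bigPlus.
elim: hs w w' h => //= x y xs ys hxy _ IH w w' h; apply: IH; exact: (steps_pm true).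
Qed.

Lemma inst_shift t u : inst (shift t) u = t.
Proof. by rewrite /inst subst_shift subst_id. Qed.

Lemma inst_replace t m u : inst (replace t m) u = inst t (inst m u).
Proof. by rewrite /inst /replace !subst_subst; apply: subst_ext => -[|i]. Qed.

Lemma inst_mixed i (us ts : seq (term S)) u : inst (mixed i us ts) u = Tup (take i us ++ u :: drop i.+1 ts).
Proof.
rewrite /inst /mixed /= map_cat /= !map_mapE.
by congr (Tup (_ ++ _ :: _)); rewrite -[RHS]map_id; apply: eq_map => x; exact: inst_shift.
Qed.

(** On the left is the body that arises when [x] is replaced by the mixed tuple [m] and the
    derivative at [m] is then taken in one component: [y] is replaced by the copy of [m] in which
    the fresh variable is the variable of differentiation. *)
Lemma replace_avoid t m :
  replace (subst (upsubst (fun i => if i is j.+1 then Var j.+1 else m)) (avoid t))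
    (rename (upren succn) m) = avoid (replace t m).
Proof.
rewrite /replace /avoid subst_rename rename_subst subst_subst; apply: subst_ext => -[|i] //=.
Qed.

(** Freezing every component but the i-th in a tuple that already varies in its i-th component alone
    changes only the variable. *)
Lemma mixed_mixed i (us ts : seq (term S)) : i < size us ->
  forall ms, mixed i us ts = Tup ms ->
  [/\ i < size ms, nth (Var 0) ms i = Var 0 & mixed i ms ms = rename (upren succn) (mixed i us ts)].
Proof.
move=> hi ms [<-]; have hsz : size (map shift (take i us)) = i by rewrite size_map size_take hi.
split.
- by rewrite size_cat hsz /= addnS ltnS leq_addr.
- by rewrite nth_cat hsz ltnn subnn.
- rewrite /mixed take_size_cat // drop_cat hsz ltnNge leqnSn /= subSnn /= drop0 map_cat /=.
  congr (Tup (_ ++ _ :: _)); rewrite !map_mapE; apply: eq_map => x;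
    by rewrite /shift [LHS]renameE [RHS]renameE !subst_rename.
Qed.

(** Along an edge the point of differentiation varies in component i only, and the i-th partial
    derivative of [t] there is the derivative of [t] restricted to the edge. Each summand of the
    integral thus has the form [int_der] again. *)
Lemma steps_Proj_Der_mixed G i (us ts : seq (term S)) t : i < size us ->
  steps G (Proj i (replace (Der (avoid t) (Var 0)) (mixed i us ts)))
    (Der (avoid (replace t (mixed i us ts))) (Var 0)).
Proof.
move=> hi; have [h1 h2 h3] := mixed_mixed hi (erefl (mixed i us ts)).
rewrite {1}/replace /=; apply: (steps_trans (steps_Proj i (steps_contr (R_DerAtTup _ _ _)))).
apply: steps_contr; constructor; rewrite onth_mkseq h1 h2 h3.
by rewrite replace_avoid.
Qed.

(** Here [w] is the partial sum leading from [c 0] to [c k]; generalizing over [k] follows the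
    association of [bigPlus] to the left. *)
Lemma sem_eq_telescope_seq T (c : nat -> term S) w ws k : addable T ->
  (forall i, i <= k + size ws -> typed [::] (c i) T /\ normalizing [::] (c i)) ->
  typed [::] w T -> normalizing [::] w -> sem_eq (M := M) T w (Minus (c k) (c 0)) ->
  (forall i x, onth ws i = Some x -> [/\ typed [::] x T, normalizing [::] x &
    sem_eq (M := M) T x (Minus (c (k + i).+1) (c (k + i)))]) ->
  sem_eq (M := M) T (bigPlus w ws) (Minus (c (k + size ws)) (c 0)).
Proof.
move=> hA; rewrite /bigPlus; elim: ws w k => [|x ws IH] w k hc tw nw ew hws /=.
  by rewrite addn0.
have [tx nx ex] := hws 0 x erefl; rewrite addn0 in ex.
have [t0 n0] := hc 0 (leq0n _); have [tk nk] := hc k (leq_addr _ _).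
have [tk' nk'] : typed [::] (c k.+1) T /\ normalizing [::] (c k.+1).
  by apply: hc; rewrite /= addnS ltnS leq_addr.
rewrite -addSnnS; apply: IH.
- by move=> i hi; apply: hc; rewrite /= -addSnnS.
- exact: (typed_pm true hA tw tx).
- exact: (normalizing_pm true hA tw tx nw nx).
- exact: (sem_eq_telescope HM hA tw tx t0 tk tk').
- by move=> i y hy; have := hws i.+1 y hy; rewrite addSnnS.
Qed.

(** If the integral never contracted at the root, its normal form would be stuck with a stuck lower
    limit, whose type would be interpretable and not a tuple. At tuple limits the only contraction
    possible is the one between tuples. *)
Lemma int_der_Tup_bounds a1 a2 t T T1 Ts : typed [::] (int_der a1 a2 t) T ->
  typed [::] a1 (TTup T1 Ts) -> normalizing [::] (int_der a1 a2 t) ->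
  exists ts1 ts2, steps [::] a1 (Tup ts1) /\ steps [::] a2 (Tup ts2).
Proof.
move=> hI h1 [n hn hi]; have [c hc hd] := steps_head (ex_intro _ _ hI) hn.
have tc := steps_typed (cong_steps hc) hI.
move/congP: hc tc hd => [U [x [y [d [-> _ sx sy _]]]]] tc hd; have tx := steps_typed sx h1.
case: hd => [e|[v hv _]].
  subst n; case: (nf_value (irreducible_nf (@ictx_nil S) tc hi)) => // hb.
  have {}hb : nb [::] x by inversion hb.
  by have [[]] := nb_ity hb tx.
inversion hv; subst; last (by exists ts1, ts2);
  match goal with H : isBase _ x |- _ => by have [? ?] := isBase_typed H tx end.
Qed.

(* Only the integral is assumed to be normalizing: [t] may get stuck on a tuple
   variable [y] in front of a diverging subterm that disappears once [y] is
   replaced by a tuple. *)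
Lemma newton_leibniz_diffable U T a1 a2 t : addable T -> diffable U ->
  typed [::] a1 U -> typed [::] a2 U -> typed [:: U] t T ->
  normalizing [::] (int_der a1 a2 t) ->
  [/\ sem_eq (M := M) T (int_der a1 a2 t) (Minus (inst t a2) (inst t a1)),
   normalizing [::] (inst t a1) & normalizing [::] (inst t a2)].
Proof.
move=> hA; elim/type_nested_ind: U a1 a2 t => [b|U1 Us IHs|//|//] a1 a2 t hd h1 h2 ht hN.
  have tI : typed [::] (int_der a1 a2 t) T by apply/typed_int_derE; exists (TBase b).
  (* With base limits nothing is substituted into the integrand, so the limits, the derivative and
     finally [t] are seen to normalize. *)
  have [n1 n2 nD] := normalizing_Int_inv h1 tI hN.
  have tV : typed [:: TBase b] (@Var S 0) (TBase b) by apply/typedP.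
  have hr := ren_up (T := TBase b) (@ren_succ _ (TBase b) [::]).
  have nt : normalizing [:: TBase b] t.
    apply: (normalizing_unrename hr); first by exists T.
    exact: (normalizing_Der_inv tV (typed_avoid (TBase b) ht) nD).
  split; [exact: (newton_leibniz_base hA h1 h2 ht n1 n2 nt) | |].
    exact: normalizing_inst ht nt h1 n1.
  exact: normalizing_inst ht nt h2 n2.
have tI : typed [::] (int_der a1 a2 t) T by apply/typed_int_derE; exists (TTup U1 Us).
have [ts1 [ts2 [s1 s2]]] := int_der_Tup_bounds tI h1 hN.
have tT1 := steps_typed s1 h1; have tT2 := steps_typed s2 h2.
have tt1 := typed_Tup_nth tT1; have tt2 := typed_Tup_nth tT2.
have hsz : size ts1 = size ts2 by rewrite (Forall2_size tt1) (Forall2_size tt2).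
(* This is [t] along the i-th edge: components before i are at the upper limit, those after i at the
   lower one. *)
pose ti i := replace t (mixed i ts2 ts1).
pose F i := int_der (nth (Var 0) ts1 i) (nth (Var 0) ts2 i) (ti i).
(* [F0] is the summand as the reduction rule produces it, and [F] the same after the i-th partial
   derivative has been selected. *)
pose F0 i := Int (nth (Var 0) ts1 i) (nth (Var 0) ts2 i)
  (Proj i (replace (Der (avoid t) (Var 0)) (mixed i ts2 ts1))).
have comp i : i < size ts1 -> exists Ui, [/\ onth (U1 :: Us) i = Some Ui, diffable Ui,
    typed [::] (nth (Var 0) ts1 i) Ui, typed [::] (nth (Var 0) ts2 i) Ui & typed [:: Ui] (ti i) T].
  move=> hi; have [x hx] := lt_onth hi; have [Ui hU hxU] := Forall2_getl tt1 hx.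
  have [y hy hyU] := Forall2_getr tt2 hU.
  exists Ui; rewrite (onth_nth (Var 0) _ _ _ hx) (onth_nth (Var 0) _ _ _ hy); split=> //.
    by apply: (@all_onth _ _ (U1 :: Us) i).
  exact: typed_replace ht (typed_mixed tt2 tt1 hU).
have hF : List.Forall2 (steps [::]) [seq F0 i | i <- iota 0 (size ts1)] [seq F i | i <- iota 0 (size ts1)].
  apply: Forall2_mkseq => i hi; have [Ui [_ _ q1 q2 _]] := comp i hi.
  apply: cong_steps; apply: (K_Int q1 q2); try exact: steps_refl.
  by apply: steps_Proj_Der_mixed; rewrite -hsz.
have pos : 0 < size ts1 by rewrite (Forall2_size tt1).
have [k hk] : exists k, size ts1 = k.+1 by exists (size ts1).-1; rewrite prednK.
have eF : [seq F i | i <- iota 0 (size ts1)] = F 0 :: [seq F i.+1 | i <- iota 0 k].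
  by rewrite hk /= -[1]addn0 iotaDl -map_comp.
have eF0 : [seq F0 i | i <- iota 0 (size ts1)] = F0 0 :: [seq F0 i.+1 | i <- iota 0 k].
  by rewrite hk /= -[1]addn0 iotaDl -map_comp.
set K := bigPlus (F 0) [seq F i.+1 | i <- iota 0 k].
have sK : steps [::] (int_der a1 a2 t) K.
  apply: (@steps_trans _ _ _ (int_der (Tup ts1) (Tup ts2) t)).
    by apply: (steps_int_der tI) => // *; exact: steps_refl.
  apply: (@steps_trans _ _ _ (bigPlus (F0 0) [seq F0 i.+1 | i <- iota 0 k])).
    by apply: steps_contr; apply: R_IntBetweenTup.
  exact: steps_bigPlus eF0 eF hF.
have tK := steps_typed sK tI.
have nK := normalizing_red_step (ex_intro _ _ tI) sK hN.
have [nF0 nFs] := normalizing_bigPlus_inv tK nK.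
have nF i : i < size ts1 -> normalizing [::] (F i).
  rewrite hk; case: i => // i; rewrite ltnS => hi.
  move/Forall_onth: nFs => /(_ i); apply.
  by rewrite onth_mkseq hi.
(* [c k] is [t] at the k-th vertex of the path, where the first k components have been moved to the
   upper limit. *)
pose c k := inst t (Tup (take k ts2 ++ drop k ts1)).
have ec1 i : i < size ts1 -> inst (ti i) (nth (Var 0) ts1 i) = c i.
  by move=> hi; rewrite /ti inst_replace inst_mixed -drop_nth.
have ec2 i : i < size ts1 -> inst (ti i) (nth (Var 0) ts2 i) = c i.+1.
  move=> hi; rewrite /ti inst_replace inst_mixed /c (take_nth (Var 0)) -?hsz //.
  by rewrite cat_rcons.
have IH i : i < size ts1 -> [/\ sem_eq (M := M) T (F i) (Minus (c i.+1) (c i)),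
    normalizing [::] (c i) & normalizing [::] (c i.+1)].
  move=> hi; have [Ui [hU dU q1 q2 q3]] := comp i hi.
  have /Forall_onth IH := IHs.
  by have := IH _ _ hU _ _ _ dU q1 q2 q3 (nF i hi); rewrite ec1 // ec2.
have nc i : i <= size ts1 -> normalizing [::] (c i).
  by case: i => [|i] hi; [have [] := IH 0 pos | have [] := IH i hi].
have tc i : typed [::] (c i) T.
  apply: typed_inst ht _; apply/typedP; exists U1, Us; split=> //.
  rewrite -(cat_take_drop i (U1 :: Us)); apply: List.Forall2_app.
    exact: Forall2_take.
  exact: Forall2_drop.
have c0 : c 0 = inst t (Tup ts1) by rewrite /c take0 drop0.
have cn : c (size ts1) = inst t (Tup ts2) by rewrite /c hsz take_size -hsz drop_size cats0.
have st1 : steps [::] (inst t a1) (c 0) by rewrite c0; apply: (steps_inst ht h1) s1; exact: steps_refl.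
have st2 : steps [::] (inst t a2) (c (size ts1)).
  by rewrite cn; apply: (steps_inst ht h2) s2; exact: steps_refl.
split; last 2 first.
- exact: normalizing_exp st1 (nc 0 (leq0n _)).
- exact: normalizing_exp st2 (nc _ (leqnn _)).
have [tF0 /Forall_onth tFs] := typed_bigPlus_inv tK.
have tM : typed [::] (Minus (c (size ts1)) (c 0)) T by exact: (typed_pm false).
apply: (sem_eq_conv tK tM); [exact: (join_sym (join_steps sK)) |
  by apply: join_sym; apply: join_steps; exact: (steps_pm false) |].
(* The index starts at 1 because the first summand already leads from vertex 0 to vertex 1. *)
have := @sem_eq_telescope_seq T c (F 0) [seq F i.+1 | i <- iota 0 k] 1 hA.
rewrite size_map size_iota add1n -hk; apply=> //.
- by move=> i hi; split; [exact: tc | exact: nc].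
- by have [] := IH 0 pos.
move=> i x; rewrite onth_mkseq; case: ifP => // hi [<-].
have hi' : i.+1 < size ts1 by rewrite hk ltnS.
have [e _ _] := IH _ hi'; split=> //; [|exact: nF].
by apply: (tFs i); rewrite onth_mkseq hi.
Qed.

End NewtonLeibniz.

Theorem theorem15 (S : signature) (M : interpretation S) (HM : base_laws M)
    (G : seq (type (base S))) (t t1 t2 : term S) :
  (exists T, typed G (int_der t1 t2 t) T) ->
  (exists T, typed G (Minus (inst t t2) (inst t t1)) T) ->
  weak_normalizable G (int_der t1 t2 t) ->
  weak_normalizable G (Minus (inst t t2) (inst t t1)) ->
  term_eq M G (int_der t1 t2 t) (Minus (inst t t2) (inst t t1)).
Proof.
set L := int_der t1 t2 t; set R := Minus _ _.
move=> [T hL] _ wL _ s hs.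
(* The substitution [s] is well typed at the variables that occur, and this is enough for the
   instance to be closed and typed. *)
have tL : typed [::] (subst s L) T.
  by apply: typed_subst_free hL => i U hf hi; case: (hs i U) => //; rewrite hf.
(* The type of a variable that does not occur may have no normalizing closed
   term, so such a variable is left free; closedness of the result is recovered by
   [normalizing_unrename]. *)
pose s' i := if free_in i L || free_in i R then s i else Var i.
have eL : subst s L = subst s' L by apply: subst_ext_free => i hf; rewrite /s' hf.
have [n hn hi] := weak_normalizable_normalizing (ex_intro _ _ hL) wL.
have tn := steps_typed hn hL.
(* Closed normalizing terms are reducible in the empty context and are carried into [G] by
   renaming. *)
have hr i U : onth G i = Some U -> red U G (s' i).
  move=> hU; rewrite /s'; case: ifP => [hf|_]; last exact: red_Var.
  have [ts ws] := hs i U hf hU.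
  have := normalizing_red ts (weak_normalizable_normalizing (ex_intro _ _ ts) ws).
  by move/(red_rename (@ren_nil _ id G)); rewrite rename_id.
(* [L] may contain [Fix], so the fundamental lemma is applied to an instance of its normal form [n],
   to which the instance of [L] reduces. *)
have nL : normalizing G (subst s' L).
  apply: normalizing_exp (red_normalizing (red_subst tn (irreducible_fixfree tn hi) hr)).
  by apply: steps_subst hn => i U /hr; exact: red_typed.
have {}nL : normalizing [::] (subst s L).
  apply: (normalizing_unrename (@ren_nil _ id G)); first by exists T.
  by rewrite rename_id eL.
have eR : subst s R = Minus (inst (subst (upsubst s) t) (subst s t2))
                            (inst (subst (upsubst s) t) (subst s t1)).
  by rewrite /R /= !subst_inst.
rewrite /L subst_int_der in tL nL *; rewrite eR.
have /typed_int_derE [U [hA hd h1 h2 ht]] := tL.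
have [h _ _] := newton_leibniz_diffable HM hA hd h1 h2 ht nL.
apply: sem_eq_closed tL _ h.
by apply: (typed_pm false hA); [exact: typed_inst ht h2 | exact: typed_inst ht h1].
Qed.
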